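(* Let $A,B$ be two FDDS. One can find in time polynomial in the sizes of $A$ and $B$ an FDDS $X$ such that $\mathcal{U}(A)\,\mathcal{U}(X)=\mathcal{U}(B)$, if any exists.
   Context: A finite discrete-time dynamical system (FDDS) is a pair $(S,f)$ with $S$ a finite set and $f:S\to S$, identified with its transition digraph and considered up to isomorphism; its size is $|S|$. A state is periodic if it lies on a cycle. For a periodic state $u$, the unroll tree in $u$ is the infinite rooted tree with vertex set $\{(s,k)\mid k\in\mathbb{N},\ f^k(s)=u\}$, root $(u,0)$ and arcs $(v,k)\to(f(v),k-1)$. The unroll $\mathcal{U}(A)$ is the multiset of unroll trees of $A$ (one per periodic state). The depth of a node of a rooted tree is its distance to the root. The product of rooted trees $\mathbf{t}_1=(V_1,E_1)$, $\mathbf{t}_2=(V_2,E_2)$ has vertex set $\{(v,u)\in V_1\times V_2\mid\mathrm{depth}(v)=\mathrm{depth}(u)\}$ and arcs $((v,u),(v',u'))$ whenever $(v,v')\in E_1$, $(u,u')\in E_2$. The product of two multisets of trees is the multiset of all pairwise products. Equality means isomorphism. *)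

(* Defs.v *)
From mathcomp Require Import all_boot.

Set Implicit Arguments.
Unset Strict Implicit.
Unset Printing Implicit Defensive.

Record fdds := FDDS { state : finType; step : state -> state }.

Definition fdds_size (A : fdds) : nat := #|state A|.

(* [s] lies on a cycle iff it can be reached again from its successor. *)
Definition periodic (A : fdds) : pred (state A) :=
  fun s => fconnect (@step A) (step s) s.

(* Possibly infinite rooted trees, arcs pointing towards the root. *)
Record rtree := RTree {
  vertex : choiceType;
  tree_root : vertex;
  tree_arc : rel vertex;
  root_sink : forall v, ~~ tree_arc tree_root v;
  arc_functional : forall v w w', tree_arc v w -> tree_arc v w' -> w = w';
  root_reachable :
    forall v, exists p, path tree_arc v p && (last v p == tree_root)
}.

(* The length of a path to the root; [depth_path] shows that all paths from
   [v] to the root have this length, so it is the distance to the root. *)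
Definition depth (t : rtree) (v : vertex t) : nat :=
  size (xchoose (root_reachable v)).

Lemma depth_path (t : rtree) (v : vertex t) (p : seq (vertex t)) :
  path (@tree_arc t) v p -> last v p = tree_root t -> size p = depth v.
Proof.
rewrite /depth; have /andP[] := xchooseP (root_reachable v).
move: (xchoose _) => q; elim: p v q => [|w p IHp] v [|x q] //=.
- by move=> /andP[vx _] _ _ vr; rewrite vr (negPf (root_sink x)) in vx.
- by move=> _ /eqP -> /andP[rw _]; rewrite (negPf (root_sink w)) in rw.
move=> /andP[vx xq] lq /andP[vw wp] lp; congr _.+1.
have xw := arc_functional vx vw; rewrite xw in xq lq.
exact: (IHp w q).
Qed.

Lemma depth_root (t : rtree) : depth (tree_root t) = 0.
Proof. by rewrite -(@depth_path t (tree_root t) [::]). Qed.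

Lemma depth_arc (t : rtree) (v w : vertex t) :
  tree_arc v w -> depth v = (depth w).+1.
Proof.
move=> vw; have [p /andP[wp /eqP lp]] := root_reachable w.
by rewrite -(depth_path wp lp) -(@depth_path t v (w :: p)) //= vw.
Qed.

Lemma depth_eq0 (t : rtree) (v : vertex t) : depth v = 0 -> v = tree_root t.
Proof.
have [[|w p] /andP[vp /eqP lp]] := root_reachable v; first by [].
by rewrite -(depth_path vp lp).
Qed.

Lemma depth_eqS (t : rtree) (v : vertex t) n :
  depth v = n.+1 -> exists2 w, tree_arc v w & depth w = n.
Proof.
move=> dv.
have [[|w p] /andP[vp /eqP lp]] := root_reachable v.
  by move: dv; rewrite -(depth_path vp lp).
case/andP: vp => vw _; exists w => //.
by move: dv; rewrite (depth_arc vw) => -[].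
Qed.

Definition tree_iso (t1 t2 : rtree) : Prop :=
  exists phi : vertex t1 -> vertex t2,
    [/\ bijective phi, phi (tree_root t1) = tree_root t2
      & forall v w, tree_arc (phi v) (phi w) = tree_arc v w].

Section TreeProduct.
Variables t1 t2 : rtree.

Definition same_depth : pred (vertex t1 * vertex t2) :=
  fun x => depth x.1 == depth x.2.
Definition prod_vertex : Type := {x | same_depth x}.

Lemma prod_root_subproof : same_depth (tree_root t1, tree_root t2).
Proof. by rewrite /same_depth /= !depth_root. Qed.

Definition prod_root : prod_vertex := Sub _ prod_root_subproof.

Definition prod_arc : rel prod_vertex :=
  fun x y => tree_arc (val x).1 (val y).1 && tree_arc (val x).2 (val y).2.

Lemma prod_root_sink x : ~~ prod_arc prod_root x.
Proof. by rewrite /prod_arc /= (negPf (root_sink _)). Qed.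

Lemma prod_arc_functional x y z : prod_arc x y -> prod_arc x z -> y = z.
Proof.
move=> /andP[xy1 xy2] /andP[xz1 xz2]; apply: val_inj.
rewrite [LHS]surjective_pairing [RHS]surjective_pairing.
by rewrite (arc_functional xy1 xz1) (arc_functional xy2 xz2).
Qed.

Lemma prod_root_reachable (x : prod_vertex) :
  exists p, path prod_arc x p && (last x p == prod_root).
Proof.
move: {2}(depth (val x).1) (erefl (depth (val x).1)) => n.
elim: n x => [|n IHn] [[v u] /= vu] dv.
  exists [::] => /=; apply/eqP/val_inj => /=.
  by rewrite (depth_eq0 dv) (@depth_eq0 t2 u) // -(eqP vu).
have [v' vv' dv'] := depth_eqS dv.
have [u' uu' du'] : exists2 u', tree_arc u u' & depth u' = n.
  by apply: depth_eqS; rewrite -(eqP vu).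
have vu' : same_depth (v', u') by rewrite /same_depth /= dv' du'.
have [p /andP[xp lp]] := IHn (Sub _ vu') dv'.
by exists (Sub _ vu' :: p); rewrite /= {1}/prod_arc /= vv' uu' xp.
Qed.

Definition tree_mul : rtree :=
  RTree prod_root_sink prod_arc_functional prod_root_reachable.

End TreeProduct.

Section UnrollTree.
Variables (A : fdds) (u : state A).

Definition leads_to_root : pred (state A * nat) :=
  fun x => iter x.2 (@step A) x.1 == u.
Definition unroll_vertex : Type := {x | leads_to_root x}.

Definition unroll_root : unroll_vertex := Sub (u, 0) (eqxx u).

Definition unroll_arc : rel unroll_vertex :=
  fun x y => (0 < (val x).2) && (val y == (step (val x).1, (val x).2.-1)).

Lemma unroll_root_sink x : ~~ unroll_arc unroll_root x.
Proof. by []. Qed.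

Lemma unroll_arc_functional x y z :
  unroll_arc x y -> unroll_arc x z -> y = z.
Proof.
by move=> /andP[_ /eqP xy] /andP[_ /eqP xz]; apply: val_inj; rewrite xy xz.
Qed.

Lemma unroll_root_reachable (x : unroll_vertex) :
  exists p, path unroll_arc x p && (last x p == unroll_root).
Proof.
case: x => [[s k] /= sk]; elim: k s sk => [|k IHk] s sk.
  by exists [::]; apply/eqP/val_inj; rewrite /= -(eqP sk).
have sk' : leads_to_root (step s, k) by rewrite /leads_to_root /= -iterSr.
have [p /andP[xp lp]] := IHk _ sk'.
by exists (Sub _ sk' :: p); rewrite /= {1}/unroll_arc /= eqxx xp.
Qed.

Definition unroll_tree : rtree :=
  RTree unroll_root_sink unroll_arc_functional unroll_root_reachable.

End UnrollTree.

(* Finite multisets of trees, as finite indexed families: equality is equality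
   of multisets of isomorphism classes. *)
Record forest := Forest {
  forest_index : finType;
  tree : forest_index -> rtree
}.

Definition forest_eq (F G : forest) : Prop :=
  exists2 sigma : forest_index F -> forest_index G,
    bijective sigma & forall i, tree_iso (tree i) (tree (sigma i)).

Definition forest_mul (F G : forest) : forest :=
  @Forest (forest_index F * forest_index G)%type
    (fun ij => tree_mul (tree ij.1) (tree ij.2)).

Definition unroll (A : fdds) : forest :=
  @Forest {u : state A | periodic u} (fun u => unroll_tree (val u)).

(* Model of computation: programs of a first-order, call-by-value functional
   language over binary trees, in the style of the language F of Jones
   (Computability and Complexity from a Programming Perspective), with a table
   of mutually recursive functions of one argument and local definitions.  Time
   is the number of rules applied in the evaluation.  Each rule is a
   constant-time operation on pointers to shared values (emptiness is the only
   test), so a function with values of polynomial size is computable in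
   polynomial time iff it is on a Turing machine. *)
Inductive data := Leaf | Node of data & data.

Definition hd (d : data) : data := if d is Node a _ then a else Leaf.
Definition tl (d : data) : data := if d is Node _ b then b else Leaf.

(* Variables are de Bruijn indices; [ELet] binds index 0. *)
Inductive expr :=
  | EVar of nat
  | ELeaf
  | ENode of expr & expr
  | EHd of expr
  | ETl of expr
  | EIf of expr & expr & expr
  | ELet of expr & expr
  | ECall of nat & expr.

(* The [f]-th entry is the body of the function [f], whose argument is
   variable 0; the main function is the first one. *)
Definition program := seq expr.

(* [eval p env e v k]: in the environment [env], the expression [e] evaluates
   to [v] in time [k]. *)
Inductive eval (p : program) : seq data -> expr -> data -> nat -> Prop :=
  | EvVar env i : eval p env (EVar i) (nth Leaf env i) 1
  | EvLeaf env : eval p env ELeaf Leaf 1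
  | EvNode env e1 e2 v1 v2 k1 k2 :
      eval p env e1 v1 k1 -> eval p env e2 v2 k2 ->
      eval p env (ENode e1 e2) (Node v1 v2) (k1 + k2).+1
  | EvHd env e v k : eval p env e v k -> eval p env (EHd e) (hd v) k.+1
  | EvTl env e v k : eval p env e v k -> eval p env (ETl e) (tl v) k.+1
  | EvIfLeaf env e e1 e2 v k k2 :
      eval p env e Leaf k -> eval p env e2 v k2 ->
      eval p env (EIf e e1 e2) v (k + k2).+1
  | EvIfNode env e e1 e2 a b v k k1 :
      eval p env e (Node a b) k -> eval p env e1 v k1 ->
      eval p env (EIf e e1 e2) v (k + k1).+1
  | EvLet env e1 e2 v1 v2 k1 k2 :
      eval p env e1 v1 k1 -> eval p (v1 :: env) e2 v2 k2 ->
      eval p env (ELet e1 e2) v2 (k1 + k2).+1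
  | EvCall env f e v w k1 k2 :
      eval p env e v k1 -> eval p [:: v] (nth ELeaf p f) w k2 ->
      eval p env (ECall f e) w (k1 + k2).+1.

Lemma eval_functional p env e v v' k k' :
  eval p env e v k -> eval p env e v' k' -> v = v' /\ k = k'.
Proof.
move=> ev; elim: ev v' k' => {env e v k} *;
  match goal with
  | H : eval _ _ _ ?v' _ |- _ = ?v' /\ _ => inversion H; subst
  end;
  repeat match goal with
  | IH : forall v' k', eval _ ?env ?e v' k' -> _, H : eval _ ?env ?e _ _ |- _ =>
    case: (IH _ _ H) => ? ?; subst; clear IH
  end; by [].
Qed.

Definition runs (p : program) (input output : data) (time : nat) : Prop :=
  eval p [:: input] (nth ELeaf p 0) output time.

Definition code_nat (n : nat) : data := iter n (Node Leaf) Leaf.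

Definition code_seq (s : seq nat) : data := foldr (Node \o code_nat) Leaf s.

(* The transition table: the states are numbered from 0 to [fdds_size A - 1]
   and the numbers of their successors listed.  Numbers are in unary, so the
   code has size O((fdds_size A)^2). *)
Definition code_fdds (A : fdds) : data :=
  code_seq [seq val (enum_rank (step s)) | s <- enum (state A)].

(* [Leaf] answers that there is no solution. *)
Definition code_answer (r : option fdds) : data :=
  if r is Some X then Node (code_fdds X) Leaf else Leaf.

(* Main.v *)
(**
Truncated at depth [k + 1], a tree is the multiset of its subtrees truncated at
depth [k].  Comparing first the truncations at depth [k], then these multisets
lexicographically from their largest element, gives a total preorder [tlt],
which multiplication by a tree preserves, strictly so if this tree has a branch
of length [k].  Hence trees with an infinite branch are cancellable.

Suppose that [B = A * Y] for multisets of trees, with [p] in [A] having an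
infinite branch.  Among the deepest trees of [B], the largest one is [b = a * y],
where [y] is the largest deepest tree of [Y], and [p * y] is then the least [r]
in [B] such that [a * r = p * b] for some [a] in [A].  Removing [A * y] from [B]
and iterating finds the part [p * Y] of [B].  Each tree [y] is thus represented
by the fraction [(p * y) / p], and all the tests are comparisons of products
[a * b], that is of vertices of the product of the two systems, which partition
refinement decides.

Applied to the periodic states, and then to the predecessors of every state, this
embeds the states of a solution [X] in those of [B]: the fraction of a state at
distance [j] from its cycle has as denominator the [j]-th predecessor of a fixed
periodic state of [A] on its cycle.  Only the cycles of [X] have to be rebuilt,
by matching the equal fractions.  A last comparison, of [A * X] with [B], tells
whether there is a solution at all.
*)

From Stdlib Require List.
Require Import Defs.
From mathcomp Require Import all_boot zify.

Set Implicit Arguments.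
Unset Strict Implicit.
Unset Printing Implicit Defensive.

(** * Orders on multisets and on finitely branching trees *)

(** Infinite trees are never handled directly: [O] is an abstract type of trees with finite lists of
    children, compared only down to a depth [k]. The obstacle is the choice of [k]. It has to be
    large enough for the vertices of the unknown [X], so the algorithm cannot know it. It need not:
    among [n] vertices, truncation stops separating trees at depth [n * n] at the latest, so what
    refinement computes on the product of the two given systems agrees with every larger depth. Only
    the correctness proof fixes a [k], as a sum of such bounds, some of them involving the size of
    [X]. The same stability replaces a compactness argument when truncations are turned back into
    isomorphisms of infinite trees.

    Since trees with an infinite branch are cancellable, the graph that is built has, when [A] has a
    state, the same unroll as any solution; hence a failed final comparison refutes every [X].

    An unroll tree looks only backwards, whereas rebuilding cycles requires successors: on a cycle,
    one step forwards is obtained as [c - 1] steps backwards, for a common period [c]. *)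

Lemma has_In (T : Type) (P : pred T) s :
  has P s <-> exists2 x, List.In x s & P x.
Proof.
elim: s => [|x s IHs] /=; first by split=> // -[].
split=> [/orP[Px|/IHs[y ys Py]]|[y [->|ys] Py]]; [by exists x; first left| |..].
- by exists y; first right.
- by rewrite Py.
by apply/orP; right; apply/IHs; exists y.
Qed.

Lemma all_In (T : Type) (P : pred T) s :
  all P s <-> forall x, List.In x s -> P x.
Proof.
elim: s => [|x s IHs] //=; split=> [/andP[Px /IHs Ps] y [<-|/Ps]|Ps] //.
by rewrite Ps; [apply/IHs => y ys; apply: Ps; right|left].
Qed.

(** * Multisets over a strict weak order, compared from their largest class *)

Section StrictWeakOrder.
Variables (T : Type) (l : rel T).

Definition tie : rel T := fun u v => ~~ l u v && ~~ l v u.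

Definition swo : Prop :=
  (forall u v, l u v -> ~~ l v u) /\ (forall u v w, l u w -> l u v || l v w).

(** The deciding class is sought among the listed elements, which makes the order a boolean; [mltP]
    shows that any element of [T] may serve as witness. *)
Definition mlt (X Y : seq T) : bool :=
  has (fun t => (count (tie t) X < count (tie t) Y)
    && all (fun s => l t s ==> (count (tie s) X == count (tie s) Y)) (X ++ Y))
    (X ++ Y).

Hypothesis l_swo : swo.

Lemma swo_irr u : l u u = false.
Proof. by apply/negP=> uu; have := l_swo.1 _ _ uu; rewrite uu. Qed.

Lemma swo_asym u v : l u v -> l v u = false.
Proof. by move/l_swo.1/negPf. Qed.

Lemma swo_trans u v w : l u v -> l v w -> l u w.
Proof.
move=> uv vw; case/orP: (l_swo.2 _ w _ uv) => // wv.
by rewrite (swo_asym wv) in vw.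
Qed.

Lemma nlt_trans u v w : ~~ l u v -> ~~ l v w -> ~~ l u w.
Proof. by move=> uv vw; apply/negP => /(l_swo.2 _ v)/orP[]; apply/negP. Qed.

Lemma nlt_lt_trans u v w : ~~ l v u -> l v w -> l u w.
Proof. by move=> vu /(l_swo.2 _ u); rewrite (negPf vu). Qed.

Lemma lt_nlt_trans u v w : l u v -> ~~ l w v -> l u w.
Proof. by move=> uv wv; move: (l_swo.2 _ w _ uv); rewrite (negPf wv) orbF. Qed.

Lemma tie_refl u : tie u u.
Proof. by rewrite /tie swo_irr. Qed.

Lemma tie_sym u v : tie u v = tie v u.
Proof. by rewrite /tie andbC. Qed.

Lemma tie_trans u v w : tie u v -> tie v w -> tie u w.
Proof.
by move=> /andP[a b] /andP[c d]; rewrite /tie (nlt_trans a c) (nlt_trans d b).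
Qed.

Lemma tie_eql u v : tie u v -> tie u =1 tie v.
Proof.
move=> uv w; apply/idP/idP; apply: tie_trans => //; by rewrite tie_sym.
Qed.

Lemma lt_tiel u v w : tie u v -> l u w = l v w.
Proof.
by move=> /andP[uv vu]; apply/idP/idP; apply: nlt_lt_trans.
Qed.

Lemma lt_tier u v w : tie u v -> l w u = l w v.
Proof.
by move=> /andP[uv vu]; apply/idP/idP => h; apply: (lt_nlt_trans h).
Qed.

Lemma lt_tie u v : l u v -> tie u v = false.
Proof. by rewrite /tie => ->. Qed.

Lemma has_maximal (P : pred T) s :
  has P s ->
  exists m, [/\ List.In m s, P m & all (fun x => P x ==> ~~ l m x) s].
Proof.
elim: s => //= x s IHs Pxs; have [/IHs[m [sm Pm mP]]|nPs] := boolP (has P s).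
  have [xm|] := boolP (P x && l m x); last first.
    rewrite negb_and -implybE => xm; exists m.
    by split; [right| |rewrite xm].
  case/andP: xm => Px mx; exists x; rewrite swo_irr implybT /=; split; [by left|by []|].
  apply: sub_all mP => y /implyP yP; apply/implyP => /yP my.
  by apply: contra my; apply: swo_trans.
exists x; rewrite swo_irr implybT /=.
split; [by left|by rewrite (negPf nPs) orbF in Pxs|].
by elim: s nPs {IHs Pxs} => //= y s IHs /norP[/negPf -> /IHs].
Qed.

Lemma mltP X Y :
  mlt X Y <-> exists2 t, count (tie t) X < count (tie t) Y
    & forall s, l t s -> count (tie s) X = count (tie s) Y.
Proof.
split=> [|[t ltXY eqXY]].
  move=> /has_In[t _ /andP[ltXY /all_In eqXY]].
  exists t => // s ts; have [|] := boolP (has (tie s) (X ++ Y)).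
    move=> /has_In[s' /eqXY + ss'].
    by rewrite -(lt_tier t ss') ts /= !(eq_count (tie_eql ss')) => /eqP.
  by rewrite has_cat => /norP[]; rewrite !has_count -!eqn0Ngt => /eqP -> /eqP.
have /has_In[s sY ts] : has (tie t) Y by rewrite has_count; apply: leq_trans ltXY.
apply/has_In; exists s; first by apply/List.in_or_app; right.
rewrite -!(eq_count (tie_eql ts)) ltXY /=.
apply/all_In => r _; apply/implyP; rewrite -(lt_tiel r ts) => /eqXY ->.
exact: eqxx.
Qed.

(** The largest class whose counts differ decides: above it all counts agree. *)
Lemma mlt_or_tie X Y :
  [\/ mlt X Y, mlt Y X | forall t, count (tie t) X = count (tie t) Y].
Proof.
pose P t := count (tie t) X != count (tie t) Y.
have Ptie s t : tie s t -> P s = P t.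
  by move=> st; rewrite /P !(eq_count (tie_eql st)).
have [/has_maximal[m [_ Pm /all_In mP]]|nP] := boolP (has P (X ++ Y)); last first.
  constructor 3 => t; apply/eqP; apply: contraNT nP => Pt.
  have : has (tie t) (X ++ Y).
    rewrite has_count count_cat lt0n addn_eq0.
    by apply/negP => /andP[/eqP cX /eqP cY]; rewrite /P cX cY in Pt.
  by case/has_In=> s sXY /Ptie Pts; apply/has_In; exists s; rewrite // -Pts.
have above s : l m s -> count (tie s) X = count (tie s) Y.
  move=> ms; apply/eqP; apply: contraTT ms => Ps.
  have : has (tie s) (X ++ Y).
    rewrite has_count count_cat lt0n addn_eq0.
    by apply/negP => /andP[/eqP cX /eqP cY]; rewrite /P cX cY in Ps.
  case/has_In=> s' /mP + ss'.
  by rewrite -(Ptie _ _ ss') -(lt_tier m ss') [P s]Ps.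
move: Pm; rewrite /P neq_ltn => /orP[] lt; [constructor 1|constructor 2];
  by apply/mltP; exists m => // s /above.
Qed.

Lemma mlt_asym X Y : mlt X Y -> ~~ mlt Y X.
Proof.
move=> /mltP[t tXY aXY]; apply/negP => /mltP[s sYX aYX].
have [ts|nts] := boolP (l t s); first by rewrite (aXY _ ts) ltnn in sYX.
have [st|nst] := boolP (l s t); first by rewrite (aYX _ st) ltnn in tXY.
have e : tie s t by rewrite /tie nst.
by rewrite !(eq_count (tie_eql e)) ltnNge ltnW in sYX.
Qed.

Lemma mlt_trans X Y Z : mlt X Y -> mlt Y Z -> mlt X Z.
Proof.
move=> /mltP[t tXY aXY] /mltP[s sYZ aYZ]; apply/mltP.
have [ts|nts] := boolP (l t s).
  exists s; first by rewrite (aXY _ ts).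
  by move=> r sr; rewrite aXY ?aYZ //; apply: swo_trans sr.
have [st|nst] := boolP (l s t).
  exists t; first by rewrite -(aYZ _ st).
  by move=> r tr; rewrite aXY ?aYZ //; apply: swo_trans tr.
have e : tie s t by rewrite /tie nst.
exists t; first by apply: ltn_trans tXY _; rewrite -!(eq_count (tie_eql e)).
by move=> r tr; rewrite aXY ?aYZ // (lt_tiel _ e).
Qed.

Lemma mlt_eql X Y Z :
  (forall t, count (tie t) X = count (tie t) Y) -> mlt X Z = mlt Y Z.
Proof.
by move=> XY; apply/idP/idP => /mltP[t tX aX]; apply/mltP; exists t => [|s /aX];
  rewrite ?XY // -XY.
Qed.

Lemma mlt_swo_tie X Y :
  (~~ mlt X Y && ~~ mlt Y X) <-> forall t, count (tie t) X = count (tie t) Y.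
Proof.
split=> [/andP[/negPf XY /negPf YX]|XY].
  by case: (mlt_or_tie X Y) => //; rewrite ?XY ?YX.
have irr Z : ~~ mlt Z Z by apply/negP => ZZ; have := mlt_asym ZZ; rewrite ZZ.
by rewrite (mlt_eql _ XY) -(mlt_eql X XY) !irr.
Qed.

Lemma mlt_negtrans X Y Z : mlt X Z -> mlt X Y || mlt Y Z.
Proof.
move=> XZ; case: (mlt_or_tie X Y) => [->|YX|XY] //.
  by rewrite (mlt_trans YX XZ) orbT.
by rewrite -(mlt_eql _ XY) XZ orbT.
Qed.

Definition meq X Y := forall t, count (tie t) X = count (tie t) Y.

Lemma meq_consl x X Y : meq (x :: X) Y ->
  exists Y1 y Y2, [/\ Y = Y1 ++ y :: Y2, tie x y & meq X (Y1 ++ Y2)].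
Proof.
move=> XY; have /has_In[y yY xy] : has (tie x) Y.
  by rewrite has_count -XY /= tie_refl.
have [Y1 [Y2 eY]] := List.in_split _ _ yY; exists Y1, y, Y2; split=> // t.
move: (XY t); rewrite eY !count_cat /= addnCA.
have -> : tie t x = tie t y by rewrite !(tie_sym t); apply: tie_eql.
by move/addnI.
Qed.

(** Matched elements are removed one by one, so a predicate constant on the classes does not
    distinguish the two lists. Most transports of a multiset equality through a function reduce to
    this. *)
Lemma meq_count Q X Y : meq X Y ->
  (forall u v, tie u v -> Q u = Q v) -> count Q X = count Q Y.
Proof.
move=> + Qtie; elim: X Y => [|x X IHX] Y XY.
  by case: Y XY => // y Y /(_ y); rewrite /= tie_refl.
have [Y1 [y [Y2 [-> xy]]]] := meq_consl XY.
move/IHX; rewrite /= !count_cat /= => ->.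
by rewrite (Qtie _ _ xy) addnCA.
Qed.

Lemma meq_size X Y : meq X Y -> size X = size Y.
Proof. by move=> XY; rewrite -!count_predT; apply: meq_count. Qed.

End StrictWeakOrder.

Lemma count_allpairs S T U (P : pred U) (f : S -> T -> U) X Y :
  count P [seq f x y | x <- X, y <- Y]
  = \sum_(x <- X) \sum_(y <- Y) P (f x y).
Proof.
rewrite count_flatten sumnE !big_map; apply: eq_bigr => x _.
by rewrite count_map -sum1_count big_mkcond.
Qed.

Lemma count_sum T (P : pred T) X : count P X = \sum_(x <- X) P x.
Proof. by rewrite -sum1_count big_mkcond. Qed.

Lemma has_allpairs S T U (P : pred U) (f : S -> T -> U) X Y :
  has P [seq f x y | x <- X, y <- Y] = has (fun x => has (fun y => P (f x y)) Y) X.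
Proof. by elim: X => //= x X IHX; rewrite has_cat IHX has_map. Qed.

Lemma eq_count_In T (P Q : pred T) s :
  (forall x, List.In x s -> P x = Q x) -> count P s = count Q s.
Proof.
elim: s => //= x s IHs PQ; rewrite PQ; last by left.
by rewrite IHs // => y ys; apply: PQ; right.
Qed.

Lemma eq_big_In T (F G : T -> nat) s :
  (forall x, List.In x s -> F x = G x) -> \sum_(x <- s) F x = \sum_(x <- s) G x.
Proof.
elim: s => [|x s IHs] FG; first by rewrite !big_nil.
by rewrite !big_cons FG ?IHs //; [move=> y ys; apply: FG; right|left].
Qed.

Lemma leq_sum_In T (F G : T -> nat) s :
  (forall x, List.In x s -> F x <= G x) -> \sum_(x <- s) F x <= \sum_(x <- s) G x.
Proof.
elim: s => [|x s IHs] FG; first by rewrite !big_nil.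
by rewrite !big_cons leq_add ?FG ?IHs //; [left|move=> y ys; apply: FG; right].
Qed.

Lemma ltn_sum_In T (F G : T -> nat) s x :
  (forall x, List.In x s -> F x <= G x) -> List.In x s -> F x < G x ->
  \sum_(x <- s) F x < \sum_(x <- s) G x.
Proof.
move=> FG xs ltFG; have [s1 [s2 es]] := List.in_split _ _ xs.
rewrite es !big_cat !big_cons /= addnCA [ltnRHS]addnCA -addSn leq_add //.
by rewrite leq_add // leq_sum_In // => y ys; apply: FG; rewrite es;
  apply/List.in_or_app; [left|right; right].
Qed.

(** * The preorder on truncated trees and its compatibility with products *)

Section TreeOrder.
Variables (O : Type) (ch : O -> seq O).

Fixpoint tlt k : rel O := fun u v =>
  if k is k'.+1 then
    tlt k' u v || ~~ tlt k' v u && mlt (tlt k') (ch u) (ch v)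
  else false.

Definition eqv k := tie (tlt k).

Fixpoint full k u := if k is k'.+1 then has (full k') (ch u) else true.

Lemma tlt_swo k : swo (tlt k).
Proof.
elim: k => [|k IHk]; first by split.
split=> [u v|u v w] /=.
  case/orP=> [uv|/andP[vu m]]; first by rewrite uv (swo_asym IHk uv).
  by rewrite negb_or vu negb_and (mlt_asym IHk m) orbT.
case/orP=> [/(IHk.2 _ v)/orP[->|->]|/andP[wu m]]; rewrite ?orbT //.
have [//|/= uv] := boolP (tlt k u v); have [|/= vw] := boolP (tlt k v w).
  by rewrite orbT.
rewrite (nlt_trans IHk vw wu) (nlt_trans IHk wu uv) /=.
exact: mlt_negtrans.
Qed.
Let tlts := tlt_swo.

Lemma eqv_refl k u : eqv k u u. Proof. exact: tie_refl. Qed.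
Lemma eqv_sym k u v : eqv k u v = eqv k v u. Proof. exact: tie_sym. Qed.
Lemma eqv_eql k u v : eqv k u v -> eqv k u =1 eqv k v.
Proof. exact: tie_eql. Qed.
Lemma eqv_eqr k u v w : eqv k u v -> eqv k w u = eqv k w v.
Proof. by move=> uv; rewrite !(eqv_sym k w); apply: eqv_eql. Qed.

Lemma tltW k u v : tlt k u v -> tlt k.+1 u v. Proof. by move=> /= ->. Qed.

Lemma eqvW k u v : eqv k.+1 u v -> eqv k u v.
Proof. by rewrite /eqv /tie /= => /andP[/norP[-> _] /norP[-> _]]. Qed.

Lemma eqvS k u v : eqv k.+1 u v <-> meq (tlt k) (ch u) (ch v).
Proof.
have eqvSE j x y : eqv j.+1 x y <-> eqv j x y /\ meq (tlt j) (ch x) (ch y).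
  rewrite /meq -(mlt_swo_tie (tlts j)) /eqv /tie /= !negb_or !negb_and !negbK.
  by case: (tlt j x y) (tlt j y x) => [] []; split=> // -[].
split=> [/eqvSE[] //|uv]; apply/eqvSE; split=> //.
elim: k u v uv => // k IHk u v uv; apply/eqvSE.
have uvk : meq (tlt k) (ch u) (ch v).
  move=> t; apply: (meq_count (tlts k.+1) uv) => x y /eqvW.
  exact: eqv_eqr.
by split=> //; apply: IHk.
Qed.

Lemma eqv_leq j k u v : j <= k -> eqv k u v -> eqv j u v.
Proof.
move=> /subnK <-; elim: (k - j) => // i IHi; rewrite addSn => /eqvW; exact: IHi.
Qed.

Lemma tlt_leq j k u v : j <= k -> tlt j u v -> tlt k u v.
Proof. by move=> /subnK <- uv; elim: (k - j) => // i; apply: tltW. Qed.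

Lemma fullW k u : full k.+1 u -> full k u.
Proof.
elim: k u => // k IHk u /has_In[v vu vk]; apply/has_In; exists v => //.
exact: IHk.
Qed.

Lemma full_leq j k u : j <= k -> full k u -> full j u.
Proof.
move=> /subnK <-; elim: (k - j) => // i IHi; rewrite addSn => /fullW; exact: IHi.
Qed.

Lemma eqv_full k u v : eqv k u v -> full k u = full k v.
Proof.
elim: k u v => // k IHk u v /eqvS uv /=.
by rewrite !has_count (meq_count (tlts k) uv IHk).
Qed.

(* Below its height a tree is determined: truncating it does nothing. *)
Lemma eqv_not_full k u v :
  ~~ full k.+1 u -> ~~ full k.+1 v -> eqv k u v -> eqv k.+1 u v.
Proof.
elim: k u v => [|k IHk] u v nu nv uv; apply/eqvS => t.
  by move: nu nv; rewrite /= !has_predT; case: (ch u) (ch v) => [] // [].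
have [ft|nt] := boolP (full k.+1 t).
  rewrite (_ : count _ _ = 0) 1?[RHS](_ : count _ _ = 0) //;
    apply/eqP; rewrite eqn0Ngt -has_count;
    [move: nv|move: nu]; apply: contra => /has_In[x xu /eqv_full];
    by rewrite ft => fx; apply/has_In; exists x.
have eqvk w : ~~ full k.+2 w ->
    count (tie (tlt k.+1) t) (ch w) = count (eqv k t) (ch w).
  move=> nw; apply: eq_count_In => x xw; apply/idP/idP => [/eqvW //|].
  by apply: IHk => //; apply: contra nw => fx; apply/has_In; exists x.
by rewrite !eqvk //; apply: (iffLR (eqvS k u v)).
Qed.

Lemma eqv_not_full_leq j k u v : j <= k ->
  ~~ full j.+1 u -> ~~ full j.+1 v -> eqv j u v -> eqv k u v.
Proof.
move=> /subnK <- nu nv uv; elim: (k - j) => // i IHi.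
by apply: eqv_not_full => //; [move: nu|move: nv]; apply: contra;
  apply: full_leq; rewrite ltnS leq_addl.
Qed.

Variable mul : O -> O -> O.
Hypothesis ch_mul :
  forall a b, ch (mul a b) = [seq mul x y | x <- ch a, y <- ch b].

Lemma full_mul k a b : full k (mul a b) = full k a && full k b.
Proof.
elim: k a b => //= k IHk a b; rewrite ch_mul has_allpairs.
apply/idP/andP => [/has_In[x xa /has_In[y yb]]|].
  by rewrite IHk => /andP[fx fy]; split; apply/has_In; [exists x|exists y].
case=> /has_In[x xa fx] /has_In[y yb fy]; apply/has_In; exists x => //.
by apply/has_In; exists y; rewrite // IHk fx.
Qed.

Lemma eqv_mulC k a b : eqv k (mul a b) (mul b a).
Proof.
elim: k a b => // k IHk a b; apply/eqvS => t.
rewrite !ch_mul !count_allpairs exchange_big; apply: eq_bigr => y _.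
by apply: eq_bigr => x _; congr nat_of_bool; apply: eqv_eqr.
Qed.

Lemma eqv_mulA k a b c : eqv k (mul a (mul b c)) (mul (mul a b) c).
Proof.
elim: k a b c => // k IHk a b c; apply/eqvS => t.
rewrite !ch_mul !count_allpairs big_allpairs_dep; apply: eq_bigr => x _.
rewrite big_allpairs_dep; apply: eq_bigr => y _.
by apply: eq_bigr => z _; congr nat_of_bool; apply: eqv_eqr.
Qed.

(** Monotonicity holds for every [a], since a short [a] only blurs the order; strictness asks for a
    branch of length [k]. Each relies on the other, so both are proved by a joint induction on the
    depth, in [mul_order]. *)
Let mul_mono k := forall a u v, tlt k (mul a u) (mul a v) -> tlt k u v.
Let mul_strict k :=
  forall a u v, full k a -> tlt k u v -> tlt k (mul a u) (mul a v).

Lemma mul_mono_eqv k a u v : mul_mono k -> eqv k u v -> eqv k (mul a u) (mul a v).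
Proof.
by move=> W /andP[uv vu]; apply/andP; split; [move: uv|move: vu]; apply: contra; apply: W.
Qed.

Lemma mul_mono_nlt k a u v :
  mul_mono k -> ~~ tlt k u v -> ~~ tlt k (mul u a) (mul v a).
Proof.
move=> W; apply: contra => lt; apply: (W a).
by rewrite (lt_tiel (tlts k) _ (eqv_mulC k a u)) (lt_tier (tlts k) _ (eqv_mulC k a v)).
Qed.

(** Let [t] be the largest class where the children of [u] and [v] differ, and [m] the largest child
    of [a] with a branch of length [k]. Then [m * t] is the largest class where the children of the
    products differ: a shorter child of [a] contributes equally to both sides, and a full child [x]
    is at most [m], so its first difference [x * t] is at most [m * t]. *)
Lemma mul_strictS k :
  (forall j, j <= k -> mul_mono j) -> mul_strict k -> mul_strict k.+1.
Proof.
move=> Wj S a u v fa; have W := Wj k (leqnn k); case/orP=> [uv|/andP[nvu]].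
  by apply: tltW; apply: S uv; apply: fullW.
have [uv _|nuv] := boolP (tlt k u v).
  by apply: tltW; apply: S uv; apply: fullW.
have uv : eqv k u v by apply/andP.
move=> /(mltP (tlts k))[t ltt gtt].
have /andP[_ nvu'] := mul_mono_eqv a W uv.
apply/orP; right; rewrite nvu' /=; apply/(mltP (tlts k)).
have [m [ma fm /all_In mmax]] := has_maximal (tlts k) fa.
(* The share of the child [x] in the count of the class of [s]. *)
pose c x s w := \sum_(y <- ch w) eqv k s (mul x y).
have cE w s : count (tie (tlt k) s) (ch (mul a w)) = \sum_(x <- ch a) c x s w.
  by rewrite ch_mul count_allpairs.
have c_count x s w : c x s w = count (fun y => eqv k s (mul x y)) (ch w).
  by rewrite count_sum.
(* The products by such an [x] have no branch of length [k]: they are determined at depth [k - 1],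
   where the children of [u] and [v] agree. *)
have c_not_full x s : ~~ full k x -> c x s u = c x s v.
  move=> nx; rewrite !c_count; case: (posnP k) => [k0|k_gt0].
    by rewrite k0 in nx.
  rewrite -(prednK k_gt0) in uv nx *; set j := k.-1 in uv nx *.
  have /eqvS uvj := uv; apply: (meq_count (tlts j) uvj) => y z yz.
  apply: eqv_eqr; apply: eqv_not_full; rewrite ?full_mul ?negb_and ?nx //.
  by apply: mul_mono_eqv => //; apply: Wj; rewrite leq_pred.
(* For [s] not below [m * t], the share of a full [x] changes only if [s] ties with [x * t], and
   then [x * t] ties with [m * t]. *)
have c_full x s : List.In x (ch a) -> full k x -> ~~ tlt k s (mul m t) ->
    if eqv k s (mul x t) then eqv k s (mul m t) /\ c x s u < c x s v
    else c x s u = c x s v.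
  move=> xa fx nst; have xtmt : ~~ tlt k (mul m t) (mul x t).
    by apply: mul_mono_nlt => //; move/implyP: (mmax x xa); apply.
  have cy y : eqv k s (mul x y) -> forall w, c x s w = count (eqv k y) (ch w).
    move=> sy w; rewrite c_count; apply: eq_count => z.
    rewrite (eqv_eql sy); apply/idP/idP => [/andP[yz zy]|]; last exact: mul_mono_eqv.
    by apply/andP; split; [move: yz|move: zy]; apply: contra; apply: S.
  case: ifP => [st|nst'].
    rewrite !(cy t) //; split=> //; apply/andP; split=> //.
    by rewrite (lt_tier (tlts k) _ st).
  have [|] := boolP (has (fun y => eqv k s (mul x y)) (ch u ++ ch v)).
    move=> /has_In[y _ sy]; rewrite !(cy y) //; apply: gtt.
    apply: contraFT nst' => nty; rewrite (eqv_eql sy).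
    apply: mul_mono_eqv => //; apply/andP; split=> //.
    apply: contra nst => /(S _ _ _ fx); rewrite -(lt_tiel (tlts k) _ sy) => sxt.
    exact: (lt_nlt_trans (tlts k) sxt).
  rewrite has_cat => /norP[]; rewrite !has_count -!eqn0Ngt -!c_count.
  by move=> /eqP -> /eqP ->.
exists (mul m t) => [|s mts].
  rewrite !cE; apply: (@ltn_sum_In _ _ _ _ m) => // [x xa|].
    have [fx|/c_not_full -> //] := boolP (full k x).
    have := c_full x (mul m t) xa fx.
    by rewrite swo_irr // => /(_ isT); case: ifP => [_ [_ /ltnW]|_ ->].
  by have := c_full m (mul m t) ma fm; rewrite swo_irr // eqv_refl => /(_ isT)[].
rewrite !cE; apply: eq_big_In => x xa.
have [fx|/c_not_full -> //] := boolP (full k x).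
have := c_full x s xa fx; rewrite (swo_asym (tlts k) mts) => /(_ isT).
by case: ifP => // _ [sm _]; rewrite eqv_sym /eqv (lt_tie mts) in sm.
Qed.

(** A full [a] preserves strict inequalities and ties, hence reflects the order; otherwise both
    products lack a branch of length [k + 1] and compare as at depth [k]. *)
Lemma mul_monoS k : mul_mono k -> mul_strict k -> mul_strict k.+1 -> mul_mono k.+1.
Proof.
move=> W S S1 a u v; case: (boolP (full k.+1 a)) => [fa|na].
  have [uv|] := boolP (tlt k.+1 u v) => // nuv.
  have [/(S1 _ _ _ fa) vu|nvu] := boolP (tlt k.+1 v u).
    by rewrite (swo_asym (tlts _) vu).
  have /eqvS uv : eqv k.+1 u v by apply/andP.
  rewrite -[tlt k.+1 _ _]negbK; suff /andP[-> _] : eqv k.+1 (mul a u) (mul a v) by [].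
  apply/eqvS => t; rewrite !ch_mul !count_allpairs; apply: eq_bigr => x _.
  rewrite -!count_sum; apply: (meq_count (tlts k) uv) => y z /(mul_mono_eqv x W).
  exact: eqv_eqr.
have [/W uv _|nuv] := boolP (tlt k (mul a u) (mul a v)); first exact: tltW.
have [vu|nvu] := boolP (tlt k (mul a v) (mul a u)).
  by rewrite (swo_asym (tlts _) (tltW vu)).
have /andP[/negPf -> //] : eqv k.+1 (mul a u) (mul a v).
by apply: eqv_not_full; rewrite ?full_mul ?negb_and ?na //; apply/andP.
Qed.

(** Strictness at [k + 1] uses monotonicity at [k - 1] for the short children, so monotonicity is
    carried for all smaller depths. *)
Lemma mul_order k : mul_mono k /\ mul_strict k.
Proof.
suff: (forall j, j <= k -> mul_mono j) /\ mul_strict k by case=> /(_ k (leqnn k)).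
elim: k => [|k [Wk Sk]].
  by split=> [j|//]; rewrite leqn0 => /eqP -> a u v.
have S1 := mul_strictS Wk Sk; split=> // j.
rewrite leq_eqVlt ltnS => /orP[/eqP ->|/Wk //].
exact: mul_monoS (Wk k _) _ _.
Qed.

Lemma tlt_mul2l k a u v : tlt k (mul a u) (mul a v) -> tlt k u v.
Proof. exact: (mul_order k).1. Qed.

Lemma full_tlt_mul2l k a u v : full k a -> tlt k (mul a u) (mul a v) = tlt k u v.
Proof.
by move=> fa; apply/idP/idP; [apply: tlt_mul2l|apply: (mul_order k).2].
Qed.

Lemma eqv_mul2l k a u v : eqv k u v -> eqv k (mul a u) (mul a v).
Proof. exact: mul_mono_eqv (mul_order k).1. Qed.

Lemma eqv_mul2r k a u v : eqv k u v -> eqv k (mul u a) (mul v a).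
Proof.
move=> /(eqv_mul2l a); rewrite (eqv_eql (eqv_mulC k a u)).
by rewrite (eqv_eqr _ (eqv_mulC k a v)).
Qed.

Lemma full_eqv_mul2l k a u v : full k a -> eqv k (mul a u) (mul a v) = eqv k u v.
Proof. by move=> fa; rewrite /eqv /tie !full_tlt_mul2l. Qed.

End TreeOrder.

(** * Division of multisets of trees *)

Lemma meq_In T (l : rel T) : swo l ->
  forall X Y x, meq l X Y -> List.In x X -> exists2 y, List.In y Y & tie l x y.
Proof.
move=> ls X Y x XY xX; apply/has_In; rewrite has_count -XY -has_count.
by apply/has_In; exists x => //; apply: tie_refl.
Qed.

Lemma meq_sym T (l : rel T) X Y : meq l X Y -> meq l Y X.
Proof. by move=> XY t. Qed.

Lemma meq_trans T (l : rel T) X Y Z : meq l X Y -> meq l Y Z -> meq l X Z.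
Proof. by move=> XY YZ t; rewrite XY. Qed.

Lemma In_allpairs S T U (f : S -> T -> U) X Y z :
  List.In z [seq f x y | x <- X, y <- Y] <->
  exists x y, [/\ List.In x X, List.In y Y & z = f x y].
Proof.
elim: X => [|x X IHX] /=; first by split=> // -[? [? []]].
rewrite List.in_app_iff IHX List.in_map_iff.
split=> [[[y [<- yY]]|[x' [y [x'X yY ->]]]]|[x' [y [[->|x'X] yY ->]]]].
- by exists x, y; split=> //; left.
- by exists x', y; split=> //; right.
- by left; exists y.
- by right; exists x', y.
Qed.

Lemma In_mem (U : eqType) (x : U) s : List.In x s <-> x \in s.
Proof.
elim: s => //= y s ->; rewrite in_cons; split=> [[->|->]|/orP[/eqP->|]];
  by rewrite ?eqxx ?orbT; auto.
Qed.

Lemma head_filter (U : eqType) (x0 : U) (P : pred U) s :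
  has P s -> head x0 [seq x <- s | P x] \in s /\ P (head x0 [seq x <- s | P x]).
Proof.
rewrite has_filter; case e: [seq x <- s | P x] => [//|x t] _ /=.
by have : x \in [seq x <- s | P x]; [rewrite e mem_head|rewrite mem_filter => /andP[]].
Qed.

Lemma filter_neq_perm (U : eqType) (x : U) s :
  uniq s -> x \in s -> perm_eq s (x :: [seq y <- s | y != x]).
Proof. by move=> us xs; rewrite -rem_filter //; apply: perm_to_rem. Qed.

Section Height.
Variables (O : Type) (ch : O -> seq O).

(** The length of the longest branch, capped at [k]; trees with an infinite branch have the greatest
    height, [k]. *)
Fixpoint height k u := if k is k'.+1 then if full ch k u then k else height k' u else 0.

Lemma heightS k u : height k.+1 u = if full ch k.+1 u then k.+1 else height k u.
Proof. by []. Qed.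

Lemma leq_height k j u : j <= k -> (j <= height k u) = full ch j u.
Proof.
elim: k => [|k IHk]; first by rewrite leqn0 => /eqP ->.
rewrite leq_eqVlt => /orP[/eqP ->|]; last first.
  rewrite ltnS => jk; rewrite heightS; case: ifP => [fu|_]; last exact: IHk.
  by rewrite leqW // (full_leq _ fu) // leqW.
rewrite heightS; case: ifP => _; first exact: leqnn.
apply/negbTE; rewrite -ltnNge ltnS.
by elim: k {IHk} => //= k IHk; case: ifP => // _; apply: leq_trans IHk _.
Qed.

Lemma height_leq k u : height k u <= k.
Proof. by elim: k => //= k IHk; case: ifP => // _; apply: leqW. Qed.

Lemma height_full k u : full ch (height k u) u.
Proof. by rewrite -(leq_height (k := k)) // height_leq. Qed.

Lemma height_leqP k u v :
  reflect (forall j, j <= k -> full ch j u -> full ch j v) (height k u <= height k v).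
Proof.
apply: (iffP idP) => [uv j jk|uv]; last first.
  by rewrite leq_height ?height_leq //; apply: uv; rewrite ?height_leq ?height_full.
by rewrite -!(leq_height _ jk) => ju; apply: leq_trans uv.
Qed.

Lemma eqv_height k u v : eqv ch k u v -> height k u = height k v.
Proof.
move=> uv; apply/eqP; rewrite eqn_leq; apply/andP; split; apply/height_leqP => j jk;
  by rewrite (eqv_full (eqv_leq jk uv)).
Qed.

Lemma full_height k u : full ch k u -> height k u = k.
Proof.
by move=> fu; apply/eqP; rewrite eqn_leq height_leq leq_height.
Qed.

Variable mul : O -> O -> O.
Hypothesis ch_mul :
  forall a b, ch (mul a b) = [seq mul x y | x <- ch a, y <- ch b].

Lemma height_mul k u v : height k (mul u v) = minn (height k u) (height k v).
Proof.
apply/eqP; rewrite eqn_leq leq_min; apply/andP; split; last first.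
  rewrite leq_height ?(full_mul ch_mul); last by rewrite geq_min height_leq.
  by rewrite -!(@leq_height k) ?geq_minl ?geq_minr // geq_min height_leq.
by apply/andP; split; apply/height_leqP => j _; rewrite (full_mul ch_mul) => /andP[].
Qed.

(* Trees with the same height [j] are compared by their truncations at depth [j]. *)
Lemma tlt_mul_height k a u v : height k u = height k v -> height k u <= height k a ->
  tlt ch k u v -> tlt ch k (mul a u) (mul a v).
Proof.
set j := height k u => huv ja uv.
have jk : j <= k by apply: height_leq.
have fa : full ch j a by rewrite -(leq_height _ jk).
apply: (tlt_leq jk); rewrite (full_tlt_mul2l ch_mul) //.
have nvu : ~~ tlt ch j v u.
  by apply/negP => /(tlt_leq jk); rewrite (swo_asym (tlt_swo ch k) uv).
apply: contraTT uv => nuv; suff /andP[] : eqv ch k u v by [].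
have e : eqv ch j u v by apply/andP.
move: jk; rewrite leq_eqVlt => /orP[/eqP <- //|jk].
by apply: (eqv_not_full_leq (ltnW jk)) e; rewrite -(leq_height _ jk) -?huv ltnn.
Qed.

(** Heights come first because multiplication by an [a] with finite branches is known to be strict
    only between trees of equal height not exceeding its own ([tlt_mul_height]). *)
Definition hlt k : rel O := fun u v =>
  (height k u < height k v) || (height k u == height k v) && tlt ch k u v.

Lemma hlt_swo k : swo (hlt k).
Proof.
rewrite /hlt; split=> [u v|u v w].
  case: (ltngtP (height k u) (height k v)) => //= _; exact: (tlt_swo ch k).1.
case: (ltngtP (height k u) (height k w)) => //= [uw _|-> uw].
  by case: (ltngtP (height k u) (height k v)) => //= [vu|<-]; rewrite ?(ltn_trans vu) ?uw ?orbT.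
case: (ltngtP (height k w) (height k v)) => //= _; exact: (tlt_swo ch k).2.
Qed.

End Height.

Section DivisionStep.
Variables (O : Type) (ch : O -> seq O) (mul : O -> O -> O) (k : nat).
Hypothesis ch_mul :
  forall a b, ch (mul a b) = [seq mul x y | x <- ch a, y <- ch b].
Let lt_swo := tlt_swo ch k.
Let ordk := hlt_swo ch k.

Lemma meq_mulr_cons A Y1 y Y2 :
  meq (tlt ch k) [seq mul x z | x <- A, z <- Y1 ++ y :: Y2]
    ([seq mul x y | x <- A] ++ [seq mul x z | x <- A, z <- Y1 ++ Y2]).
Proof.
move=> t; rewrite count_cat !count_allpairs count_map count_sum -big_split.
by apply: eq_bigr => x _; rewrite !big_cat big_cons /= addnCA.
Qed.

Variables (A R Y : seq O) (p : O).
Hypotheses (pA : List.In p A) (fp : full ch k p).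
Hypothesis RAY : meq (tlt ch k) R [seq mul x y | x <- A, y <- Y].

(* Among the trees of [R] of maximal height, the largest one is [a * y] for the
   largest [y] of maximal height and some [a], and [p * y] is then the least [r]
   such that some [a] in [A] satisfies [a * r = p * (a * y)]. *)
Lemma division_step b :
  List.In b R -> (forall r, List.In r R -> ~~ hlt ch k b r) ->
  exists y, List.In y Y /\
  exists r0, [/\ List.In r0 R, eqv ch k r0 (mul p y),
    exists2 a, List.In a A & eqv ch k (mul a r0) (mul p b)
  & forall r a, List.In r R -> List.In a A ->
      eqv ch k (mul a r) (mul p b) -> ~~ tlt ch k r r0].
Proof.
move=> bR bmax.
have [_ /In_allpairs[a0 [y0 [a0A y0Y ->]]] ba0y0] := meq_In lt_swo RAY bR.
have [y [yY _ ymax]] : exists m, [/\ List.In m Y, true & all (fun x => true ==> ~~ hlt ch k m x) Y].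
  by apply: (has_maximal ordk (P := predT)); apply/has_In; exists y0.
move/all_In: ymax => ymax.
have in_R a z : List.In a A -> List.In z Y -> exists2 r, List.In r R & eqv ch k (mul a z) r.
  move=> aA zY; apply: (meq_In lt_swo (meq_sym RAY)).
  by apply/In_allpairs; exists a, z.
have [r0 r0R r0py] := in_R _ _ pA yY.
have le_b a z : List.In a A -> List.In z Y -> height ch k (mul a z) <= height ch k b.
  move=> aA zY; have [r rR e] := in_R _ _ aA zY; rewrite (eqv_height e).
  by move: (bmax r rR); rewrite negb_or -leqNgt => /andP[].
have hp : height ch k p = k by apply: full_height.
have hpm z : height ch k (mul p z) = height ch k z.
  by rewrite (height_mul ch_mul) hp (minn_idPr _) ?height_leq.
have hy0 : height ch k y0 <= height ch k y.
  by move: (ymax y0 y0Y); rewrite negb_or -leqNgt => /andP[].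
have hb0 : height ch k b = minn (height ch k a0) (height ch k y0).
  by rewrite (eqv_height ba0y0) (height_mul ch_mul).
have hyb : height ch k y <= height ch k b by rewrite -hpm le_b.
(* [p * y] has the height of [y] and occurs in [R], where [b = a0 * y0] is deepest: so [b], [y] and
   [y0] have the same height. *)
have /andP[/eqP hby /eqP hy0y] : (height ch k b == height ch k y) && (height ch k y0 == height ch k y).
  rewrite !eqn_leq hyb hy0 !andbT; apply/andP; split.
    by rewrite (leq_trans _ hy0) // hb0 geq_minr.
  by rewrite (leq_trans hyb) // hb0 geq_minr.
have le_b' a : List.In a A -> height ch k y <= height ch k a -> ~~ tlt ch k b (mul a y).
  move=> aA hya; have [r rR ayr] := in_R _ _ aA yY.
  rewrite (lt_tier lt_swo _ ayr); have := bmax r rR; rewrite /hlt -(eqv_height ayr).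
  by rewrite (height_mul ch_mul) (minn_idPr hya) hby ltnn eqxx.
have ha0 : height ch k y <= height ch k a0.
  by rewrite (leq_trans hyb) // hb0 geq_minl.
(* [b] is also [a0 * y]: [y0] is at most [y], and [b] is maximal. *)
have a0yb : eqv ch k (mul a0 y) b.
  rewrite /eqv /tie le_b' // andbT (lt_tier lt_swo _ ba0y0).
  apply/negP => /(tlt_mul2l ch_mul) yy0.
  by move: (ymax y0 y0Y); rewrite /hlt hy0y yy0 eqxx orbT.
have swap a z : eqv ch k (mul a (mul p z)) (mul p (mul a z)).
  rewrite (eqv_eql (eqv_mulA ch_mul k a p z)) (eqv_eqr _ (eqv_mulA ch_mul k p a z)).
  by apply: eqv_mul2r => //; apply: eqv_mulC.
exists y; split=> //; exists r0; split=> //; first by rewrite eqv_sym.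
  exists a0 => //; rewrite -(eqv_eql (eqv_mul2l ch_mul a0 r0py)) (eqv_eql (swap _ _)).
  exact: eqv_mul2l.
(* A smaller [r] would give [a * r < a * r0], that is [p * b < p * (a * y)]; cancelling [p]
   contradicts the maximality of [b]. *)
move=> r a rR aA arpb; apply/negP => rr0.
have hapb : minn (height ch k a) (height ch k r) = height ch k y.
  by rewrite -(height_mul ch_mul) (eqv_height arpb) hpm.
have hya : height ch k y <= height ch k a by rewrite -hapb geq_minl.
have hr : height ch k r = height ch k y.
  apply/eqP; rewrite eqn_leq -{2}hapb geq_minr andbT -hby.
  by move: (bmax r rR); rewrite negb_or -leqNgt => /andP[].
have : tlt ch k (mul a r) (mul a r0).
  by apply: tlt_mul_height => //; rewrite ?hr // -(eqv_height r0py) hpm.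
rewrite (lt_tiel lt_swo _ arpb) -(lt_tier lt_swo _ (eqv_mul2l ch_mul a r0py)).
rewrite (lt_tier lt_swo _ (swap _ _)) (full_tlt_mul2l ch_mul) //.
by apply/negP; apply: le_b'.
Qed.

End DivisionStep.

Section Division.
Variables (S T : eqType) (lt : rel (S * T)) (deeper : rel T) (d : T).
Variables (DA : seq S) (p : S).

(** Only products of an element of [DA] and an element of [DB] can be compared, so [b] and [b'] are
    compared as [p * b] and [p * b'], which is faithful when [p] has an infinite branch. *)
Definition deepest R :=
  head d [seq b <- R | all (fun b' => deeper b b' && (deeper b' b ==> ~~ lt (p, b) (p, b'))) R].

Definition quotients R :=
  [seq r <- R | has (fun a => tie lt (a, r) (p, deepest R)) DA].

Definition quotient R :=
  head d [seq r <- quotients R | all (fun r' => ~~ lt (p, r') (p, r)) (quotients R)].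

(** When [r] stands for [p * y], the equation [p * b = a * r] says that [b] is [a * y]. Removing by
    value removes one occurrence, the lists being duplicate-free. *)
Definition remove_mul r R a :=
  [seq b <- R | b != head d [seq b <- R | tie lt (p, b) (a, r)]].

(** The quotient [r] is itself the product of [p] and the [y] that is found, so [p] is left out of
    the other removals. The result is kept as a sublist of [DB], which bounds its size. *)
Definition division_iter DB (acc : seq T * seq T) :=
  (foldl (remove_mul (quotient acc.1)) [seq b <- acc.1 | b != quotient acc.1]
     [seq a <- DA | a != p],
   [seq b <- DB | (b == quotient acc.1) || (b \in acc.2)]).

Definition division DB := (iter (size DB) (division_iter DB) (DB, [::])).2.

End Division.

Section DivisionCorrect.
Variables (S T : eqType) (lt : rel (S * T)) (deeper : rel T) (d : T).
Variables (DA : seq S) (p : S) (DB : seq T).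
Variables (O : Type) (ch : O -> seq O) (mul : O -> O -> O) (k : nat).
Hypothesis ch_mul :
  forall a b, ch (mul a b) = [seq mul x y | x <- ch a, y <- ch b].
Variables (oS : S -> O) (oT : T -> O).
Hypotheses (pDA : p \in DA) (fp : full ch k (oS p)) (DAuniq : uniq DA).
Hypotheses (dDB : d \notin DB) (DBuniq : uniq DB).
Hypothesis ltE : {in DA & DB, forall a b, {in DA & DB, forall a' b',
  lt (a, b) (a', b') = tlt ch k (mul (oS a) (oT b)) (mul (oS a') (oT b'))}}.
Hypothesis deeperE : {in DB &, forall b b',
  deeper b b' = (height ch k (oT b') <= height ch k (oT b))}.
Let lt_swo := tlt_swo ch k.

Lemma tieE a b a' b' : a \in DA -> b \in DB -> a' \in DA -> b' \in DB ->
  tie lt (a, b) (a', b') = eqv ch k (mul (oS a) (oT b)) (mul (oS a') (oT b')).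
Proof. by move=> *; rewrite /tie !ltE. Qed.

Lemma meq_filter_neq R b y rest : uniq R -> b \in R -> eqv ch k (oT b) y ->
  meq (tlt ch k) (map oT R) (y :: rest) ->
  meq (tlt ch k) (map oT [seq x <- R | x != b]) rest.
Proof.
move=> uR bR byy H t; have := H t.
rewrite !count_map (permP (filter_neq_perm uR bR)) /=.
by rewrite -/(eqv ch k t (oT b)) (eqv_eqr t byy) => /addnI.
Qed.

Lemma foldl_remove_mul r y l R rest :
  r \in DB -> eqv ch k (oT r) (mul (oS p) y) -> {subset l <= DA} ->
  uniq R -> {subset R <= DB} ->
  meq (tlt ch k) (map oT R) ([seq mul (oS a) y | a <- l] ++ rest) ->
  let R' := foldl (remove_mul lt d p r) R l in
  [/\ uniq R', {subset R' <= R} & meq (tlt ch k) (map oT R') rest].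
Proof.
move=> rDB ry; elim: l R => [|a l IHl] R /= lDA uR RDB H; first by split.
have aDA : a \in DA by rewrite lDA ?mem_head.
pose b := head d [seq b <- R | tie lt (p, b) (a, r)].
rewrite -[remove_mul lt d p r R a]/([seq x <- R | x != b]).
(* From [p * x = a * r = a * (p * y)], cancelling [p] gives [x = a * y]. *)
have test x : x \in R -> tie lt (p, x) (a, r) = eqv ch k (oT x) (mul (oS a) y).
  move=> xR; rewrite tieE ?rDB ?(RDB x) // (eqv_eqr _ (eqv_mul2l ch_mul _ ry)).
  rewrite (eqv_eqr _ (eqv_mulA ch_mul k _ _ _)).
  rewrite (eqv_eqr _ (eqv_mul2r ch_mul _ (eqv_mulC ch_mul k _ _))).
  by rewrite -(eqv_eqr _ (eqv_mulA ch_mul k _ _ _)) full_eqv_mul2l.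
have [bR bP] : b \in R /\ tie lt (p, b) (a, r).
  apply: head_filter; have /meq_sym H' := H.
  have [|x] := meq_In lt_swo H' (_ : List.In (mul (oS a) y) _); first by left.
  move=> /List.in_map_iff[x' [<- /In_mem xR]]; rewrite tie_sym => xe.
  by apply/hasP; exists x'; rewrite ?test.
rewrite test // in bP.
have [||||u s m] := IHl [seq x <- R | x != b].
- by move=> x xl; rewrite lDA // in_cons xl orbT.
- exact: filter_uniq.
- by move=> x; rewrite mem_filter => /andP[_ /RDB].
- exact: meq_filter_neq H.
by split=> // x /s; rewrite mem_filter => /andP[].
Qed.

(** [Y1] is the part of [Y] still to be found, [Y2] the part already found. The truncated
    subtraction covers the rounds that follow exhaustion. *)
Definition division_inv (Y : seq O) (acc : seq T * seq T) n :=
  exists Y1 Y2, [/\ size Y1 = size Y - n /\ meq (tlt ch k) Y (Y1 ++ Y2),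
    uniq acc.1 /\ uniq acc.2, {subset acc.1 <= DB} /\ {subset acc.2 <= DB},
    (forall x, x \in acc.1 -> x \notin acc.2)
    & meq (tlt ch k) (map oT acc.1) [seq mul x y | x <- map oS DA, y <- Y1]
      /\ meq (tlt ch k) (map oT acc.2) [seq mul (oS p) y | y <- Y2]].

Lemma division_iter_inv Y acc n :
  division_inv Y acc n -> division_inv Y (division_iter lt deeper d DA p DB acc) n.+1.
Proof.
case: acc => R Q [Y1 [Y2 /= [[sY YE] [uR uQ] [RDB QDB] RQ [RE QE]]]].
rewrite /division_iter /=; set r := quotient _ _ _ _ _ _.
have pA : List.In (oS p) (map oS DA).
  by apply/List.in_map_iff; exists p; rewrite In_mem.
(* Once [R] is empty the quotient is the default [d], which lies outside [DB] and adds nothing. *)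
case: (posnP (size Y1)) => [/size0nil Y10|Y1_gt0].
  have R0 : R = [::].
    apply: size0nil; have := meq_size lt_swo RE.
    by rewrite size_map size_allpairs Y10 muln0.
  have rd : r = d by rewrite /r /quotient /quotients R0.
  exists [::], Y2; split; rewrite ?R0 /=.
  - by split; [rewrite subnS -sY Y10|rewrite Y10 in YE].
  - by rewrite filter_uniq // ; elim: [seq a <- DA | a != p].
  - split=> x; last by rewrite mem_filter => /andP[].
    by elim: [seq a <- DA | a != p].
  - by move=> x; elim: [seq a <- DA | a != p].
  rewrite Y10 R0 /= in RE; split.
    by rewrite (_ : foldl _ _ _ = [::]) //; elim: [seq a <- DA | a != p].
  apply: meq_trans QE => t; rewrite !count_map; apply/permP/uniq_perm => //.
    exact: filter_uniq.
  move=> x; rewrite mem_filter rd andb_orl.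
  have [->|_] /= := eqVneq x d; last by apply/andP/idP => [[]//|xQ]; rewrite xQ QDB.
  by rewrite (negPf dDB) andbF; apply/esym/negP => /QDB; apply/negP.
have RDBi : {in R & R, forall x y, deeper x y = (height ch k (oT y) <= height ch k (oT x))}.
  by move=> x y xR yR; rewrite deeperE ?RDB.
have ltpE : {in R & R, forall x y, lt (p, x) (p, y) = tlt ch k (oT x) (oT y)}.
  by move=> x y xR yR; rewrite ltE ?RDB // full_tlt_mul2l.
set b := deepest lt deeper d p R.
have [bR bmax] : b \in R /\ (forall x, x \in R -> ~~ hlt ch k (oT b) (oT x)).
  have [|bR /allP bP] := @head_filter _ d
      (fun b => all (fun b' => deeper b b' && (deeper b' b ==> ~~ lt (p, b) (p, b'))) R) R.
    have [|m [mR _ /all_In mP]] := has_maximal (hlt_swo ch k) (P := predT) (s := map oT R).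
      rewrite has_predT size_map -(size_map oT) (meq_size lt_swo RE) size_allpairs muln_gt0 Y1_gt0.
      by rewrite size_map; case: (DA) pDA.
    have [x [xm xR]] := iffLR (List.in_map_iff _ _ _) mR.
    apply/hasP; exists x; first exact/In_mem.
    apply/allP => y yR; have := mP (oT y).
    have yIn : List.In (oT y) (map oT R) by apply/List.in_map_iff; exists y; rewrite In_mem.
    move/(_ yIn); rewrite /= -xm /hlt negb_or -leqNgt => /andP[hyx]; move/In_mem: xR => xR.
    rewrite !RDBi // hyx /= negb_and ltpE // eqn_leq hyx andbT.
    by rewrite implybE.
  split=> // x /[dup] xR /bP; rewrite !RDBi // ltpE // => /andP[hxb].
  by rewrite implybE /hlt negb_or -leqNgt hxb negb_and eqn_leq hxb andbT.
have inR x : List.In x (map oT R) -> exists2 z, z \in R & x = oT z.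
  by move=> /List.in_map_iff[z [<- /In_mem]]; exists z.
have [||y [yY [_ [/inR[r0 r0R ->] r0y [_ /List.in_map_iff[a [<- /In_mem aDA]] ar0] r0min]]]] :=
    division_step ch_mul pA fp RE (b := oT b).
- by apply/List.in_map_iff; exists b; rewrite In_mem.
- by move=> x /inR[z zR ->]; apply: bmax.
have quotP x : x \in quotients lt deeper d DA p R ->
    x \in R /\ ~~ tlt ch k (oT x) (oT r0).
  rewrite mem_filter => /andP[/hasP[a' a'DA e] xR]; rewrite tieE ?RDB // in e.
  split=> //; apply: r0min e; apply/List.in_map_iff; [exists x|exists a'];
    by rewrite In_mem.
have r0quot : r0 \in quotients lt deeper d DA p R.
  by rewrite mem_filter r0R andbT; apply/hasP; exists a; rewrite ?tieE ?RDB.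
have [|rquot /allP rmin] := @head_filter _ d
    (fun r => all (fun r' => ~~ lt (p, r') (p, r)) (quotients lt deeper d DA p R))
    (quotients lt deeper d DA p R).
  apply/hasP; exists r0 => //; apply/allP => x /quotP[xR].
  by rewrite ltpE.
rewrite -/(quotient lt deeper d DA p R) -/r in rquot rmin.
have [rR rr0] := quotP r rquot.
have ry : eqv ch k (oT r) (mul (oS p) y).
  rewrite -(eqv_eqr _ r0y) /eqv /tie rr0 /=.
  by move: (rmin _ r0quot); rewrite ltpE.
have [Z1 [Z2 eY1]] := List.in_split _ _ yY.
have pDAperm := filter_neq_perm DAuniq pDA.
have rRE : meq (tlt ch k) (map oT [seq x <- R | x != r])
    ([seq mul (oS a) y | a <- [seq a <- DA | a != p]] ++
     [seq mul x z | x <- map oS DA, z <- Z1 ++ Z2]).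
  apply: (meq_filter_neq uR rR ry); apply: meq_trans RE _ => t.
  rewrite eY1 meq_mulr_cons // -cat_cons !count_cat; congr (_ + _).
  by rewrite count_map count_map (permP pDAperm) /= count_map.
have [|||u s m] := foldl_remove_mul (RDB _ rR) ry _ _ _ rRE.
- by move=> x; rewrite mem_filter => /andP[].
- exact: filter_uniq.
- by move=> x; rewrite mem_filter => /andP[_ /RDB].
exists (Z1 ++ Z2), (y :: Y2); split=> //=.
- split; first by move: sY; rewrite eY1 !size_cat /= addnS subnS => <-.
  by move=> t; rewrite YE eY1 !count_cat /= -!addnA; congr (_ + _); apply: addnCA.
- by split=> //; apply: filter_uniq.
- by split=> x; [move/s|]; rewrite mem_filter => /andP[] // _ /RDB.
- move=> x /s; rewrite !mem_filter => /andP[xr xR].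
  by rewrite negb_and negb_or xr RQ.
split=> // t; rewrite /= -QE !count_map.
have <- : tie (tlt ch k) t (oT r) = tie (tlt ch k) t (mul (oS p) y) by apply: eqv_eqr.
have -> : count (preim oT (tie (tlt ch k) t)) [seq b0 <- DB | (b0 == r) || (b0 \in Q)]
        = count (preim oT (tie (tlt ch k) t)) (r :: Q); last by [].
apply/permP/uniq_perm; first exact: filter_uniq.
  by rewrite /= uQ andbT RQ.
move=> x; rewrite mem_filter in_cons; have [->|_] /= := eqVneq x r; first exact: RDB.
by apply/andP/idP => [[]//|xQ]; rewrite xQ QDB.
Qed.

Theorem divisionP Y :
  meq (tlt ch k) (map oT DB) [seq mul x y | x <- map oS DA, y <- Y] ->
  let Q := division lt deeper d DA p DB in
  [/\ uniq Q, {subset Q <= DB}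
    & meq (tlt ch k) (map oT Q) [seq mul (oS p) y | y <- Y]].
Proof.
move=> DBE; rewrite /division.
have inv n : division_inv Y (iter n (division_iter lt deeper d DA p DB) (DB, [::])) n.
  elim: n => [|n]; last exact: division_iter_inv.
  by exists Y, [::]; split; rewrite ?subn0 ?cats0 //; split.
have := inv (size DB); case: (iter _ _ _) => R Q [Y1 [Y2 [/= [sY YE] [_ uQ] [_ QDB] _ [_ QE]]]].
(* There are [size DB] rounds, and [Y] has at most as many elements because [DA] is not empty. *)
have Y10 : Y1 = [::].
  apply: size0nil; rewrite sY; apply/eqP; rewrite subn_eq0.
  rewrite -(size_map oT) (meq_size lt_swo DBE) size_allpairs size_map leq_pmull //.
  by case: (DA) pDA.
split=> //; apply: meq_trans QE _ => t; rewrite Y10 in YE.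
rewrite !count_map; symmetry; apply: (meq_count lt_swo YE) => u v uv.
by apply: eqv_eqr; apply: eqv_mul2l.
Qed.

End DivisionCorrect.

(** * Graphs and their periodic vertices *)

(** The vertices are listed inside a type that may be infinite: those of a table are then plain
    numbers, and the functions on graphs become functions on [nat] by conversion. *)
Record graph := Graph { gvertex : eqType; gvs : seq gvertex; gnext : gvertex -> gvertex }.

Definition gwf (G : graph) : Prop :=
  uniq (gvs G) /\ {in gvs G, forall v, gnext v \in gvs G}.

Definition gpred (G : graph) (v : gvertex G) : seq (gvertex G) :=
  [seq u <- gvs G | gnext u == v].

(** After as many steps as there are vertices, every orbit has entered its cycle. *)
Definition gper (G : graph) : seq (gvertex G) :=
  [seq v <- gvs G | has (fun u => iter (size (gvs G)) (@gnext G) u == v) (gvs G)].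

Definition gprod (G H : graph) : graph :=
  @Graph (gvertex G * gvertex H)%type [seq (u, v) | u <- gvs G, v <- gvs H]
    (fun p => (gnext p.1, gnext p.2)).

Definition gsum (G H : graph) : graph :=
  @Graph (gvertex G + gvertex H)%type (map inl (gvs G) ++ map inr (gvs H))
    (fun p => match p with inl u => inl (gnext u) | inr v => inr (gnext v) end).

Lemma gpred_prod (G H : graph) (u : gvertex G) (v : gvertex H) :
  @gpred (gprod G H) (u, v) = [seq (x, y) | x <- gpred u, y <- gpred v].
Proof.
rewrite /gpred /=; elim: (gvs G) => //= x s IHs.
rewrite filter_cat IHs filter_map /=; case: (eqVneq (gnext x) u) => [xu|/negPf xu] /=.
  by congr (map _ _ ++ _); apply: eq_filter => y; rewrite /= xpair_eqE xu eqxx.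
by rewrite (eq_filter (a2 := pred0)) ?filter_pred0 // => y; rewrite /= xpair_eqE xu.
Qed.

Lemma iter_period (V : Type) (h : V -> V) i j x : iter j h x = x -> iter (i * j) h x = x.
Proof. by move=> jx; elim: i => // i IHi; rewrite mulSn iterD IHi. Qed.

(** * Trees assigned to vertices, and the depth at which truncations stabilise *)

Section Model.
Variables (O : Type) (ch : O -> seq O).

(* [o] sends every vertex to its unroll tree. *)
Definition model (G : graph) (o : gvertex G -> O) : Prop :=
  {in gvs G, forall v, ch (o v) = map o (gpred v)}.

Lemma model_prod (mul : O -> O -> O) (G H : graph) (oG : gvertex G -> O) (oH : gvertex H -> O) :
  (forall a b, ch (mul a b) = [seq mul x y | x <- ch a, y <- ch b]) ->
  model oG -> model oH -> @model (gprod G H) (fun p => mul (oG p.1) (oH p.2)).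
Proof.
move=> ch_mul mG mH [u v] /allpairsP[[x y] [xG yH [-> ->]]] /=.
by rewrite ch_mul mG // mH // gpred_prod map_allpairs allpairs_mapl allpairs_mapr.
Qed.

Lemma model_sum (G H : graph) (oG : gvertex G -> O) (oH : gvertex H -> O) :
  model oG -> model oH ->
  @model (gsum G H) (fun p => match p with inl u => oG u | inr v => oH v end).
Proof.
move=> mG mH [v|v]; rewrite mem_cat => /orP[] /mapP[w wG []] // ->.
  rewrite mG // /gpred /= filter_cat !filter_map.
  rewrite [X in _ ++ X](_ : _ = [::]) ?cats0; last first.
    by rewrite (eq_filter (a2 := pred0)) ?filter_pred0.
  rewrite -map_comp; congr map; exact: eq_filter.
rewrite mH // /gpred /= filter_cat !filter_map.
rewrite [X in X ++ _](_ : _ = [::]) ?cat0s; last first.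
  by rewrite (eq_filter (a2 := pred0)) ?filter_pred0.
rewrite -map_comp; congr map; exact: eq_filter.
Qed.

Section Stability.
Variables (G : graph) (o : gvertex G -> O).
Hypothesis oG : model o.
Let n := size (gvs G).

Definition stable_at k : bool :=
  all (fun u => all (fun v => eqv ch k (o u) (o v) ==> eqv ch k.+1 (o u) (o v))
    (gvs G)) (gvs G).

Lemma stable_atP k : reflect
  {in gvs G &, forall u v, eqv ch k (o u) (o v) -> eqv ch k.+1 (o u) (o v)}
  (stable_at k).
Proof.
apply: (iffP allP) => [st u v uG vG|st u uG].
  by have /allP/(_ v vG)/implyP := st u uG.
by apply/allP => v vG; apply/implyP; apply: st.
Qed.

(** If a level separates no further pair, the classes met among the predecessors do not change, and
    the next level separates nothing either. *)
Lemma stable_atS k : stable_at k -> stable_at k.+1.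
Proof.
move=> /stable_atP st; apply/stable_atP => u v uG vG /eqvS uv; apply/eqvS => t.
have sub w : {subset gpred w <= gvs G} by move=> x; rewrite mem_filter => /andP[].
have [|] := boolP (has (fun x => eqv ch k.+1 t (o x)) (gpred u ++ gpred v)).
  case/hasP=> x xuv tx; have xG : x \in gvs G.
    by move: xuv; rewrite mem_cat => /orP[] /sub.
  have cE w : w \in gvs G ->
      count (tie (tlt ch k.+1) t) (ch (o w)) = count (tie (tlt ch k) (o x)) (ch (o w)).
    move=> wG; rewrite oG // !count_map; apply: eq_in_count => y /sub yG /=.
    rewrite -/(eqv ch k.+1 t (o y)) (eqv_eql tx).
    by apply/idP/idP; [apply: eqvW|apply: st].
  by rewrite !cE //; apply: uv.
rewrite has_cat => /norP[nu nv].
by rewrite !oG // !count_map; move: nu nv; rewrite !has_count -!eqn0Ngt => /eqP -> /eqP ->.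
Qed.

Lemma stable_at_leq j k : j <= k -> stable_at j -> stable_at k.
Proof. by move=> /subnK <- st; elim: (k - j) => // i; apply: stable_atS. Qed.

(** Every unstable level loses at least one of the at most [n * n] pairs of tied vertices. *)
Lemma stable_at_sqr k : n * n <= k -> stable_at k.
Proof.
move=> nk; apply: (stable_at_leq nk); apply: contraT => nst.
pose c j := \sum_(u <- gvs G) \sum_(v <- gvs G) eqv ch j (o u) (o v).
have c0 : c 0 = n * n.
  rewrite /c (eq_bigr (fun _ => n)); first by rewrite big_const_seq count_predT iter_addn_0.
  by move=> u _; rewrite (eq_bigr (fun _ => 1)) ?sum1_size.
have cS j : ~~ stable_at j -> c j.+1 < c j.
  rewrite -has_predC => /hasP[u uG /=]; rewrite -has_predC => /hasP[v vG /=].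
  rewrite negb_imply => /andP[uv nuv].
  have le x y : eqv ch j.+1 (o x) (o y) <= eqv ch j (o x) (o y).
    by case e: (eqv ch j.+1 _ _) => //; rewrite (eqvW e).
  apply: (@ltn_sum_In _ _ _ _ u); [|exact/In_mem|].
    by move=> x _; apply: leq_sum => y _; apply: le.
  apply: (@ltn_sum_In _ _ _ _ v); [|exact/In_mem|by rewrite uv (negPf nuv)].
  by move=> x _; apply: le.
have cle j : j <= (n * n).+1 -> c j + j <= n * n.
  elim: j => [|j IHj]; first by rewrite c0 addn0.
  rewrite ltnS => jn; have := IHj (leqW jn); rewrite addnS -addSn; apply: leq_trans.
  rewrite leq_add2r; apply: cS; apply: contra nst; exact: stable_at_leq.
by have := cle _ (leqnn _); rewrite addnS ltnNge leq_addl.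
Qed.

Lemma eqv_stable j k u v : u \in gvs G -> v \in gvs G -> n * n <= j ->
  eqv ch j (o u) (o v) -> eqv ch k (o u) (o v).
Proof.
move=> uG vG nj uv; case: (leqP k j) => [kj|/ltnW]; first exact: eqv_leq uv.
move=> /subnK <-; elim: (k - j) => // i IHi; rewrite addSn.
by apply: (stable_atP _ _) => //; apply: stable_at_sqr; apply: leq_trans nj (leq_addl _ _).
Qed.

Lemma tlt_stable k u v : u \in gvs G -> v \in gvs G -> n * n <= k ->
  tlt ch k (o u) (o v) = tlt ch (n * n) (o u) (o v).
Proof.
move=> uG vG nk; apply/idP/idP => [uv|]; last exact: tlt_leq.
apply: contraTT uv => nuv; have [vu|nvu] := boolP (tlt ch (n * n) (o v) (o u)).
  by rewrite (swo_asym (tlt_swo ch k)) ?(tlt_leq nk).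
have /andP[] // : eqv ch k (o u) (o v).
by apply: (@eqv_stable (n * n)) => //; apply/andP.
Qed.

End Stability.

(** Vertices of two graphs are compared inside their disjoint union, whence the bound. *)
Lemma eqv_stable2 (G H : graph) (oG : gvertex G -> O) (oH : gvertex H -> O) j k u v :
  model oG -> model oH -> u \in gvs G -> v \in gvs H ->
  (size (gvs G) + size (gvs H)) * (size (gvs G) + size (gvs H)) <= j ->
  eqv ch j (oG u) (oH v) -> eqv ch k (oG u) (oH v).
Proof.
move=> mG mH uG vH nj.
apply: (@eqv_stable (gsum G H) _ (model_sum mG mH) j k (inl u) (inr v));
  by rewrite ?mem_cat ?map_f ?orbT // size_cat !size_map.
Qed.

(** * Periodic vertices and the lengths of branches *)

Section Periodic.
Variables (G : graph) (o : gvertex G -> O).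
Hypothesis oG : model o.
Hypothesis G_wf : gwf G.
Let n := size (gvs G).
Let f := @gnext G.

Lemma iter_gnext k v : v \in gvs G -> iter k f v \in gvs G.
Proof. by move=> vG; elim: k => //= k; apply: G_wf.2. Qed.

Lemma gper_sub : {subset gper G <= gvs G}.
Proof. by move=> v; rewrite mem_filter => /andP[]. Qed.

Lemma gper_uniq : uniq (gper G).
Proof. exact: filter_uniq G_wf.1. Qed.

Lemma iter_in_gper k v : v \in gvs G -> n <= k -> iter k f v \in gper G.
Proof.
move=> vG nk; rewrite mem_filter iter_gnext // andbT; apply/hasP.
by exists (iter (k - n) f v); rewrite ?iter_gnext // -iterD subnKC.
Qed.

Lemma gperP v : reflect (v \in gvs G /\ exists2 d, 0 < d & iter d f v = v) (v \in gper G).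
Proof.
apply: (iffP idP) => [|[vG [d d_gt0 dv]]]; last first.
  by rewrite -(iter_period n dv) iter_in_gper // leq_pmulr.
rewrite mem_filter => /andP[/hasP[u uG /eqP uv] vG]; split=> //.
(* Pigeonhole on the first [n + 1] iterates. *)
have : looping f u n.
  apply: contraT; rewrite -looping_uniq => /uniq_leq_size lt.
  suff : n.+1 <= n by rewrite ltnn.
  rewrite -(size_traject f u n.+1); apply: lt => x /trajectP[i _ ->].
  exact: iter_gnext.
case/trajectP=> i lt_in uniE; exists (n - i); first by rewrite subn_gt0.
by rewrite -{1}uv uniE -iterD subnK // ltnW.
Qed.

Lemma gnext_per v : v \in gper G -> f v \in gper G.
Proof.
move=> /gperP[vG [d d0 dv]]; apply/gperP; split; first exact: G_wf.2.
by exists d; rewrite // -iterSr iterS dv.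
Qed.

Lemma iter_per k v : v \in gper G -> iter k f v \in gper G.
Proof. by move=> vP; elim: k => //= k; apply: gnext_per. Qed.

Lemma gnext_inj : {in gper G &, injective f}.
Proof.
move=> u v /gperP[_ [d d0 du]] /gperP[_ [e e0 ev]] uv.
have : iter (d * e) f u = iter (d * e) f v.
  have /prednK <- : 0 < d * e by rewrite muln_gt0 d0.
  by rewrite !iterSr uv.
by rewrite (@iter_period _ f d e v) // mulnC (@iter_period _ f e d u).
Qed.

Lemma iter_inj k : {in gper G &, injective (iter k f)}.
Proof.
elim: k => // k IHk u v uP vP /= /gnext_inj e; apply: IHk => //; apply: e; exact: iter_per.
Qed.

Lemma iter_surj k v : v \in gper G -> exists2 u, u \in gper G & iter k f u = v.
Proof.
elim: k v => [|k IHk] v vP; first by exists v.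
have /gperP[vG [d d0 dv]] := vP.
have [u uP uv] := IHk (iter d.-1 f v) (iter_per _ vP).
by exists u; rewrite // iterS uv -iterS prednK.
Qed.

Lemma full_iter k v : v \in gvs G ->
  reflect (exists2 u, u \in gvs G & iter k f u = v) (full ch k (o v)).
Proof.
elim: k v => [|k IHk] v vG; first by apply: (iffP idP) => // _; exists v.
rewrite /= oG // has_map; apply: (iffP hasP) => [[w]|[u uG uv]].
  rewrite mem_filter => /andP[/eqP <- wG] /(IHk w wG)[u uG <-]; by exists u.
exists (iter k f u); last by apply/IHk; [exact: iter_gnext|exists u].
by rewrite mem_filter iter_gnext // andbT -uv.
Qed.

Lemma full_per k v : v \in gper G -> full ch k (o v).
Proof.
move=> vP; apply/full_iter; first exact: gper_sub.
by have [u /gper_sub uG] := iter_surj k vP; exists u.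
Qed.

Lemma full_in_per k v : v \in gvs G -> n <= k -> full ch k (o v) = (v \in gper G).
Proof.
move=> vG nk; apply/idP/idP => [/(full_iter _ vG)[u uG <-]|]; last exact: full_per.
exact: iter_in_gper.
Qed.

(** A branch of length [n] already forces the vertex onto a cycle, where branches of all lengths
    exist. So lengths up to [n] suffice, and the comparison of heights becomes a computable test
    that does not mention [k]. *)
Lemma height_leq_per k u v : u \in gvs G -> v \in gvs G -> n <= k ->
  (height ch k (o u) <= height ch k (o v))
  = all (fun j => has (fun x => iter j f x == u) (gvs G) ==>
                  has (fun x => iter j f x == v) (gvs G)) (iota 0 n.+1).
Proof.
move=> uG vG nk.
have hasE j w : w \in gvs G -> has (fun x => iter j f x == w) (gvs G) = full ch j (o w).
  by move=> wG; apply/hasP/(full_iter j wG) => -[x xG /eqP xw]; exists x => //; apply/eqP.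
apply/height_leqP/allP => [uv j|uv j jk fu].
  rewrite mem_iota ltnS => /= jn; rewrite !hasE //; apply/implyP; apply: uv.
  exact: leq_trans nk.
have [jn|/ltnW nj] := leqP j n.
  by have := uv j; rewrite mem_iota ltnS jn !hasE // fu; apply.
have := uv n; rewrite mem_iota ltnSn !hasE // (full_leq nj fu) => /(_ isT).
by rewrite !full_in_per // => /full_per.
Qed.

End Periodic.
End Model.

Lemma tie_eqr T (l : rel T) u v w : swo l -> tie l u v -> tie l w u = tie l w v.
Proof. by move=> ls uv; rewrite !(tie_sym l w); apply: tie_eql. Qed.

Lemma meq_perm (O : Type) (l : rel O) (T : eqType) (h : T -> O) X Y :
  perm_eq X Y -> meq l (map h X) (map h Y).
Proof. by move=> XY t; rewrite !count_map (permP XY). Qed.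

(** The elements are paired along [l]; if every tied pair is also tied in [l'], the same pairing
    serves for the other labels. It is used to pass from products in [B] at depth [k] to trees of
    [X] at any depth. *)
Lemma meq_transfer O (l l' : rel O) (S T : eqType) (g g' : S -> O) (h h' : T -> O) X Y :
  swo l -> swo l' ->
  {in X & Y, forall x y, tie l (g x) (h y) -> tie l' (g' x) (h' y)} ->
  meq l (map g X) (map h Y) -> meq l' (map g' X) (map h' Y).
Proof.
move=> ls ls'; elim: X Y => [|x X IHX] Y sub XY.
  by case: Y XY {sub} => // y Y /(_ (h y)); rewrite /= tie_refl.
have [_ /List.in_map_iff[y [<- /In_mem yY]] xy] := meq_In ls XY (or_introl (erefl (g x))).
have pY := perm_to_rem yY; apply: (meq_trans (Y := map h' (y :: rem y Y))); last first.
  by apply: meq_perm; rewrite perm_sym.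
have XY' : meq l (map g X) (map h (rem y Y)).
  move=> t; have := XY t; rewrite (meq_perm l h pY) /= (tie_eqr t ls xy).
  by move/addnI.
move=> t /=; rewrite (tie_eqr t ls' (sub x y (mem_head _ _) yY xy)); congr (_ + _).
by apply: IHX XY' t => u v uX /mem_rem vY; apply: sub; rewrite // in_cons uX orbT.
Qed.

Lemma meq_filter O (l : rel O) (S T : eqType) (g : S -> O) (h : T -> O) (F : pred O) X Y :
  swo l -> (forall x y, tie l x y -> F x = F y) ->
  meq l (map g X) (map h Y) ->
  meq l (map g [seq x <- X | F (g x)]) (map h [seq y <- Y | F (h y)]).
Proof.
move=> ls Ftie XY t.
have E (U : eqType) (e : U -> O) Z : count (tie l t) (map e [seq z <- Z | F (e z)])
    = count (predI (tie l t) F) (map e Z).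
  by rewrite !count_map count_filter.
rewrite !E; apply: (meq_count ls XY) => u v uv /=.
by rewrite (tie_eqr t ls uv) (Ftie u v).
Qed.

Section PeriodicShift.
Variables (O : Type) (ch : O -> seq O).
Variables (G H : graph) (oG : gvertex G -> O) (oH : gvertex H -> O) (k : nat).
Hypotheses (mG : model ch oG) (mH : model ch oH) (Gwf : gwf G) (Hwf : gwf H).
Let n := size (gvs G) + size (gvs H).
Hypothesis kn : n * n <= k.

Lemma leq_sqr m : m <= m * m. Proof. by case: m => // m; rewrite leq_pmulr. Qed.
Let kG : size (gvs G) <= k.
Proof. exact: leq_trans (leq_addr _ _) (leq_trans (leq_sqr n) kn). Qed.
Let kH : size (gvs H) <= k.
Proof. exact: leq_trans (leq_addl _ _) (leq_trans (leq_sqr n) kn). Qed.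

Lemma meq_gpred u v : u \in gvs G -> v \in gvs H -> eqv ch k (oG u) (oH v) ->
  meq (tlt ch k) (map oG (gpred u)) (map oH (gpred v)).
Proof.
move=> uG vH uv; rewrite -mG // -mH //; apply/eqvS.
exact: (eqv_stable2 k.+1 mG mH uG vH kn uv).
Qed.

Lemma eqv_gper u v : u \in gvs G -> v \in gvs H -> eqv ch k (oG u) (oH v) ->
  (u \in gper G) = (v \in gper H).
Proof.
move=> uG vH uv; have := eqv_full uv.
by rewrite (full_in_per mG Gwf uG kG) (full_in_per mH Hwf vH kH).
Qed.

(** The periodic predecessor of a periodic vertex is its only predecessor with arbitrarily long
    branches, so it can be recognised in the tree. *)
Lemma eqv_per_pred u v : u \in gper G -> v \in gper H ->
  eqv ch k (oG (gnext u)) (oH (gnext v)) -> eqv ch k (oG u) (oH v).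
Proof.
move=> uP vP uv; have [uG vH] := (gper_sub uP, gper_sub vP).
have := meq_gpred (Gwf.2 _ uG) (Hwf.2 _ vH) uv.
have uI : List.In (oG u) (map oG (gpred (gnext u))).
  by apply/List.in_map_iff; exists u; rewrite In_mem mem_filter eqxx uG.
move=> /(meq_In (tlt_swo ch k))/(_ uI)[_ /List.in_map_iff[w [<- /In_mem]]].
rewrite mem_filter => /andP[/eqP wv wH] uw.
suff <- : w = v by [].
by apply: (gnext_inj Hwf) => //; rewrite -(eqv_gper uG wH uw).
Qed.

(** The tree of a vertex does not show its successor, but [eqv_per_pred] allows going backwards:
    along a common period [c], going back [c - 1] times amounts to one step forwards. *)
Lemma eqv_per_next u v : u \in gper G -> v \in gper H ->
  eqv ch k (oG u) (oH v) -> eqv ch k (oG (gnext u)) (oH (gnext v)).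
Proof.
move=> uP vP uv; have /(gperP Gwf)[_ [d d0 du]] := uP.
have /(gperP Hwf)[_ [e e0 ev]] := vP.
pose c := d * e; have c0 : 0 < c by rewrite muln_gt0 d0.
have cu : iter c (@gnext G) u = u by rewrite /c mulnC; apply: iter_period.
have cv : iter c (@gnext H) v = v by apply: iter_period.
have step m : m <= c ->
    eqv ch k (oG (iter (c - m) (@gnext G) u)) (oH (iter (c - m) (@gnext H) v)).
  elim: m => [|m IHm] mc; first by rewrite subn0 cu cv.
  apply: eqv_per_pred; try exact: iter_per.
  by rewrite -!iterS -subSn // subSS; apply: IHm; apply: ltnW.
by have := step c.-1 (leq_pred _); rewrite -subn1 subKn.
Qed.

End PeriodicShift.

Lemma gwf_prod (G H : graph) : gwf G -> gwf H -> gwf (gprod G H).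
Proof.
move=> [uG nG] [uH nH]; split.
  by apply: allpairs_uniq => // -[? ?] [? ?] _ _ [-> ->].
by move=> _ /allpairsP[[x y] [/nG xG /nH yH ->]]; apply/allpairsP; exists (gnext x, gnext y).
Qed.

Lemma mem_gprod (G H : graph) u v :
  ((u, v) \in gvs (gprod G H)) = (u \in gvs G) && (v \in gvs H).
Proof.
apply/allpairsP/andP => [[[x y] [xG yH [-> ->]]] //|[uG vH]].
by exists (u, v).
Qed.

Lemma gper_prod (G H : graph) : gwf G -> gwf H -> forall u v,
  u \in gper G -> v \in gper H -> (u, v) \in gper (gprod G H).
Proof.
move=> wG wH u v /(gperP wG)[uG [d d0 du]] /(gperP wH)[vH [e e0 ev]].
apply/(gperP (gwf_prod wG wH)); rewrite mem_gprod uG vH; split=> //.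
exists (d * e); first by rewrite muln_gt0 d0.
have iterE m : iter m (@gnext (gprod G H)) (u, v) = (iter m (@gnext G) u, iter m (@gnext H) v).
  by elim: m => //= m ->.
by rewrite iterE; congr (_, _); [rewrite mulnC|]; apply: iter_period.
Qed.

(** * The quotient graph *)

Section QuotientGraph.
Variables (A B : graph) (a0 : gvertex A) (b0 : gvertex B).
Variable lt : rel (gvertex A * gvertex B).

Definition reaches (j : nat) (b : gvertex B) : bool :=
  has (fun x => iter j (@gnext B) x == b) (gvs B).

Definition deeper (b b' : gvertex B) : bool :=
  all (fun j => reaches j b' ==> reaches j b) (iota 0 (size (gvs B)).+1).

Definition base := head a0 (gper A).
Definition back m := head a0 [seq a <- gper A | iter m (@gnext A) a == base].

Definition qdiv DA p DB := division lt deeper b0 DA p DB.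
Definition qper := qdiv (gper A) base (gper B).
(** When [t] is [back m * x], its predecessors are the products of those of [back m] and those of
    [x]; the division selects the ones that represent predecessors of [x], now over the denominator
    [back m.+1]. *)
Definition kept m t := qdiv (gpred (back m)) (back m.+1) (gpred t).

(* A transient vertex at distance [j] from the cycles is paired with the
   vertex [back j] of the cycle of [base]. *)
Definition layer j t :=
  (iter j (@gnext B) t \in qper) &&
  all (fun i => (iter i (@gnext B) t \notin gper B) &&
                (iter i (@gnext B) t \in kept (j.-1 - i) (iter i.+1 (@gnext B) t)))
    (iota 0 j).

Definition qvs := [seq t <- gvs B | has (fun j => layer j t) (iota 0 (size (gvs B)).+1)].

Definition qclass t := [seq u <- qper | tie lt (base, t) (base, u)].
(** If [t] is [base * x] and [f] is the successor, then [f t] is [f base * f x]; so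
    [f base * u = base * f t] says, after cancelling [f base], that [u] is [base * f x]. *)
Definition qnext_class t := [seq u <- qper | tie lt (gnext base, u) (base, gnext t)].
(** Any bijection from the class of [t] to the next class will do, as unroll trees do not tell which
    of several equal states is linked to which; equal positions in the two lists give one. The
    cycles obtained need not be those of [X]. *)
Definition qcycle_next t := nth t (qnext_class t) (index t (qclass t)).
Definition qnext t := if t \in qper then qcycle_next t else gnext t.

Definition quotient_graph := Graph qvs qnext.

Variables (O : Type) (ch : O -> seq O) (mul : O -> O -> O).
Hypothesis ch_mul : forall a b, ch (mul a b) = [seq mul x y | x <- ch a, y <- ch b].
Variable X : graph.
Variables (oA : gvertex A -> O) (oB : gvertex B -> O) (oX : gvertex X -> O).
Hypotheses (mA : model ch oA) (mB : model ch oB) (mX : model ch oX).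
Hypotheses (Awf : gwf A) (Bwf : gwf B) (Xwf : gwf X).
Hypotheses (b0B : b0 \notin gvs B) (A_per : gper A != [::]).
Variable k : nat.
Let nA := size (gvs A).
Let nB := size (gvs B).
Let nX := size (gvs X).
Hypothesis k_prod : (nB + nA * nX) * (nB + nA * nX) <= k.
Hypothesis k_XX : (nX + nX) * (nX + nX) <= k.
Hypothesis k_BB : (nB + nB) * (nB + nB) <= k.
Hypothesis ltE : {in gvs A & gvs B, forall a b, {in gvs A & gvs B, forall a' b',
  lt (a, b) (a', b') = tlt ch k (mul (oA a) (oB b)) (mul (oA a') (oB b'))}}.
Hypothesis sol : meq (tlt ch k) (map oB (gper B))
  [seq mul x y | x <- map oA (gper A), y <- map oX (gper X)].

Let lt_swo := tlt_swo ch k.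
Let kB : nB <= k. Proof. by apply: leq_trans k_BB; apply: leq_trans (leq_sqr _); apply: leq_addr. Qed.

Lemma base_per : base \in gper A.
Proof. by rewrite /base; case: (gper A) A_per => // a s _; apply: mem_head. Qed.

Lemma backP m : back m \in gper A /\ iter m (@gnext A) (back m) = base.
Proof.
have [|bP /eqP] := @head_filter _ a0 (fun a => iter m (@gnext A) a == base) (gper A); last by [].
by have [u uP <-] := iter_surj Awf m base_per; apply/hasP; exists u.
Qed.

Lemma back_per m : back m \in gper A. Proof. by have [] := backP m. Qed.

Lemma back0 : back 0 = base. Proof. by have [] := backP 0. Qed.

Lemma gnext_back m : gnext (back m.+1) = back m.
Proof.
apply: (iter_inj Awf (k := m)); rewrite ?back_per //.
  by apply: gnext_per; rewrite ?back_per.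
by rewrite -iterSr; have [_ ->] := backP m.+1; have [_ ->] := backP m.
Qed.

Lemma full_base m : full ch m (oA base).
Proof. by apply: full_per => //; apply: base_per. Qed.

Lemma full_back j m : full ch m (oA (back j)).
Proof. by apply: full_per => //; apply: back_per. Qed.

Lemma sub_gpred (G : graph) (v : gvertex G) : {subset gpred v <= gvs G}.
Proof. by move=> u; rewrite mem_filter => /andP[]. Qed.

Lemma gpred_uniq (G : graph) (v : gvertex G) : gwf G -> uniq (gpred v).
Proof. by move=> [uG _]; apply: filter_uniq. Qed.

Lemma mem_back_gpred m : back m.+1 \in gpred (back m).
Proof. by rewrite mem_filter gnext_back eqxx gper_sub // back_per. Qed.

Lemma qdivP DA p DB Y : p \in DA -> p \in gper A -> uniq DA -> uniq DB ->
  {subset DA <= gvs A} -> {subset DB <= gvs B} ->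
  meq (tlt ch k) (map oB DB) [seq mul x y | x <- map oA DA, y <- map oX Y] ->
  [/\ uniq (qdiv DA p DB), {subset qdiv DA p DB <= DB}
    & meq (tlt ch k) (map oB (qdiv DA p DB)) (map (fun x => mul (oA p) (oX x)) Y)].
Proof.
move=> pDA pP uDA uDB sA sB; rewrite [in X in _ -> X](map_comp (mul (oA p)) oX).
apply: divisionP => //; first by apply: full_per.
- by apply: contra b0B; apply: sB.
- by move=> a b /sA aA /sB bB a' b' /sA a'A /sB b'B; apply: ltE.
by move=> b b' /sB bB /sB b'B; rewrite (height_leq_per mB).
Qed.

Lemma qperP : [/\ uniq qper, {subset qper <= gper B}
  & meq (tlt ch k) (map oB qper) (map (fun x => mul (oA base) (oX x)) (gper X))].
Proof.
apply: qdivP sol; rewrite ?base_per ?gper_uniq //; exact: gper_sub.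
Qed.

Let AX_wf := gwf_prod Awf Xwf.
Let mAX : @model _ ch (gprod A X) (fun p => mul (oA p.1) (oX p.2)) := model_prod ch_mul mA mX.

Lemma k_BAX : let n := size (gvs B) + size (gvs (gprod A X)) in n * n <= k.
Proof. by rewrite /= size_allpairs. Qed.

Lemma keptP m t x : t \in gvs B -> x \in gvs X ->
  eqv ch k (oB t) (mul (oA (back m)) (oX x)) ->
  [/\ uniq (kept m t), {subset kept m t <= gpred t}
    & meq (tlt ch k) (map oB (kept m t)) (map (fun x => mul (oA (back m.+1)) (oX x)) (gpred x))].
Proof.
move=> tB xX tx; apply: qdivP; rewrite ?mem_back_gpred ?back_per ?gpred_uniq //;
  try exact: sub_gpred.
have axG : (back m, x) \in gvs (gprod A X) by rewrite mem_gprod xX gper_sub // back_per.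
have := @meq_gpred _ _ B (gprod A X) _ _ k mB mAX k_BAX t _ tB axG tx.
by rewrite gpred_prod map_allpairs allpairs_mapl allpairs_mapr.
Qed.

(** In the definition, [j.-1 - i] is the distance to the cycles of the successor number [i + 1]. The
    definition is a bounded quantification, convenient for the complexity analysis; the proofs use
    this recursion. *)
Lemma layerS j t : layer j.+1 t =
  [&& t \notin gper B, t \in kept j (gnext t) & layer j (gnext t)].
Proof.
rewrite /layer /= -iterSr -iterS subn0 -andbA andbCA; congr (_ && _).
rewrite andbCA; congr [&& _, _ & _].
rewrite (iotaDl 1 0 j) all_map; apply: eq_all => i /=.
rewrite -!iterS -!iterSr !add1n.
by congr ((_ \notin _) && (_ \in kept _ _)); case: j => // j'; rewrite subSS.
Qed.

Lemma layer_per j t : layer j t -> t \in gper B -> j = 0.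
Proof. by case: j => // j; rewrite layerS => /and3P[/negPf ->]. Qed.

Lemma layer0 t : layer 0 t = (t \in qper).
Proof. by rewrite /layer /= andbT. Qed.

(** The layer counts the steps before the cycles are reached, so a vertex determines the denominator
    [back j] of its fraction. *)
Lemma layer_inj i j t : layer i t -> layer j t -> i = j.
Proof.
elim: i j t => [|i IHi] [|j] t //.
- by rewrite layer0 layerS => /(let: And3 _ s _ := qperP in s t) -> /and3P[].
- by rewrite layer0 layerS => /and3P[nt _ _] /(let: And3 _ s _ := qperP in s t); rewrite (negPf nt).
by rewrite !layerS => /and3P[_ _ ti] /and3P[_ _ tj]; rewrite (IHi j (gnext t)).
Qed.

Lemma qvsP t : t \in qvs <-> t \in gvs B /\ exists j, layer j t.
Proof.
split=> [|[tB [j tj]]].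
  by rewrite mem_filter => /andP[/hasP[j _ tj] tB]; split; last exists j.
rewrite mem_filter tB andbT; apply/hasP; exists j => //.
(* After [nB] steps every vertex of [B] is periodic, which bounds [j]. *)
rewrite mem_iota /= ltnS leqNgt; apply/negP => nj.
move/andP: tj => [_ /allP/(_ nB)]; rewrite mem_iota /= => /(_ nj)/andP[+ _].
by rewrite (iter_in_gper Bwf).
Qed.

Let qper_sub : {subset qper <= gper B}. Proof. by have [] := qperP. Qed.
Let qper_gvs : {subset qper <= gvs B}. Proof. by move=> t /qper_sub/gper_sub. Qed.

Lemma qper_pair t : t \in qper ->
  exists2 x, x \in gper X & eqv ch k (oB t) (mul (oA base) (oX x)).
Proof.
move=> tP; have [_ _ M] := qperP.
have tI : List.In (oB t) (map oB qper) by apply/List.in_map_iff; exists t; rewrite In_mem.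
by have [_ /List.in_map_iff[x [<- /In_mem]]] := meq_In lt_swo M tI; exists x.
Qed.

Lemma pair_base_per x : x \in gper X -> (base, x) \in gper (gprod A X).
Proof. by move=> xP; apply: gper_prod; rewrite ?base_per. Qed.

Lemma eqv_gnext_pair t x : t \in gper B -> x \in gper X ->
  eqv ch k (oB t) (mul (oA base) (oX x)) ->
  eqv ch k (oB (gnext t)) (mul (oA (gnext base)) (oX (gnext x))).
Proof.
move=> tP xP tx.
exact: (@eqv_per_next _ _ B (gprod A X) _ _ k mB mAX Bwf AX_wf k_BAX t (base, x) tP (pair_base_per xP) tx).
Qed.

Let full_base_k : full ch k (oA base). Proof. exact: full_base. Qed.
Let gnext_base_per : gnext base \in gper A.
Proof. by apply: gnext_per => //; apply: base_per. Qed.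
Let full_gnext_base : full ch k (oA (gnext base)). Proof. exact: full_per. Qed.

Let swap a b c : eqv ch k (mul a (mul b c)) (mul b (mul a c)).
Proof.
rewrite (eqv_eql (eqv_mulA ch_mul k a b c)) (eqv_eqr _ (eqv_mulA ch_mul k b a c)).
by apply: eqv_mul2r => //; apply: eqv_mulC.
Qed.

Lemma tie_ltE a b a' b' : a \in gvs A -> b \in gvs B -> a' \in gvs A -> b' \in gvs B ->
  tie lt (a, b) (a', b') = eqv ch k (mul (oA a) (oB b)) (mul (oA a') (oB b')).
Proof. by move=> *; rewrite /tie !ltE. Qed.

Lemma qclassE t u : t \in qper -> u \in qper ->
  tie lt (base, t) (base, u) = eqv ch k (oB t) (oB u).
Proof.
move=> tP uP; rewrite tie_ltE ?qper_gvs ?gper_sub ?base_per //.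
exact: full_eqv_mul2l.
Qed.

Lemma qnext_classE t x u : t \in qper -> x \in gper X -> u \in qper ->
  eqv ch k (oB t) (mul (oA base) (oX x)) ->
  tie lt (gnext base, u) (base, gnext t) = eqv ch k (oB u) (mul (oA base) (oX (gnext x))).
Proof.
move=> tP xP uP tx; have ftB : gnext t \in gvs B by apply: Bwf.2; apply: qper_gvs.
rewrite tie_ltE ?(qper_gvs uP) ?(gper_sub base_per) ?(gper_sub gnext_base_per) //.
rewrite (eqv_eqr _ (eqv_mul2l ch_mul _ (eqv_gnext_pair (qper_sub tP) xP tx))).
by rewrite (eqv_eqr _ (swap _ _ _)) full_eqv_mul2l.
Qed.

Lemma count_qper y : count (fun u => eqv ch k (mul (oA base) y) (oB u)) qper
  = count (fun x => eqv ch k y (oX x)) (gper X).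
Proof.
have [_ _ M] := qperP; have := M (mul (oA base) y); rewrite !count_map => ->.
by apply: eq_count => x; apply: full_eqv_mul2l.
Qed.

Lemma eqv_gnextX x y : x \in gper X -> y \in gper X ->
  eqv ch k (oX (gnext x)) (oX (gnext y)) = eqv ch k (oX x) (oX y).
Proof.
move=> xP yP; apply/idP/idP; first exact: (eqv_per_pred mX mX).
exact: (eqv_per_next mX mX).
Qed.

Lemma perm_gnext (G : graph) : gwf G -> perm_eq (map (@gnext G) (gper G)) (gper G).
Proof.
move=> Gwf; have uG : uniq (map (@gnext G) (gper G)).
  rewrite map_inj_in_uniq ?gper_uniq //; exact: gnext_inj.
apply: uniq_perm => //; first exact: gper_uniq.
move=> v; apply/mapP/idP => [[u uP ->]|vP]; first exact: gnext_per.
by have [u uP <-] := iter_surj Gwf 1 vP; exists u.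
Qed.

(** The successor permutes the periodic vertices of [X], and it preserves and reflects equality of
    their trees; so a class of [X] and the class of its successors have the same size. *)
Lemma size_qnext_class t : t \in qper -> size (qnext_class t) = size (qclass t).
Proof.
move=> tP; have [x xP tx] := qper_pair tP; rewrite !size_filter.
transitivity (count (fun u => eqv ch k (mul (oA base) (oX (gnext x))) (oB u)) qper).
  by apply: eq_in_count => u uP; rewrite (qnext_classE tP xP uP tx) eqv_sym.
rewrite count_qper -(permP (perm_gnext Xwf)) count_map.
transitivity (count (fun u => eqv ch k (mul (oA base) (oX x)) (oB u)) qper).
  by rewrite count_qper; apply: eq_in_count => y yP /=; rewrite eqv_gnextX.
by apply: eq_in_count => u uP; rewrite qclassE // (eqv_eql tx).
Qed.

Lemma qcycle_next_class t : t \in qper -> qcycle_next t \in qnext_class t.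
Proof.
move=> tP; rewrite mem_nth // size_qnext_class // index_mem mem_filter tP andbT.
by rewrite qclassE // eqv_refl.
Qed.

Lemma qcycle_next_per t : t \in qper -> qcycle_next t \in qper.
Proof. by move/qcycle_next_class; rewrite mem_filter => /andP[]. Qed.

Lemma qcycle_nextE t x : t \in qper -> x \in gper X ->
  eqv ch k (oB t) (mul (oA base) (oX x)) ->
  eqv ch k (oB (qcycle_next t)) (mul (oA base) (oX (gnext x))).
Proof.
move=> tP xP tx; have := qcycle_next_class tP; rewrite mem_filter => /andP[+ cP].
by rewrite (qnext_classE tP xP cP tx).
Qed.

(** Equal images force equal trees one step further, hence equal trees by [eqv_gnextX]: the two
    vertices share their class and their position in it. *)
Lemma qcycle_next_inj : {in qper &, injective qcycle_next}.
Proof.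
move=> t u tP uP tu; have [x xP tx] := qper_pair tP; have [y yP uy] := qper_pair uP.
have xy : eqv ch k (oX x) (oX y).
  rewrite -eqv_gnextX // -(full_eqv_mul2l ch_mul _ _ full_base_k).
  rewrite -(eqv_eql (qcycle_nextE tP xP tx)) -(eqv_eqr _ (qcycle_nextE uP yP uy)) tu.
  exact: eqv_refl.
have tBu : eqv ch k (oB t) (oB u).
  by rewrite (eqv_eql tx) (eqv_eqr _ uy); apply: eqv_mul2l.
have eclass : qclass t = qclass u.
  by apply: eq_in_filter => v vP; rewrite !qclassE // (eqv_eql tBu).
have enext : qnext_class t = qnext_class u.
  apply: eq_in_filter => v vP.
  rewrite (qnext_classE tP xP vP tx) (qnext_classE uP yP vP uy).
  by apply: eqv_eqr; apply: eqv_mul2l => //; rewrite eqv_gnextX.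
have in_class v : v \in qper -> v \in qclass v.
  by move=> vP; rewrite mem_filter vP qclassE // eqv_refl.
have lt_class v : v \in qper -> index v (qclass v) < size (qnext_class v).
  by move=> vP; rewrite size_qnext_class // index_mem in_class.
have [uqper _ _] := qperP.
move: tu; rewrite /qcycle_next -enext => /eqP.
rewrite (set_nth_default u t) ?lt_class // nth_uniq ?filter_uniq ?lt_class //; last first.
  by rewrite enext lt_class.
rewrite -eclass => /eqP e.
by rewrite -(nth_index t (in_class t tP)) e eclass nth_index // in_class.
Qed.

Lemma qnext_per t : t \in qper -> qnext t = qcycle_next t.
Proof. by rewrite /qnext => ->. Qed.

Lemma iter_qnext_per n t : t \in qper -> iter n qnext t \in qper.
Proof. by move=> tP; elim: n => //= n IHn; rewrite qnext_per // qcycle_next_per. Qed.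

Lemma qnext_surj t : t \in qper -> exists2 u, u \in qper & qnext u = t.
Proof.
have [uqper _ _] := qperP.
have u_map : uniq (map qcycle_next qper) by rewrite map_inj_in_uniq //; exact: qcycle_next_inj.
have sub : {subset map qcycle_next qper <= qper}.
  by move=> _ /mapP[v vP ->]; apply: qcycle_next_per.
have le : size qper <= size (map qcycle_next qper) by rewrite size_map.
have [_ E] := uniq_min_size u_map sub le.
rewrite -E => /mapP[u uP ->].
by exists u => //; rewrite qnext_per.
Qed.

Lemma layer_gvs j t : t \in gvs B -> layer j t -> t \in qvs.
Proof. by move=> tB tj; apply/qvsP; split; last exists j. Qed.

Lemma qnext_transient t : t \in gvs B -> t \notin qper -> qnext t = gnext t.
Proof. by rewrite /qnext => _ /negPf ->. Qed.

Lemma quotient_wf : gwf quotient_graph.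
Proof.
split=> [|t /= /qvsP[tB [[|j]]]]; first by apply: filter_uniq Bwf.1.
  rewrite layer0 => tP; rewrite qnext_per //.
  by apply: (@layer_gvs 0); rewrite ?layer0 ?qper_gvs ?qcycle_next_per.
rewrite layerS => /and3P[nt _ ft].
rewrite qnext_transient //; last by apply: contra nt => /qper_sub.
by apply: layer_gvs ft; apply: Bwf.2.
Qed.

Lemma gper_quotient : perm_eq (gper quotient_graph) qper.
Proof.
have [uqper _ _] := qperP.
apply: uniq_perm; rewrite ?gper_uniq //; first exact: quotient_wf.
move=> t; apply/idP/idP => [/(gperP quotient_wf)[/qvsP[tB [j tj]] [d d0 dt]]|tP].
  have jP : iter j qnext t \in qper.
    elim: j t tj {tB dt} => [|j IHj] t; first by rewrite layer0.
    rewrite layerS iterSr => /and3P[nt _ /IHj].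
    by rewrite /qnext; case: ifP => // /qper_sub; rewrite (negPf nt).
  (* [j * d] steps lead back to [t], and the first [j] of them reach [qper], which is closed under
     [qnext]. *)
  rewrite -(iter_period j dt) -(@subnK j (j * d)) ?leq_pmulr // iterD.
  exact: iter_qnext_per.
have [u uP <-] : exists2 u, u \in qper & iter (size qvs) qnext u = t.
  elim: (size qvs) t tP => [|n IHn] t tP; first by exists t.
  have [u uP <-] := qnext_surj tP; have [v vP <-] := IHn u uP.
  by exists v.
by apply: iter_in_gper; [exact: quotient_wf|apply: (@layer_gvs 0); rewrite ?layer0 ?qper_gvs|].
Qed.

Variable oQ : gvertex quotient_graph -> O.
Hypothesis mQ : model ch oQ.

(** Only transient predecessors are compared: for a periodic [t], [kept j t] may also contain a
    fraction lying on a cycle of [B], which is discarded because [qcycle_next] provides the periodic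
    predecessor. *)
Lemma gpred_quotient j t x : t \in gvs B -> layer j t -> x \in gvs X ->
  eqv ch k (oB t) (mul (oA (back j)) (oX x)) ->
  perm_eq [seq u <- @gpred quotient_graph t | u \notin gper B]
          [seq u <- kept j t | u \notin gper B].
Proof.
move=> tB tj xX tx; have [ukept skept _] := keptP tB xX tx.
apply: uniq_perm; [by do 3 apply: filter_uniq; apply: Bwf.1|exact: filter_uniq|].
move=> u; rewrite mem_filter [RHS]mem_filter.
have [//|nu] := boolP (u \in gper B); rewrite /= [LHS]mem_filter.
have uqper : (u \in qper) = false by apply: contraNF nu => /qper_sub.
rewrite /= /qnext uqper; apply/andP/idP => [[/eqP ut uq]|uk]; last first.
  have := skept u uk; rewrite mem_filter => /andP[/eqP ut uB]; rewrite ut eqxx; split=> //.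
  by apply: (@layer_gvs j.+1); rewrite // layerS nu ut uk.
have [uB [[|i] ui]] := iffLR (qvsP u) uq.
  by rewrite layer0 uqper in ui.
move: ui; rewrite layerS ut => /and3P[_ uk ti].
by rewrite (layer_inj tj ti).
Qed.

Lemma meq_kept_transient j t x : t \in gvs B -> x \in gvs X ->
  eqv ch k (oB t) (mul (oA (back j)) (oX x)) ->
  meq (tlt ch k) (map oB [seq u <- kept j t | u \notin gper B])
    (map (fun y => mul (oA (back j.+1)) (oX y)) [seq y <- gpred x | y \notin gper X]).
Proof.
move=> tB xX tx; have [_ skept M] := keptP tB xX tx.
have kX : size (gvs X) <= k.
  by apply: leq_trans k_XX; apply: leq_trans (leq_sqr _); apply: leq_addr.
have inv u v : tie (tlt ch k) u v -> ~~ full ch k u = ~~ full ch k v.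
  by move=> uv; rewrite (eqv_full uv).
have := meq_filter lt_swo inv M; set f1 := filter _ (kept j t); set f2 := filter _ (gpred x).
have -> : f1 = [seq u <- kept j t | u \notin gper B].
  apply: eq_in_filter => u /skept; rewrite mem_filter => /andP[_ uB].
  by rewrite (full_in_per mB).
have -> // : f2 = [seq y <- gpred x | y \notin gper X].
apply: eq_in_filter => y; rewrite mem_filter => /andP[_ yX].
by rewrite (full_mul ch_mul) full_back (full_in_per mX).
Qed.

(** The hypothesis stays at the fixed depth [k] while the conclusion is at an arbitrary depth [i]:
    [keptP] renews the hypothesis for the predecessors, one layer further from the cycles. *)
Lemma quotient_transient i j t x : t \in gvs B -> layer j t -> t \notin gper B ->
  x \in gvs X -> eqv ch k (oB t) (mul (oA (back j)) (oX x)) -> eqv ch i (oQ t) (oX x).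
Proof.
elim: i j t x => // i IHi j t x tB tj nt xX tx; apply/eqvS.
rewrite mQ ?mX //; last exact: layer_gvs tj.
have tper u : u \in gvs B -> gnext u = t -> u \notin gper B.
  by move=> uB ut; apply: contra nt => uP; rewrite -ut; apply: gnext_per.
have nx : x \notin gper X.
  apply: contra nt => xP; rewrite -(full_in_per mB Bwf tB kB) (eqv_full tx).
  by rewrite (full_mul ch_mul) full_back full_per.
have -> : @gpred quotient_graph t = [seq u <- @gpred quotient_graph t | u \notin gper B].
  apply/esym/all_filterP/allP => u; rewrite mem_filter => /andP[/eqP /= ut uq].
  move: uq ut => /qvsP[uB _]; rewrite /qnext; case: ifP => [uP ut|_]; last exact: tper.
  by rewrite -ut (qper_sub (qcycle_next_per uP)) in nt.
have -> : gpred x = [seq y <- gpred x | y \notin gper X].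
  apply/esym/all_filterP/allP => y; rewrite mem_filter => /andP[/eqP yx _].
  by apply: contra nx => yP; rewrite -yx; apply: gnext_per.
apply: meq_trans (meq_perm (tlt ch i) oQ (gpred_quotient tB tj xX tx)) _.
have [_ skept _] := keptP tB xX tx.
apply: (meq_transfer lt_swo (tlt_swo ch i)) (meq_kept_transient tB xX tx).
move=> u y; rewrite mem_filter => /andP[nu uk]; rewrite mem_filter => /andP[_ /sub_gpred yX].
have := skept u uk; rewrite mem_filter => /andP[/eqP ut uB].
by apply: (IHi j.+1); rewrite // layerS nu ut uk.
Qed.

Lemma gpred_per_split (G : graph) (v : gvertex G) : gwf G -> v \in gper G ->
  perm_eq (gpred (gnext v)) (v :: [seq u <- gpred (gnext v) | u \notin gper G]).
Proof.
move=> Gwf vP; rewrite -(perm_filterC (mem (gper G)) (gpred (gnext v))).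
rewrite -cat1s perm_cat2r; apply: uniq_perm => //; first by rewrite filter_uniq ?gpred_uniq.
move=> u; rewrite !mem_filter inE; apply/and3P/eqP => [[uP /eqP uv _]|->].
  exact: (gnext_inj Gwf).
by rewrite eqxx gper_sub.
Qed.

(** The transient predecessors are treated by [quotient_transient] in layer 1. There remains one
    periodic predecessor on each side, [u] and [y], to which the induction hypothesis applies. *)
Lemma quotient_periodic i t x : t \in qper -> x \in gper X ->
  eqv ch k (oB t) (mul (oA base) (oX x)) -> eqv ch i (oQ t) (oX x).
Proof.
elim: i t x => // i IHi t x tP xP tx; apply/eqvS.
have [tB xX] := (qper_gvs tP, gper_sub xP).
have t0 : layer 0 t by rewrite layer0.
have tx0 : eqv ch k (oB t) (mul (oA (back 0)) (oX x)) by rewrite back0.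
rewrite mQ ?mX //; last exact: layer_gvs t0.
have [u uP ut] := qnext_surj tP; have [y yP yx] := iter_surj Xwf 1 xP.
rewrite /= in yx; have [z zP uz] := qper_pair uP.
(* [u] stands for some [z], not necessarily for [y]; but the successors of [z] and [y] have equal
   trees, so [z] and [y] have too. *)
have zy : eqv ch k (oX z) (oX y).
  rewrite -eqv_gnextX // yx -(full_eqv_mul2l ch_mul _ _ full_base_k).
  by rewrite -(eqv_eqr _ tx) -ut qnext_per // eqv_sym; apply: qcycle_nextE.
have uy : eqv ch k (oB u) (mul (oA base) (oX y)).
  by rewrite (eqv_eql uz); apply: eqv_mul2l.
apply: (meq_trans (Y := map oQ (u :: [seq v <- kept 0 t | v \notin gper B]))).
  apply: meq_perm; apply: perm_trans (_ : perm_eq (u :: [seq v <- @gpred quotient_graph t | v \notin gper B]) _); last first.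
    by rewrite perm_cons; apply: gpred_quotient tx0.
  have uQ : u \in gper quotient_graph by rewrite (perm_mem gper_quotient).
  have := gpred_per_split quotient_wf uQ; rewrite -[@gnext quotient_graph u]/(qnext u) ut.
  set f1 := filter _ _; set f2 := filter _ _; suff -> : f1 = f2 by [].
  apply: eq_in_filter => v; rewrite (perm_mem gper_quotient) mem_filter => /andP[_ vq].
  have [_ [j vj]] := iffLR (qvsP v) vq; congr (~~ _).
  apply/idP/idP => [/qper_sub //|vP]; rewrite -layer0.
  by rewrite -(layer_per vj vP).
rewrite -yx; apply: meq_trans (meq_perm _ _ _); last first.
  by rewrite perm_sym; apply: gpred_per_split; rewrite ?yx.
rewrite yx => s /=; rewrite -/(eqv ch i s (oQ u)) (eqv_eqr _ (IHi _ _ uP yP uy)); congr (_ + _).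
have [_ skept _] := keptP tB xX tx0.
apply: (meq_transfer lt_swo (tlt_swo ch i)) (meq_kept_transient tB xX tx0) s.
move=> v w; rewrite mem_filter => /andP[nv vk]; rewrite mem_filter => /andP[_ /sub_gpred wX].
have := skept v vk; rewrite mem_filter => /andP[/eqP vt vB].
by apply: (@quotient_transient i 1); rewrite // layerS nv vt vk.
Qed.

Theorem quotient_graphP i :
  meq (tlt ch i) (map oQ (gper quotient_graph)) (map oX (gper X)).
Proof.
apply: meq_trans (meq_perm (tlt ch i) oQ gper_quotient) _.
have [_ _ M] := qperP.
apply: (meq_transfer lt_swo (tlt_swo ch i)) M => t x tP xP.
exact: quotient_periodic.
Qed.

End QuotientGraph.

(** * Tables and the division algorithm *)

Section Refinement.
Variable V : eqType.

Definition in_rel (L : seq (V * V)) : rel V := fun u v => (u, v) \in L.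

Definition edges_pred (E : seq (V * V)) (v : V) : seq V := [seq e.1 | e <- E & e.2 == v].

(** One level of the recursion of [tlt], tabulated for all pairs of vertices at once so that a level
    costs polynomial time. The number of rounds in [refine] is the stabilisation bound [n * n], as
    there is one edge for each vertex. *)
Definition refine_step (E L : seq (V * V)) : seq (V * V) :=
  [seq p <- [seq (u, v) | u <- map fst E, v <- map fst E]
     | in_rel L p.1 p.2 ||
       ~~ in_rel L p.2 p.1 && mlt (in_rel L) (edges_pred E p.1) (edges_pred E p.2)].

Definition refine (E : seq (V * V)) : seq (V * V) :=
  iter (size E * size E) (refine_step E) [::].

End Refinement.

Definition edges (G : graph) : seq (gvertex G * gvertex G) :=
  [seq (v, gnext v) | v <- gvs G].

Lemma mlt_map (S : eqType) (T : Type) (o : S -> T) (l : rel S) (l' : rel T) (X Y : seq S) :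
  {in X ++ Y &, forall x y, l x y = l' (o x) (o y)} ->
  mlt l X Y = mlt l' (map o X) (map o Y).
Proof.
move=> ll'; rewrite /mlt -map_cat has_map; apply: eq_in_has => x xXY /=.
have cE s Z : s \in X ++ Y -> {subset Z <= X ++ Y} ->
    count (tie l s) Z = count (tie l' (o s)) (map o Z).
  move=> sXY ZXY; rewrite count_map; apply: eq_in_count => z /ZXY zXY.
  by rewrite /= /tie !ll'.
have XXY : {subset X <= X ++ Y} by move=> z; rewrite mem_cat => ->.
have YXY : {subset Y <= X ++ Y} by move=> z; rewrite mem_cat orbC => ->.
rewrite !cE //; congr (_ && _); rewrite all_map; apply: eq_in_all => s sXY /=.
by rewrite !cE // ll'.
Qed.

Lemma edges_predE G v : edges_pred (edges G) v = gpred v.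
Proof.
by rewrite /edges_pred /edges filter_map -map_comp map_id.
Qed.

Section RefinementCorrect.
Variables (O : Type) (ch : O -> seq O) (G : graph) (o : gvertex G -> O).
Hypothesis oG : model ch o.

Lemma iter_refine k : {in gvs G &, forall u v,
  in_rel (iter k (refine_step (edges G)) [::]) u v = tlt ch k (o u) (o v)}.
Proof.
elim: k => [|k IHk] u v uG vG //; rewrite iterS {1}/in_rel mem_filter /=.
have -> : map fst (edges G) = gvs G by rewrite -map_comp map_id.
rewrite allpairs_f // andbT !IHk // !edges_predE !oG //.
congr (_ || _ && _); apply: mlt_map => x y.
by rewrite !mem_cat => /orP[] /sub_gpred xG /orP[] /sub_gpred yG; apply: IHk.
Qed.

Lemma refineP k : size (gvs G) * size (gvs G) <= k ->
  {in gvs G &, forall u v, in_rel (refine (edges G)) u v = tlt ch k (o u) (o v)}.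
Proof.
by move=> nk u v uG vG; rewrite iter_refine // size_map (tlt_stable oG uG vG nk).
Qed.

End RefinementCorrect.

(** * Graphs given by tables, and a concrete type of trees for them *)

Definition gtab (t : seq nat) : graph := @Graph nat (iota 0 (size t)) (nth 0 t).

Definition relabel (G : graph) : seq nat := [seq index (gnext v) (gvs G) | v <- gvs G].

(* A list of pointed tables stands for the product of their unroll trees; the
   product of such lists is their concatenation. *)
Definition wtree : Type := seq (seq nat * nat).

(** The empty list is the infinite path, the unit of the product. Concatenation then satisfies the
    law [ch_mul] assumed of products ([wch_cat]). *)
Fixpoint wch (w : wtree) : seq wtree :=
  if w is (t, i) :: w' then
    [seq (t, j) :: z | j <- @gpred (gtab t) i, z <- wch w']
  else [:: [::]].

Definition leaf (t : seq nat) (i : nat) : wtree := [:: (t, i)].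

Lemma wch_cat a b : wch (a ++ b) = [seq x ++ y | x <- wch a, y <- wch b].
Proof.
elim: a => [|[t i] a IHa] /=; first by rewrite cats0 map_id.
rewrite IHa; elim: (@gpred (gtab t) i) => //= j s IHs.
rewrite IHs [RHS](congr1 flatten (map_cat _ _ _)) flatten_cat; congr (_ ++ _).
by rewrite map_allpairs allpairs_mapl.
Qed.

Lemma model_tab t : @model _ wch (gtab t) (leaf t).
Proof.
move=> v _; rewrite /= /leaf; by elim: (gpred _) => //= j s ->.
Qed.

Section Relabel.
Variable G : graph.
Hypothesis Gwf : gwf G.
Let n := size (gvs G).
Let r (v : gvertex G) : nat := index v (gvs G).

Lemma size_relabel : size (relabel G) = n. Proof. exact: size_map. Qed.

Lemma map_index_gvs : map r (gvs G) = iota 0 n.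
Proof.
case E : (gvs G) => [|v0 s]; first by rewrite /n E.
apply: (@eq_from_nth _ 0); first by rewrite size_map size_iota /n E.
move=> i; rewrite size_map => il; rewrite (nth_map v0) // nth_iota /n ?E //.
by rewrite /r E index_uniq //; have := Gwf.1; rewrite E.
Qed.

Lemma nth_relabel v : v \in gvs G -> nth 0 (relabel G) (r v) = r (gnext v).
Proof. by move=> vG; rewrite (nth_map v) ?index_mem // nth_index. Qed.

Lemma r_inj : {in gvs G &, injective r}.
Proof. by move=> u v uG vG uv; rewrite -(nth_index u uG) -/(r u) uv nth_index. Qed.

Lemma gpred_relabel v : v \in gvs G ->
  @gpred (gtab (relabel G)) (r v) = map r (gpred v).
Proof.
move=> vG; rewrite /gpred /= size_relabel -map_index_gvs filter_map.
congr map; apply: eq_in_filter => u uG /=; rewrite nth_relabel //.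
by rewrite (inj_in_eq r_inj) // Gwf.2.
Qed.

Lemma model_relabel : model wch (fun v => leaf (relabel G) (r v)).
Proof.
move=> v vG; rewrite (@model_tab (relabel G) (r v)); last first.
  by rewrite mem_iota size_relabel index_mem.
by rewrite gpred_relabel // -map_comp.
Qed.

Lemma gper_relabel : gper (gtab (relabel G)) = map r (gper G).
Proof.
rewrite /gper /= size_relabel size_iota -map_index_gvs filter_map.
congr map; apply: eq_in_filter => v vG /=; rewrite has_map; apply: eq_in_has => u uG /=.
have E m : iter m (nth 0 (relabel G)) (r u) = r (iter m (@gnext G) u).
  elim: m => //= m ->; rewrite nth_relabel //; exact: iter_gnext.
by rewrite E (inj_in_eq r_inj) // iter_gnext.
Qed.

Lemma map_gper_relabel :
  map (leaf (relabel G)) (gper (gtab (relabel G))) = map (fun v => leaf (relabel G) (r v)) (gper G).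
Proof. by rewrite gper_relabel -map_comp. Qed.

End Relabel.

(* Vertices [(a, x)] with [a < size tA] form the product of [tA] and [tX];
   the other ones are the pairs [(size tA, b)], with [b] in [tB]. *)
Definition gcheck (tA tX tB : seq nat) : graph :=
  @Graph (nat * nat)%type
    ([seq (a, x) | a <- iota 0 (size tA), x <- iota 0 (size tX)] ++
     [seq (size tA, b) | b <- iota 0 (size tB)])
    (fun p => if p.1 < size tA then (nth 0 tA p.1, nth 0 tX p.2) else (p.1, nth 0 tB p.2)).

Definition check (tA tX tB : seq nat) : bool :=
  let lt := in_rel (refine (edges (gcheck tA tX tB))) in
  let X := [seq (a, x) | a <- gper (gtab tA), x <- gper (gtab tX)] in
  let Y := [seq (size tA, b) | b <- gper (gtab tB)] in
  all (fun t => count (tie lt t) X == count (tie lt t) Y) (X ++ Y).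

Definition forest_of (t : seq nat) : seq wtree := map (leaf t) (gper (gtab t)).

Section CheckCorrect.
Variables tA tX tB : seq nat.
Hypotheses (Awf : gwf (gtab tA)) (Xwf : gwf (gtab tX)) (Bwf : gwf (gtab tB)).
Let G := gcheck tA tX tB.
Let o (p : nat * nat) : wtree :=
  if p.1 < size tA then leaf tA p.1 ++ leaf tX p.2 else leaf tB p.2.

Let A := gtab tA.
Let X := gtab tX.
Let B := gtab tB.

Let nth_ltA a : a < size tA -> nth 0 tA a < size tA.
Proof. by move=> aA; have := Awf.2 a; rewrite /= !mem_iota; apply. Qed.

Lemma gpred_check_prod a x : a < size tA ->
  @gpred G (a, x) = @gpred (gprod A X) (a, x).
Proof.
move=> aA; rewrite /gpred [gvs G]/= filter_cat [Y in _ ++ Y](_ : _ = [::]) ?cats0; last first.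
  rewrite filter_map (eq_filter (a2 := pred0)) ?filter_pred0 // => b /=.
  by rewrite ltnn xpair_eqE; case: eqP aA => // <-; rewrite ltnn.
apply: eq_in_filter => _ /allpairsP[[c z] [+ _ ->]].
by rewrite mem_iota /= => cA; rewrite cA.
Qed.

Lemma gpred_check_right b : @gpred G (size tA, b) = [seq (size tA, c) | c <- @gpred B b].
Proof.
rewrite /gpred [gvs G]/= filter_cat [Y in Y ++ _](_ : _ = [::]) ?cat0s.
  rewrite filter_map; congr map; apply: eq_filter => c /=.
  by rewrite ltnn xpair_eqE eqxx.
rewrite (@eq_in_filter _ _ pred0) ?filter_pred0 // => _ /allpairsP[[c z] [+ _ ->]].
rewrite mem_iota /= => cA; rewrite cA xpair_eqE.
by have := nth_ltA cA; rewrite ltn_neqAle => /andP[/negPf ->].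
Qed.

Lemma model_check : @model _ wch G o.
Proof.
move=> p; rewrite mem_cat => /orP[pAX|/mapP[b bB ->]].
  have := pAX => /allpairsP[[a x] [+ _ pE]]; rewrite mem_iota /= => aA.
  rewrite pE gpred_check_prod // {1}/o /= aA.
  have := model_prod wch_cat (@model_tab tA) (@model_tab tX) pAX.
  rewrite pE /= => ->; apply/eq_in_map => -[c z]; rewrite mem_filter => /andP[_].
  by case/allpairsP=> -[c' z'] [+ _ [-> _]]; rewrite mem_iota /o /= => ->.
rewrite gpred_check_right {1}/o /= ltnn -/(wch (leaf tB b)) (@model_tab tB b) //.
by rewrite -map_comp; apply: eq_map => c; rewrite /o /= ltnn.
Qed.

(** The comparison runs in a single graph containing both the product and [tB], so that one
    refinement decides ties between their vertices. *)
Lemma checkP :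
  check tA tX tB <->
  forall k, meq (tlt wch k) (forest_of tB)
    [seq x ++ y | x <- forest_of tA, y <- forest_of tX].
Proof.
set X0 := [seq (a, x) | a <- gper A, x <- gper X].
set Y0 := [seq (size tA, b) | b <- gper B].
have XG : {subset X0 <= gvs G}.
  move=> _ /allpairsP[[a x] [/gper_sub aA /gper_sub xX ->]].
  by rewrite mem_cat (allpairs_f _ aA xX).
have YG : {subset Y0 <= gvs G}.
  by move=> _ /mapP[b /gper_sub bB ->]; rewrite mem_cat orbC map_f.
have oX0 : map o X0 = [seq x ++ y | x <- forest_of tA, y <- forest_of tX].
  rewrite map_allpairs allpairs_mapl allpairs_mapr.
  by apply/eq_in_allpairs => a x /gper_sub + _; rewrite mem_iota /o /= => ->.
have oY0 : map o Y0 = forest_of tB.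
  by rewrite -map_comp; apply: eq_map => b; rewrite /o /= ltnn.
pose N := size (gvs G) * size (gvs G).
have tieE k : N <= k -> {in gvs G &, forall u v,
    tie (in_rel (refine (edges G))) u v = eqv wch k (o u) (o v)}.
  by move=> Nk u v uG vG; rewrite /tie !(refineP model_check Nk).
have cE k t Z : N <= k -> t \in gvs G -> {subset Z <= gvs G} ->
    count (tie (in_rel (refine (edges G))) t) Z = count (eqv wch k (o t)) (map o Z).
  move=> Nk tG ZG; rewrite count_map; apply: eq_in_count => z /ZG zG; exact: tieE.
rewrite -oX0 -oY0; split=> [/allP chk k t|H].
  (* The computed relation is exact from depth [N] on; smaller depths follow by coarsening. *)
  suff : meq (tlt wch (maxn k N)) (map o Y0) (map o X0).
    move=> /(meq_count (tlt_swo _ _)); apply=> u v uv; apply: eqv_eqr.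
    exact: eqv_leq (leq_maxl k N) uv.
  move=> {}t; have Nk : N <= maxn k N := leq_maxr k N.
  have [|nt] := boolP (has (fun z => eqv wch (maxn k N) t (o z)) (X0 ++ Y0)).
    case/hasP=> z zXY tz; have zG : z \in gvs G.
      by move: zXY; rewrite mem_cat => /orP[/XG|/YG].
    rewrite !(eq_count (eqv_eql tz)) -!cE //; apply/esym/eqP; exact: chk.
  move: nt; rewrite has_cat => /norP[].
  by rewrite !has_count -!eqn0Ngt !count_map => /eqP -> /eqP ->.
apply/allP => t; rewrite mem_cat => tXY.
have tG : t \in gvs G by case/orP: tXY => [/XG|/YG].
by rewrite !(cE N) // [X in _ == X]H.
Qed.

End CheckCorrect.

(** The default [size tB] is not a vertex of [tB], as the division requires. *)
Definition quotient_table (tA tB : seq nat) : seq nat :=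
  relabel (@quotient_graph (gtab tA) (gtab tB) 0 (size tB)
    (in_rel (refine (edges (gprod (gtab tA) (gtab tB)))))).

Definition valid_table (t : seq nat) : bool := all (fun i => i < size t) t.

Lemma gwf_tab t : valid_table t -> gwf (gtab t).
Proof.
move=> /allP tP; split=> [|i /=]; first exact: iota_uniq.
by rewrite !mem_iota => it; apply: tP; rewrite mem_nth.
Qed.

Lemma valid_relabel G : gwf G -> valid_table (relabel G).
Proof.
move=> Gwf; apply/allP => _ /mapP[v vG ->].
by rewrite size_relabel index_mem Gwf.2.
Qed.

(** Cancellation at work: the table computed from [tA] and [tB] alone has the unroll of any solution
    [tX]. *)
Lemma gwf_quotient_graph tA tX tB :
  valid_table tA -> valid_table tX -> valid_table tB -> tA != [::] ->
  (forall k, meq (tlt wch k) (forest_of tB) [seq x ++ y | x <- forest_of tA, y <- forest_of tX]) ->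
  valid_table (quotient_table tA tB) /\
  forall k, meq (tlt wch k) (forest_of (quotient_table tA tB)) (forest_of tX).
Proof.
move=> /gwf_tab Awf /gwf_tab Xwf /gwf_tab Bwf tA0 sol.
pose A := gtab tA; pose B := gtab tB; pose X := gtab tX.
pose nA := size (gvs A); pose nB := size (gvs B); pose nX := size (gvs X).
pose k1 := (nB + nA * nX) * (nB + nA * nX); pose k2 := (nX + nX) * (nX + nX).
pose k3 := (nB + nB) * (nB + nB); pose k4 := nA * nB * (nA * nB).
(* [k1] and [k2] involve the hypothetical [X]; the algorithm does not depend on [k], since its
   refinement agrees with all depths from [k4] on. *)
pose k := k1 + k2 + k3 + k4.
have K1 : k1 <= k by rewrite /k -!addnA leq_addr.
have K2 : k2 <= k by rewrite /k -!addnA addnCA leq_addr.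
have K3 : k3 <= k by rewrite /k -addnA addnCA leq_addr.
have K4 : k4 <= k by rewrite /k leq_addl.
have Aper : gper A != [::].
  have n0 : 0 \in gvs A by rewrite mem_iota /=; case: (tA) tA0.
  by have := iter_in_gper Awf n0 (leqnn _); case: (gper A).
have b0B : size tB \notin gvs B by rewrite mem_iota /= ltnn.
pose lt := in_rel (refine (edges (gprod A B))).
have ltE : {in gvs A & gvs B, forall a b, {in gvs A & gvs B, forall a' b',
    lt (a, b) (a', b') = tlt wch k (leaf tA a ++ leaf tB b) (leaf tA a' ++ leaf tB b')}}.
  move=> a b aA bB a' b' a'A b'B.
  have M := model_prod wch_cat (@model_tab tA) (@model_tab tB).
  by rewrite /lt (refineP M (k := k)) ?mem_gprod ?aA ?a'A //= size_allpairs.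
have Qwf := @quotient_wf A B 0 _ _ _ _ _ wch_cat X _ _ _ (@model_tab tA) (@model_tab tB) (@model_tab tX) Awf Bwf Xwf
  b0B Aper k K1 K2 K3 ltE (sol k).
split=> [|i]; first exact: valid_relabel.
rewrite /forest_of map_gper_relabel //.
exact: (@quotient_graphP A B 0 _ _ _ _ _ wch_cat X _ _ _ (@model_tab tA) (@model_tab tB) (@model_tab tX) Awf Bwf Xwf
  b0B Aper k K1 K2 K3 ltE (sol k) _ (model_relabel Qwf)).
Qed.

(** An empty [tA] has no periodic state to serve as [base]; all products are then empty, so the
    empty table is a solution if there is any. *)
Definition answer (tA tB : seq nat) : option (seq nat) :=
  let tX := if nilp tA then [::] else quotient_table tA tB in
  if valid_table tX && check tA tX tB then Some tX else None.

Definition divides (tA tX tB : seq nat) : Prop :=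
  forall k, meq (tlt wch k) (forest_of tB) [seq x ++ y | x <- forest_of tA, y <- forest_of tX].

(** Any solution has the same unroll as the computed table, so that table must pass the check; if it
    fails, there is no solution. *)
Lemma answerP tA tB : valid_table tA -> valid_table tB ->
  match answer tA tB with
  | Some tX => valid_table tX /\ divides tA tX tB
  | None => forall tX, valid_table tX -> ~ divides tA tX tB
  end.
Proof.
move=> Av Bv; rewrite /answer; set tQ := (if nilp tA then _ else _).
case: (boolP (valid_table tQ && check tA tQ tB)) => [/andP[Qv chk]|nchk tX Xv div].
  by split=> //; apply/checkP => //; apply: gwf_tab.
case/negP: nchk; move: @tQ; case: nilP => [tA0|/eqP tA0] tQ.
  apply/andP; split=> //; apply/checkP; try exact: gwf_tab.
  by move: div; rewrite /divides tA0.
have [Qv QX] := gwf_quotient_graph Av Xv Bv tA0 div.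
rewrite Qv; apply/checkP; try exact: gwf_tab.
move=> k; apply: meq_trans (div k) _ => t; rewrite !count_allpairs; apply: eq_bigr => x _.
rewrite -!count_sum; symmetry; apply: (meq_count (tlt_swo wch k) (QX k)) => u v uv.
by apply: eqv_eqr; apply: (eqv_mul2l wch_cat).
Qed.

(** * Polynomial time *)

(** Polynomials with natural coefficients: they are monotone, which makes bounds compose. *)
Inductive poly : (nat -> nat) -> Prop :=
  | PolyConst c : poly (fun _ => c)
  | PolyId : poly (fun n => n)
  | PolyAdd f g : poly f -> poly g -> poly (fun n => f n + g n)
  | PolyMul f g : poly f -> poly g -> poly (fun n => f n * g n).

Lemma poly_comp f g : poly f -> poly g -> poly (fun n => f (g n)).
Proof.
by move=> pf pg; elim: pf => [c|//|f1 f2 _ p1 _ p2|f1 f2 _ p1 _ p2];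
  [apply: PolyConst|apply: PolyAdd|apply: PolyMul].
Qed.

Ltac poly_tac :=
  lazymatch goal with
  | |- poly (fun n => n) => exact PolyId
  | |- poly (fun n => addn (@?f n) (@?g n)) => apply (@PolyAdd f g); poly_tac
  | |- poly (fun n => muln (@?f n) (@?g n)) => apply (@PolyMul f g); poly_tac
  | |- poly (fun n => S (@?f n)) => apply (PolyAdd (PolyConst 1) (g := f)); poly_tac
  | H : poly ?q |- poly ?q => exact H
  | H : poly ?q |- poly (fun n => ?q (@?f n)) => apply (@poly_comp q f H); poly_tac
  | |- _ => exact (PolyConst _)
  end.

Lemma poly_leq f m n : poly f -> m <= n -> f m <= f n.
Proof. by move=> pf mn; elim: pf => // *; rewrite ?leq_add ?leq_mul. Qed.

Lemma poly_bound f : poly f -> exists c d, forall n, f n <= c * n ^ d + c.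
Proof.
(* With the positive base [n.+1], powers grow with the exponent, so sums and products of bounds may
   use the sum of the exponents. Going back costs a factor [2 ^ d], and the additive constant covers
   [n = 0]. *)
move=> pf; suff [c [d cd]] : exists c d, forall n, f n <= c * n.+1 ^ d.
  exists (c * 2 ^ d), d => n; apply: leq_trans (cd n) _.
  case: n => [|n]; first by rewrite exp1n muln1 (leq_trans _ (leq_addl _ _)) // leq_pmulr ?expn_gt0.
  rewrite -mulnA -expnMn (leq_trans _ (leq_addr _ _)) // leq_mul //.
  case: d {cd} => // d; rewrite leq_exp2r // mul2n -addnn addSn ltnS.
  by rewrite leq_addl.
elim: pf => [c||g h _ [c [d cd]] _ [c' [d' cd']]|g h _ [c [d cd]] _ [c' [d' cd']]].
- by exists c, 0 => n; rewrite muln1.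
- by exists 1, 1 => n; rewrite mul1n expn1.
- exists (c + c'), (d + d') => n; rewrite mulnDl.
  by apply: leq_add; [apply: leq_trans (cd n) _|apply: leq_trans (cd' n) _];
    rewrite leq_mul // leq_pexp2l ?leq_addl ?leq_addr.
exists (c * c'), (d + d') => n; rewrite expnD mulnACA; exact: leq_mul.
Qed.

Fixpoint dsize (d : data) : nat := if d is Node a b then (dsize a + dsize b).+1 else 1.

Lemma dsize_gt0 d : 0 < dsize d. Proof. by case: d. Qed.

(** * Linking programs *)

Fixpoint reloc (n m : nat) (e : expr) : expr :=
  match e with
  | EVar i => EVar i
  | ELeaf => ELeaf
  | ENode e1 e2 => ENode (reloc n m e1) (reloc n m e2)
  | EHd e => EHd (reloc n m e)
  | ETl e => ETl (reloc n m e)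
  | EIf e e1 e2 => EIf (reloc n m e) (reloc n m e1) (reloc n m e2)
  | ELet e1 e2 => ELet (reloc n m e1) (reloc n m e2)
  (* an undefined function returns [Leaf] *)
  | ECall f e => if f < n then ECall (m + f) (reloc n m e) else ELet (reloc n m e) ELeaf
  end.

Lemma eval_reloc (p q : program) m env e v k :
  (forall f, f < size p -> nth ELeaf q (m + f) = reloc (size p) m (nth ELeaf p f)) ->
  eval p env e v k -> eval q env (reloc (size p) m e) v k.
Proof.
move=> pq; elim=> {env e v k}; try by [constructor|econstructor; eauto].
move=> env f e v w k1 k2 _ ev1 ev2' ev2 /=; case: ltnP => [fp|pf].
  by econstructor; first exact: ev1; rewrite pq.
rewrite nth_default // in ev2'; inversion ev2'; subst.
by econstructor; [exact: ev1|constructor].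
Qed.

Definition link (main p1 p2 : program) : program :=
  main ++ map (reloc (size p1) (size main)) p1
       ++ map (reloc (size p2) (size main + size p1)) p2.

Lemma eval_link1 main p1 p2 env e d v k k' : 0 < size p1 ->
  eval (link main p1 p2) env e d k' -> runs p1 d v k ->
  eval (link main p1 p2) env (ECall (size main) e) v (k' + k).+1.
Proof.
move=> p1_gt0 ev ru; econstructor; first exact: ev.
have E f : f < size p1 -> nth ELeaf (link main p1 p2) (size main + f)
    = reloc (size p1) (size main) (nth ELeaf p1 f).
  move=> fp; rewrite nth_cat ltnNge leq_addr /= addKn nth_cat size_map fp.
  by rewrite (nth_map ELeaf).
by rewrite -[size main]addn0 E //; apply: eval_reloc ru.
Qed.

Lemma eval_link2 main p1 p2 env e d v k k' : 0 < size p2 ->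
  eval (link main p1 p2) env e d k' -> runs p2 d v k ->
  eval (link main p1 p2) env (ECall (size main + size p1) e) v (k' + k).+1.
Proof.
move=> p2_gt0 ev ru; econstructor; first exact: ev.
have E f : f < size p2 -> nth ELeaf (link main p1 p2) (size main + size p1 + f)
    = reloc (size p2) (size main + size p1) (nth ELeaf p2 f).
  move=> fp; rewrite nth_cat -addnA ltnNge leq_addr /= addKn nth_cat size_map.
  by rewrite ltnNge leq_addr /= addKn (nth_map ELeaf).
by rewrite -[size main + size p1]addn0 E //; apply: eval_reloc ru.
Qed.

(** * Codes of data types and combinators for polynomial-time functions *)

Class coded (T : Type) := code : T -> data.

#[export] Instance coded_unit : coded unit := fun _ => Leaf.
#[export] Instance coded_bool : coded bool := fun b => if b then Node Leaf Leaf else Leaf.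
#[export] Instance coded_nat : coded nat := code_nat.
#[export] Instance coded_prod S T `{coded S} `{coded T} : coded (S * T) :=
  fun x => Node (code x.1) (code x.2).
#[export] Instance coded_seq T `{coded T} : coded (seq T) :=
  foldr (fun x => Node (code x)) Leaf.
#[export] Instance coded_option T `{coded T} : coded (option T) :=
  fun r => if r is Some x then Node (code x) Leaf else Leaf.

Definition csize T `{coded T} (x : T) : nat := dsize (code x).

(* Sharing allows a program to build a value of exponential size, so the size of
   the result is bounded as well. *)
Definition pt S T `{coded S} `{coded T} (f : S -> T) : Prop :=
  exists (p : program) (q : nat -> nat),
    [/\ 0 < size p, poly q & forall x, exists k,
      [/\ runs p (code x) (code (f x)) k, k <= q (csize x) & csize (f x) <= q (csize x)]].


Lemma pt_ext S T `{coded S} `{coded T} (f g : S -> T) : f =1 g -> pt f -> pt g.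
Proof.
move=> fg [p [q [p0 pq fP]]]; exists p, q; split=> // x.
by rewrite -fg.
Qed.

Lemma pt_expr S T `{coded S} `{coded T} (f : S -> T) (e : expr) (c : nat) :
  (forall p x, exists k,
    [/\ eval p [:: code x] e (code (f x)) k, k <= c & csize (f x) <= csize x + c]) -> pt f.
Proof.
move=> fP; exists [:: e], (fun n => n + c); split=> //.
  by poly_tac.
move=> x; have [k [ev kc sc]] := fP [:: e] x; exists k; split=> //.
exact: leq_trans (leq_addl _ _).
Qed.

Lemma pt_id S `{coded S} : pt (fun x : S => x).
Proof.
apply: (pt_expr (e := EVar 0) (c := 1)) => p x; exists 1; split; [constructor|by []|exact: leq_addr].
Qed.

Lemma pt_comp S T U `{coded S} `{coded T} `{coded U} (g : T -> U) (f : S -> T) : pt g -> pt f -> pt (fun x => g (f x)).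
Proof.
move=> [pg [qg [pg0 qgP gP]]] [pf [qf [pf0 qfP fP]]].
exists (link [:: ECall (1 + size pf) (ECall 1 (EVar 0))] pf pg).
exists (fun n => qg (qf n) + qf n + 3); split=> //.
  by poly_tac.
move=> x; have [k [fr kq sq]] := fP x; have [k' [gr kq' sq']] := gP (f x).
have le : qg (csize (f x)) <= qg (qf (csize x)) by apply: poly_leq.
exists ((1 + k).+1 + k').+1; split.
- by apply: eval_link2 gr => //; apply: eval_link1 fr => //; constructor.
- rewrite !addnS !addSn add0n addn0 addnC !ltnS leq_add //; exact: leq_trans le.
by rewrite (leq_trans sq') // (leq_trans le) // -addnA leq_addr.
Qed.

Lemma pt_pair S T U `{coded S} `{coded T} `{coded U} (f : S -> T) (g : S -> U) : pt f -> pt g -> pt (fun x => (f x, g x)).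
Proof.
move=> [pf [qf [pf0 qfP fP]]] [pg [qg [pg0 qgP gP]]].
exists (link [:: ENode (ECall 1 (EVar 0)) (ECall (1 + size pf) (EVar 0))] pf pg).
exists (fun n => qf n + qg n + 5); split=> //.
  by poly_tac.
move=> x; have [k [fr kq sq]] := fP x; have [k' [gr kq' sq']] := gP x.
exists ((1 + k).+1 + (1 + k').+1).+1; split.
- by constructor; [apply: eval_link1 fr|apply: eval_link2 gr] => //; constructor.
- by rewrite !addnS !addSn !add0n addn0 !ltnS leq_add.
by rewrite /csize /= in sq sq' *; lia.
Qed.

Ltac eval_term p env e :=
  lazymatch e with
  | EVar ?i => constr:(EvVar p env i)
  | ELeaf => constr:(EvLeaf p env)
  | ENode ?e1 ?e2 =>
      let h1 := eval_term p env e1 in let h2 := eval_term p env e2 in constr:(EvNode h1 h2)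
  | EHd ?e1 => let h1 := eval_term p env e1 in constr:(EvHd h1)
  | ETl ?e1 => let h1 := eval_term p env e1 in constr:(EvTl h1)
  end.

Ltac eval_tac :=
  lazymatch goal with |- eval ?p ?env ?e _ _ =>
    let h := eval_term p env e in exact h
  end.

(** The argument is a triple made of the parameter, the accumulator and the remaining list. Function
    1 is the loop itself, called in tail position, and function [n] is the body. *)
Definition loop_expr n : expr :=
  let l := ETl (ETl (EVar 0)) in
  EIf l
    (ECall 1 (ENode (EHd (EVar 0))
      (ENode (ECall n (ENode (EHd (EVar 0)) (ENode (EHd (ETl (EVar 0))) (EHd l))))
        (ETl l))))
    (EHd (ETl (EVar 0))).

(** The accumulators need a bound of their own: iterating the size bound of [f] would not give a
    polynomial. With it, the time is at most one polynomial cost per element. *)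
Lemma pt_foldl G T U `{coded G} `{coded T} `{coded U} (f : G -> U -> T -> U) (u0 : G -> U) (l : G -> seq T) :
  pt (fun z : G * (U * T) => f z.1 z.2.1 z.2.2) -> pt u0 -> pt l ->
  (exists2 q, poly q & forall x i, i <= size (l x) ->
    csize (foldl (f x) (u0 x) (take i (l x))) <= q (csize x)) ->
  pt (fun x => foldl (f x) (u0 x) (l x)).
Proof.
move=> [pf [qf [pf0 qfP fP]]] u0P lP [q qP foldP].
have [pu [qu [pu0 quP uP]]] := u0P; have [pl [ql [pl0 qlP llP]]] := lP.
have [p1 [q1 [p10 q1P initP]]] : pt (fun x => (x, (u0 x, l x))).
  by apply: pt_pair; [exact: pt_id|exact: pt_pair].
pose main := [:: ECall 1 (ECall 2 (EVar 0)); loop_expr (2 + size p1)].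
exists (link main p1 pf).
(* [W] bounds each of the three components passed to [f], and the constant 50 covers the other
   operations of one round. *)
pose W n := n + q n + ql n; pose C n := qf (W n * 3 + 2) + 50.
exists (fun n => q1 n + (ql n).+1 * C n + q n + 10); split=> //.
  by rewrite /C /W; poly_tac.
move=> x; set n := csize x; have [k [ir kq sq]] := initP x.
have loopP l1 u : (forall i, i <= size l1 -> csize (foldl (f x) u (take i l1)) <= q n) ->
    csize l1 <= ql n -> exists k,
    eval (link main p1 pf) [:: code (x, (u, l1))] (loop_expr (2 + size p1))
      (code (foldl (f x) u l1)) k /\
    k <= (size l1).+1 * C n.
  elim: l1 u => [|y l1 IHl] u uq lq.
    exists 7; split; last by rewrite mul1n /C; lia.
    apply: (@EvIfLeaf _ _ _ _ _ _ 3 3); eval_tac.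
  have [||k1 [ev1 k1le]] := IHl (f x u y).
  - by move=> i il; have := uq i.+1; apply.
  - by have eyl : csize (y :: l1) = (csize y + csize l1).+1 by []; lia.
  have [k2 [ev2 k2le _]] := fP (x, (u, y)).
  have k2C : k2 + 50 <= C n.
    rewrite /C leq_add2r (leq_trans k2le) // poly_leq //.
    have := uq 0 isT; rewrite take0 [foldl _ _ _]/= => uqn.
    have -> : csize (x, (u, y)) = (n + (csize u + csize y).+1).+1 by [].
    have eyl : csize (y :: l1) = (csize y + csize l1).+1 by [].
    by rewrite eyl in lq; rewrite /W; lia.
  exists (k1 + k2 + 25); split; last by rewrite [size _]/= mulSn; lia.
  have eva : eval (link main p1 pf) [:: code (x, (u, y :: l1))]
     (ENode (EHd (EVar 0)) (ENode (EHd (ETl (EVar 0))) (EHd (ETl (ETl (EVar 0))))))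
     (code (x, (u, y))) 11 by eval_tac.
  have evb := eval_link2 pf0 eva ev2.
  have evl : eval (link main p1 pf) [:: code (x, (u, y :: l1))] (ETl (ETl (EVar 0))) (code (y :: l1)) 3.
    by eval_tac.
  have evg : eval (link main p1 pf) [:: code (x, (u, y :: l1))] (EHd (EVar 0)) (code x) 2.
    by eval_tac.
  have e := EvIfNode (EHd (ETl (EVar 0))) evl (EvCall (f := 1) (EvNode evg (EvNode evb (EvTl evl))) ev1).
  have -> : k1 + k2 + 25 = (3 + ((2 + ((11 + k2).+1 + 4).+1).+1 + k1).+1).+1 by lia.
  exact: e.
have sl : size (l x) <= csize (l x).
  by elim: (l x) => //= y l1; rewrite /csize /= ltnS => /leq_trans; apply; exact: leq_addl.
have sz : csize (x, (u0 x, l x)) = (n + (csize (u0 x) + csize (l x)).+1).+1 by [].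
have [k' [llr kq' sq']] := llP x.
have [|k2 [ev2 k2le]] := loopP (l x) (u0 x) _ sq'; first by move=> i; apply: foldP.
have ev0 := eval_link1 (main := main) (p2 := pf) p10 (EvVar _ [:: code x] 0) ir.
have e := EvCall (f := 1) ev0 ev2.
exists ((1 + k).+1 + k2).+1; split.
- exact: e.
- have le : (size (l x)).+1 * C n <= (ql n).+1 * C n.
    by rewrite leq_mul2r ltnS (leq_trans sl sq') orbT.
  by rewrite -/n in kq; lia.
by have := foldP x _ (leqnn _); rewrite take_size -/n; lia.
Qed.

Lemma csize_cons T `{coded T} (x : T) s : csize (x :: s) = (csize x + csize s).+1.
Proof. by []. Qed.

Lemma csize_pair S T `{coded S} `{coded T} (x : S) (y : T) :
  csize (x, y) = (csize x + csize y).+1.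
Proof. by []. Qed.

Lemma csize_gt0 T `{coded T} (x : T) : 0 < csize x.
Proof. exact: dsize_gt0. Qed.

Lemma csize_seqE T `{coded T} (s : seq T) : csize s = (\sum_(x <- s) (csize x).+1).+1.
Proof.
elim: s => [|x s IHs]; first by rewrite big_nil.
by rewrite csize_cons IHs big_cons addSn addnS.
Qed.

Lemma leq_csize_take T `{coded T} (s : seq T) i : csize (take i s) <= csize s.
Proof. by rewrite -{2}(cat_take_drop i s) !csize_seqE big_cat ltnS leq_addr. Qed.

Lemma leq_csize_filter T `{coded T} (P : pred T) (s : seq T) :
  csize [seq x <- s | P x] <= csize s.
Proof. by rewrite !csize_seqE ltnS big_filter [leqRHS](bigID P) leq_addr. Qed.

Lemma csize_rev T `{coded T} (s : seq T) : csize (rev s) = csize s.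
Proof. by rewrite !csize_seqE big_rev. Qed.

Lemma leq_size_csize T `{coded T} (s : seq T) : size s < csize s.
Proof.
by elim: s => // x s IHs; rewrite csize_cons ltnS (leq_trans IHs) ?leq_addl.
Qed.

Section Primitives.
Context {G S T U : Type} `{coded G} `{coded S} `{coded T} `{coded U}.

Lemma pt_const (c : T) : pt (fun _ : G => c).
Proof.
pose fix quote d := if d is Node a b then ENode (quote a) (quote b) else ELeaf.
pose fix cost d := if d is Node a b then (cost a + cost b).+1 else 1.
apply: (pt_expr (e := quote (code c)) (c := cost (code c) + csize c)) => p x.
exists (cost (code c)); split; last by rewrite /csize; lia.
  by elim: (code c) => [|a IHa b IHb] /=; constructor.
exact: leq_addr.
Qed.

Lemma pt_fst (f : G -> S * T) : pt f -> pt (fun x => (f x).1).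
Proof.
apply: pt_comp (pt_expr (e := EHd (EVar 0)) (c := 2) _) => p [x y].
by exists 2; split=> //; [eval_tac|rewrite csize_pair /=; lia].
Qed.

Lemma pt_snd (f : G -> S * T) : pt f -> pt (fun x => (f x).2).
Proof.
apply: pt_comp (pt_expr (e := ETl (EVar 0)) (c := 2) _) => p [x y].
by exists 2; split=> //; [eval_tac|rewrite csize_pair /=; lia].
Qed.

Lemma pt_cons (f : G -> T) (s : G -> seq T) : pt f -> pt s -> pt (fun x => f x :: s x).
Proof.
move=> fP sP; apply: (pt_comp (g := fun z : T * seq T => z.1 :: z.2)) (pt_pair fP sP).
apply: (pt_expr (e := EVar 0) (c := 1)) => p [x y].
by exists 1; split=> //; [eval_tac|rewrite csize_cons csize_pair /=; lia].
Qed.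

Lemma pt_behead (s : G -> seq T) : pt s -> pt (fun x => behead (s x)).
Proof.
apply: pt_comp (pt_expr (e := ETl (EVar 0)) (c := 2) _) => p [|x s'].
  by exists 2; split=> //; eval_tac.
by exists 2; split=> //; [eval_tac|rewrite csize_cons /=; lia].
Qed.

Lemma pt_nilp (s : G -> seq T) : pt s -> pt (fun x => nilp (s x)).
Proof.
apply: pt_comp (pt_expr (e := EIf (EVar 0) ELeaf (ENode ELeaf ELeaf)) (c := 5) _) => p [|x s'].
  by exists 5; split=> //; apply: (@EvIfLeaf _ _ _ _ _ _ 1 3); eval_tac.
exists 3; split=> //.
by apply: (@EvIfNode _ _ _ _ _ (code x) (code s') _ 1 1); eval_tac.
Qed.

Lemma pt_head (x0 : G -> T) (s : G -> seq T) :
  pt x0 -> pt s -> pt (fun x => head (x0 x) (s x)).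
Proof.
move=> xP sP; apply: (pt_comp (g := fun z : T * seq T => head z.1 z.2)) (pt_pair xP sP).
apply: (pt_expr (e := EIf (ETl (EVar 0)) (EHd (ETl (EVar 0))) (EHd (EVar 0))) (c := 6)).
move=> p [y [|x s']].
  exists 5; split=> //; last by rewrite csize_pair /=; lia.
  by apply: (@EvIfLeaf _ _ _ _ _ _ 2 2); eval_tac.
exists 6; split=> //; last by rewrite csize_pair csize_cons /=; lia.
by apply: (@EvIfNode _ _ _ _ _ (code x) (code s') _ 2 3); eval_tac.
Qed.

Lemma pt_if (b : G -> bool) (f g : G -> T) :
  pt b -> pt f -> pt g -> pt (fun x => if b x then f x else g x).
Proof.
move=> bP fP gP.
apply: (pt_comp (g := fun z : bool * (T * T) => if z.1 then z.2.1 else z.2.2))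
  (pt_pair bP (pt_pair fP gP)).
apply: (pt_expr (e := EIf (EHd (EVar 0)) (EHd (ETl (EVar 0))) (ETl (ETl (EVar 0)))) (c := 6)).
move=> p [[] [x y]]; exists 6; split=> //; try by rewrite !csize_pair /=; lia.
  by apply: (@EvIfNode _ _ _ _ _ Leaf Leaf _ 2 3); eval_tac.
by apply: (@EvIfLeaf _ _ _ _ _ _ 2 3); eval_tac.
Qed.

Lemma pt_some (f : G -> T) : pt f -> pt (fun x => Some (f x)).
Proof.
apply: pt_comp (pt_expr (e := ENode (EVar 0) ELeaf) (c := 3) _) => p x.
by exists 3; split=> //; [eval_tac|rewrite /csize /=; lia].
Qed.

Lemma pt_succ (f : G -> nat) : pt f -> pt (fun x => (f x).+1).
Proof.
apply: pt_comp (pt_expr (e := ENode ELeaf (EVar 0)) (c := 3) _) => p x.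
by exists 3; split=> //; [eval_tac|rewrite (_ : csize x.+1 = (csize x).+2) //; lia].
Qed.

(** Unary numbers are coded as lists of units, so iterating [n] times is folding over a list, and
    arithmetic reduces to operations on lists. *)
Lemma code_nat_nseq n : code n = code (nseq n tt).
Proof. by elim: n => //= n; rewrite /code /coded_nat /= => ->. Qed.

Lemma pt_nseq (f : G -> nat) : pt f -> pt (fun x => nseq (f x) tt).
Proof.
apply: pt_comp (pt_expr (e := EVar 0) (c := 1) _) => p x.
exists 1; rewrite /csize -code_nat_nseq; split=> //; last exact: leq_addr.
exact: EvVar.
Qed.

End Primitives.

Section Iteration.
Context {G S T U : Type} `{coded G} `{coded S} `{coded T} `{coded U}.

Lemma pt_rev (s : G -> seq T) : pt s -> pt (fun x => rev (s x)).
Proof.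
move=> sP.
have E x : foldl (fun u y => y :: u) [::] x = rev x :> seq T.
  by rewrite -{1}(revK x) foldl_rev; elim: (rev x) => //= y u ->.
apply: (pt_ext (fun x => E (s x))); apply: pt_foldl => //.
- by apply: pt_cons; [apply: pt_snd; apply: pt_snd|apply: pt_fst; apply: pt_snd]; exact: pt_id.
- exact: pt_const.
have [p [q [_ qP sq]]] := sP; exists q => // x i _; rewrite E csize_rev.
by apply: leq_trans (leq_csize_take _ _) _; have [k []] := sq x.
Qed.

End Iteration.

Section Recursion.
Context {G S T U : Type} `{coded G} `{coded S} `{coded T} `{coded U}.

(** The growth hypothesis is additive in the accumulator, so the increments add up to a polynomial
    over the list. *)
Lemma pt_foldr (f : G -> T -> U -> U) (u0 : G -> U) (s : G -> seq T) :
  pt (fun z : G * (T * U) => f z.1 z.2.1 z.2.2) -> pt u0 -> pt s ->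
  (exists2 q, poly q & forall x y u, csize (f x y u) <= csize u + q (csize x + csize y)) ->
  pt (fun x => foldr (f x) (u0 x) (s x)).
Proof.
move=> fP uP sP [q qP qf].
apply: (pt_ext (f := fun x => foldl (fun u y => f x y u) (u0 x) (rev (s x)))).
  by move=> x; rewrite foldl_rev.
apply: pt_foldl; [|exact: uP|exact: pt_rev|].
  apply: (pt_comp (g := fun z : G * (T * U) => f z.1 z.2.1 z.2.2)
    (f := fun z : G * (U * T) => (z.1, (z.2.2, z.2.1)))) => //.
  by apply: pt_pair; [apply: pt_fst|apply: pt_pair; [apply: pt_snd|apply: pt_fst]; apply: pt_snd];
    exact: pt_id.
have [pu [qu [_ quP uq]]] := uP; have [ps [qs [_ qsP sq]]] := sP.
exists (fun n => qu n + qs n * q (n + qs n)); first by poly_tac.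
move=> x i _; have [ku [_ _ ux]] := uq x; have [ks [_ _ sx]] := sq x.
have : csize (rev (s x)) <= qs (csize x) by rewrite csize_rev.
move: (rev (s x)) => l /(leq_trans (leq_csize_take _ i)); move: (take i l) => {}l lx.
apply: (@leq_trans (csize (u0 x) + size l * q (csize x + qs (csize x)))); last first.
  by rewrite leq_add // leq_mul2r (leq_trans (ltnW (leq_size_csize l)) lx) orbT.
elim: l (u0 x) lx => [|y l IHl] u; first by rewrite addn0.
rewrite csize_cons => lx; apply: leq_trans (IHl _ _) _; first by lia.
rewrite [size _]/= mulSn addnA leq_add2r (leq_trans (qf _ _ _)) // leq_add2l.
by apply: poly_leq => //; rewrite leq_add2l; lia.
Qed.

End Recursion.

Lemma pt_csize S T `{coded S} `{coded T} (f : S -> T) : pt f ->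
  exists2 q, poly q & forall x, csize (f x) <= q (csize x).
Proof. by move=> [p [q [_ qP fP]]]; exists q => // x; have [k []] := fP x. Qed.

Ltac pt_step :=
  cbv beta; lazymatch goal with
  | |- pt (fun x => x) => exact pt_id
  | |- pt fst => exact (pt_fst pt_id)
  | |- pt snd => exact (pt_snd pt_id)
  | |- pt (fun x => fst _) => apply pt_fst
  | |- pt (fun x => snd _) => apply pt_snd
  | |- pt (fun x => pair _ _) => apply pt_pair
  | |- pt (fun x => cons _ _) => apply pt_cons
  | |- pt (fun x => nil) => exact (pt_const _)
  | |- pt (fun x => S (@?f x)) => apply (pt_succ (f := f))
  | |- pt (fun x => O) => exact (pt_const _)
  | |- pt (fun x => if _ then _ else _) => apply pt_if
  | |- pt (fun x => behead _) => apply pt_behead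
  | |- pt (fun x => nilp _) => apply pt_nilp
  | |- pt (fun x => head _ _) => apply pt_head
  | |- pt (fun x => Some _) => apply pt_some
  | |- pt (fun x => rev _) => apply pt_rev
  | |- pt (fun x => nseq _ tt) => apply pt_nseq
  | |- pt (fun x => true) => exact (pt_const _)
  | |- pt (fun x => false) => exact (pt_const _)
  | H : pt (fun z => ?f (fst z) (snd z)) |- pt (fun x => ?f (@?a x) (@?b x)) =>
      apply (pt_comp (f := fun x => (a x, b x)) H)
  | H : pt (fun z => ?f (fst z) (fst (snd z)) (snd (snd z)))
      |- pt (fun x => ?f (@?a x) (@?b x) (@?c x)) =>
      apply (pt_comp (f := fun x => (a x, (b x, c x))) H)
  | H : pt ?s |- pt ?s => exact H
  | H : pt ?s |- pt (fun x => ?s (@?a x)) => apply (pt_comp (f := a) H)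
  | |- _ => assumption
  end.
Ltac pt_tac := repeat pt_step.

Section Sequences.
Context {G T U : Type} `{coded G} `{coded T} `{coded U}.

Lemma pt_map (f : G -> T -> U) (s : G -> seq T) :
  pt (fun z : G * T => f z.1 z.2) -> pt s -> pt (fun x => map (f x) (s x)).
Proof.
move=> fP sP; have [q qP fq] := pt_csize fP.
apply: (pt_ext (f := fun x => foldr (fun y u => f x y :: u) [::] (s x))).
  by move=> x; elim: (s x) => //= y u ->.
apply: pt_foldr; [by pt_tac..|exists (fun n => q n.+1 + 1)]; first by poly_tac.
move=> x y u; have := fq (x, y); rewrite csize_cons csize_pair /=; lia.
Qed.

Lemma pt_filter (P : G -> T -> bool) (s : G -> seq T) :
  pt (fun z : G * T => P z.1 z.2) -> pt s -> pt (fun x => filter (P x) (s x)).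
Proof.
move=> PP sP.
apply: (pt_ext (f := fun x => foldr (fun y u => if P x y then y :: u else u) [::] (s x))).
  by move=> x; elim: (s x) => //= y u ->.
apply: pt_foldr; [by pt_tac..|exists (fun n => n + 1)]; first by poly_tac.
by move=> x y u; case: (P x y); rewrite ?csize_cons; lia.
Qed.

Lemma pt_cat (s t : G -> seq T) : pt s -> pt t -> pt (fun x => s x ++ t x).
Proof.
move=> sP tP; apply: (pt_ext (f := fun x => foldr cons (t x) (s x))).
  by move=> x; elim: (s x) => //= y u ->.
apply: pt_foldr; [by pt_tac..|exists (fun n => n + 1)]; first by poly_tac.
by move=> x y u; rewrite csize_cons; lia.
Qed.

Lemma csize_cat (s t : seq T) : csize (s ++ t) <= csize s + csize t.
Proof. by rewrite !csize_seqE big_cat /= addSn addnS. Qed.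

Lemma pt_size (s : G -> seq T) : pt s -> pt (fun x => size (s x)).
Proof.
move=> sP; apply: (pt_ext (f := fun x => foldr (fun _ n => n.+1) 0 (s x))).
  by move=> x; elim: (s x) => //= y u ->.
apply: pt_foldr; [by pt_tac..|exists (fun n => 2)]; first by poly_tac.
by move=> x y u; rewrite (_ : csize u.+1 = (csize u).+2) //; lia.
Qed.

Lemma pt_negb (b : G -> bool) : pt b -> pt (fun x => ~~ b x).
Proof. by move=> bP; apply: pt_if; pt_tac. Qed.

Lemma pt_andb (b c : G -> bool) : pt b -> pt c -> pt (fun x => b x && c x).
Proof. by move=> bP cP; apply: pt_if; pt_tac. Qed.

Lemma pt_orb (b c : G -> bool) : pt b -> pt c -> pt (fun x => b x || c x).
Proof. by move=> bP cP; apply: pt_if; pt_tac. Qed.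

Lemma pt_implyb (b c : G -> bool) : pt b -> pt c -> pt (fun x => b x ==> c x).
Proof. by move=> bP cP; apply: pt_if; pt_tac. Qed.

End Sequences.

Section Sequences2.
Context {G S T U : Type} `{coded G} `{coded S} `{coded T} `{coded U}.

Lemma pt_flatten (s : G -> seq (seq T)) : pt s -> pt (fun x => flatten (s x)).
Proof.
move=> sP; apply: pt_foldr; [|by pt_tac..|exists (fun n => n)]; last 2 [by poly_tac].
  by apply: pt_cat; pt_tac.
move=> x y u; apply: leq_trans (csize_cat y u) _; rewrite addnC leq_add2l; exact: leq_addl.
Qed.

Lemma pt_has (P : G -> T -> bool) (s : G -> seq T) :
  pt (fun z : G * T => P z.1 z.2) -> pt s -> pt (fun x => has (P x) (s x)).
Proof.
move=> PP sP; apply: (pt_ext (f := fun x => ~~ nilp (filter (P x) (s x)))).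
  by move=> x; rewrite has_count -size_filter /nilp lt0n.
by apply: pt_negb; apply: pt_nilp; apply: pt_filter.
Qed.

Lemma pt_all (P : G -> T -> bool) (s : G -> seq T) :
  pt (fun z : G * T => P z.1 z.2) -> pt s -> pt (fun x => all (P x) (s x)).
Proof.
move=> PP sP; apply: (pt_ext (f := fun x => ~~ has (fun y => ~~ P x y) (s x))).
  by move=> x; rewrite has_predC negbK.
by apply: pt_negb; apply: pt_has => //; apply: pt_negb.
Qed.

Lemma pt_count (P : G -> T -> bool) (s : G -> seq T) :
  pt (fun z : G * T => P z.1 z.2) -> pt s -> pt (fun x => count (P x) (s x)).
Proof.
move=> PP sP; apply: (pt_ext (f := fun x => size (filter (P x) (s x)))).
  by move=> x; rewrite size_filter.
by apply: pt_size; apply: pt_filter.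
Qed.

Lemma pt_iter (f : G -> U -> U) (u0 : G -> U) (n : G -> nat) :
  pt (fun z : G * U => f z.1 z.2) -> pt u0 -> pt n ->
  (exists2 q, poly q & forall x i, i <= n x -> csize (iter i (f x) (u0 x)) <= q (csize x)) ->
  pt (fun x => iter (n x) (f x) (u0 x)).
Proof.
move=> fP uP nP [q qP fq].
have E x m : foldl (fun u (_ : unit) => f x u) (u0 x) (nseq m tt) = iter m (f x) (u0 x).
  by elim: m (u0 x) => // m IHm u; rewrite iterSr -IHm.
apply: (pt_ext (fun x => E x (n x))); apply: pt_foldl; [|by pt_tac..|exists q => //].
  by apply: (pt_comp (f := fun z : G * (U * unit) => (z.1, z.2.1)) fP); pt_tac.
by move=> x i; rewrite size_nseq => ix; rewrite take_nseq // E; apply: fq.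
Qed.

End Sequences2.

Lemma pt_pred G `{coded G} (f : G -> nat) : pt f -> pt (fun x => (f x).-1).
Proof.
move=> fP; apply: (pt_ext (f := fun x => size (behead (nseq (f x) tt)))).
  by move=> x; rewrite size_behead size_nseq.
by apply: pt_size; pt_tac.
Qed.

(** * Arithmetic on unary numbers and access to lists *)

Section Naturals.
Context {G T : Type} `{coded G} `{coded T}.

Lemma pt_add (f g : G -> nat) : pt f -> pt g -> pt (fun x => f x + g x).
Proof.
move=> fP gP; apply: (pt_ext (f := fun x => size (nseq (f x) tt ++ nseq (g x) tt))).
  by move=> x; rewrite size_cat !size_nseq.
by apply: pt_size; apply: pt_cat; pt_tac.
Qed.

Lemma csize_nat (n : nat) : csize n = n.*2.+1.
Proof. by elim: n => // n IHn; rewrite (_ : csize n.+1 = (csize n).+2) // IHn. Qed.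

Lemma pt_sub (f g : G -> nat) : pt f -> pt g -> pt (fun x => f x - g x).
Proof.
move=> fP gP; apply: (pt_ext (f := fun x => iter (g x) predn (f x))).
  by move=> x; elim: (g x) => [|n IHn]; rewrite ?subn0 // subnS /= IHn.
have [q qP fq] := pt_csize fP.
apply: pt_iter => //; first by apply: pt_pred; pt_tac.
exists q => // x i _; apply: leq_trans (fq x).
by rewrite !csize_nat ltnS leq_double; elim: i => //= i /(leq_trans (leq_pred _)).
Qed.

Lemma pt_leq (f g : G -> nat) : pt f -> pt g -> pt (fun x => f x <= g x).
Proof.
move=> fP gP; apply: (pt_ext (f := fun x => nilp (nseq (f x - g x) tt))).
  by move=> x; rewrite /nilp size_nseq.
by apply: pt_nilp; apply: pt_nseq; apply: pt_sub.
Qed.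

Lemma pt_eqn (f g : G -> nat) : pt f -> pt g -> pt (fun x => f x == g x).
Proof.
move=> fP gP; apply: (pt_ext (f := fun x => (f x <= g x) && (g x <= f x))).
  by move=> x; rewrite eqn_leq.
by apply: pt_andb; apply: pt_leq.
Qed.

Lemma pt_mul (f g : G -> nat) : pt f -> pt g -> pt (fun x => f x * g x).
Proof.
move=> fP gP.
apply: (pt_ext (f := fun x => size (flatten (map (fun _ => nseq (g x) tt) (nseq (f x) tt))))).
  by move=> x; elim: (f x) => //= n IHn; rewrite size_cat size_nseq IHn mulSn.
by apply: pt_size; apply: pt_flatten; apply: pt_map; pt_tac.
Qed.

Lemma pt_iota (f : G -> nat) : pt f -> pt (fun x => iota 0 (f x)).
Proof.
move=> fP; have E n : iter n (fun s => size s :: s) [::] = rev (iota 0 n).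
  elim: n => // n IHn; rewrite iterS IHn -addn1 iotaD rev_cat /= size_rev size_iota.
  by rewrite add0n.
apply: (pt_ext (f := fun x => rev (iter (f x) (fun s => size s :: s) [::]))).
  by move=> x; rewrite E revK.
have [q qP fq] := pt_csize fP.
apply: pt_rev; apply: pt_iter => //; pt_tac; first by apply: pt_size; pt_tac.
exists (fun n => (q n * (q n + q n + 2)).+1); first by poly_tac.
move=> x i ix; rewrite E csize_rev csize_seqE ltnS.
apply: (@leq_trans (\sum_(k <- iota 0 i) (i + i + 2))).
  rewrite !big_seq; apply: leq_sum => k; rewrite mem_iota csize_nat; lia.
rewrite big_const_seq count_predT iter_addn_0 size_iota mulnC.
have : i <= q (csize x).
  by apply: leq_trans (fq x); rewrite csize_nat; lia.
by move=> iq; rewrite leq_mul //; lia.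
Qed.

Lemma pt_drop (n : G -> nat) (s : G -> seq T) :
  pt n -> pt s -> pt (fun x => drop (n x) (s x)).
Proof.
move=> nP sP.
have E (u : seq T) m : iter m behead u = drop m u.
  by elim: m u => [|m IHm] u; rewrite ?drop0 // iterSr IHm; case: u.
apply: (pt_ext (fun x => E (s x) (n x))); have [q qP sq] := pt_csize sP.
apply: pt_iter => //; pt_tac; exists q => // x i _; apply: leq_trans (sq x).
by rewrite E -{2}(cat_take_drop i (s x)) !csize_seqE big_cat ltnS leq_addl.
Qed.

Lemma pt_nth (x0 : G -> T) (s : G -> seq T) (n : G -> nat) :
  pt x0 -> pt s -> pt n -> pt (fun x => nth (x0 x) (s x) (n x)).
Proof.
move=> xP sP nP; apply: (pt_ext (f := fun x => head (x0 x) (drop (n x) (s x)))).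
  by move=> x; rewrite -nth0 nth_drop addn0.
by apply: pt_head => //; apply: pt_drop.
Qed.

End Naturals.

(** * The division algorithm runs in polynomial time *)

Ltac pt_lib_step :=
  cbv beta; lazymatch goal with
  | |- pt (fun x => map _ _) => apply pt_map
  | |- pt (fun x => filter _ _) => apply pt_filter
  | |- pt (fun x => flatten _) => apply pt_flatten
  | |- pt (fun x => cat _ _) => apply pt_cat
  | |- pt (fun x => size _) => apply pt_size
  | |- pt (fun x => has _ _) => apply pt_has
  | |- pt (fun x => all _ _) => apply pt_all
  | |- pt (fun x => count _ _) => apply pt_count
  | |- pt (fun x => negb _) => apply pt_negb
  | |- pt (fun x => andb _ _) => apply pt_andb
  | |- pt (fun x => orb _ _) => apply pt_orb
  | |- pt (fun x => implb _ _) => apply pt_implyb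
  | |- pt (fun x => leq _ _) => apply pt_leq
  | |- pt (fun x => addn _ _) => apply pt_add
  | |- pt (fun x => subn _ _) => apply pt_sub
  | |- pt (fun x => predn _) => apply pt_pred
  | |- pt (fun x => muln _ _) => apply pt_mul
  | |- pt (fun x => iota O _) => apply pt_iota
  | |- pt (fun x => nth _ _ _) => apply pt_nth
  | |- pt (fun x => @eq_op Datatypes_nat__canonical__eqtype_Equality _ _) => apply pt_eqn
  | |- _ => pt_step
  end.
Ltac pt_lib := repeat pt_lib_step.

Section TableFunctions.
Context {G : Type} `{coded G}.

Lemma pt_mem_nat (f : G -> nat) (s : G -> seq nat) : pt f -> pt s -> pt (fun x => f x \in s x).
Proof.
move=> fP sP; apply: (pt_ext (f := fun x => has (fun y => y == f x) (s x))).
  by move=> x; rewrite has_pred1.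
by pt_lib.
Qed.

Lemma pt_index (f : G -> nat) (s : G -> seq nat) : pt f -> pt s -> pt (fun x => index (f x) (s x)).
Proof.
move=> fP sP; apply: (pt_ext (f := fun x => foldr (fun y n => if y == f x then 0 else n.+1) 0 (s x))).
  by move=> x; elim: (s x) => //= y u ->.
apply: pt_foldr; [|by pt_lib..|exists (fun n => 2); first by poly_tac].
  by pt_lib.
by move=> x y n; case: ifP; rewrite !csize_nat; lia.
Qed.

Lemma pt_in_rel (L : G -> seq ((nat * nat) * (nat * nat))) (u v : G -> nat * nat) :
  pt L -> pt u -> pt v -> pt (fun x => in_rel (L x) (u x) (v x)).
Proof.
move=> LP uP vP.
apply: (pt_ext (f := fun x => has (fun e => (e.1.1 == (u x).1) && (e.1.2 == (u x).2) &&
    ((e.2.1 == (v x).1) && (e.2.2 == (v x).2))) (L x))).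
  move=> x; rewrite /in_rel -has_pred1; apply: eq_has => -[[a b] [c d]] /=.
  by rewrite !xpair_eqE; case: (u x) (v x) => [? ?] [? ?].
by pt_lib.
Qed.

Lemma pt_edges_pred (E : G -> seq ((nat * nat) * (nat * nat))) (v : G -> nat * nat) :
  pt E -> pt v -> pt (fun x => edges_pred (E x) (v x)).
Proof.
move=> EP vP.
apply: (pt_ext (f := fun x => map fst [seq e <- E x |
  (e.2.1 == (v x).1) && (e.2.2 == (v x).2)])).
  by move=> x; rewrite /edges_pred; congr map; apply: eq_filter => -[[a b] [c d]].
by pt_lib.
Qed.

Lemma pt_tie (T : Type) `{coded T} (l : G -> rel T) (u v : G -> T) :
  pt (fun z : G * (T * T) => l z.1 z.2.1 z.2.2) -> pt u -> pt v ->
  pt (fun x => tie (l x) (u x) (v x)).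
Proof.
by move=> lP uP vP; rewrite /tie; pt_lib.
Qed.

End TableFunctions.

Section MultisetOrder.
Context {G T : Type} `{coded G} `{coded T}.

Lemma pt_mlt (l : G -> rel T) (X Y : G -> seq T) :
  pt (fun z : G * (T * T) => l z.1 z.2.1 z.2.2) -> pt X -> pt Y ->
  pt (fun x => mlt (l x) (X x) (Y x)).
Proof.
move=> lP XP YP; rewrite /mlt /tie.
by pt_lib.
Qed.

End MultisetOrder.

Ltac pt_alg_step :=
  cbv beta; lazymatch goal with
  | |- pt (fun x => @tie ?T _ _ _) => apply (@pt_tie _ _ T _)
  | |- pt (fun x => @mlt ?T _ _ _) => apply (@pt_mlt _ T _ _)
  | |- pt (fun x => in_rel _ _ _) => apply pt_in_rel
  | |- pt (fun x => edges_pred _ _) => apply pt_edges_pred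
  | |- pt (fun x => index _ _) => apply pt_index
  | |- pt (fun x => in_mem _ (mem (_ : seq nat))) => apply pt_mem_nat
  | |- _ => pt_lib_step
  end.
Ltac pt_alg := repeat pt_alg_step.

Section Algorithm.
Context {G : Type} `{coded G}.

(** Every intermediate relation is a sublist of the list of all pairs, hence of polynomial size. *)
Lemma pt_refine (E : G -> seq ((nat * nat) * (nat * nat))) :
  pt E -> pt (fun x => refine (E x)).
Proof.
move=> EP; rewrite /refine.
have allP : pt (fun x => [seq (u, v) | u <- map fst (E x), v <- map fst (E x)]).
  by pt_alg.
have [q qP sq] := pt_csize allP.
apply: pt_iter; [rewrite /refine_step|by pt_alg..|].
  by pt_alg.
exists (fun n => q n + 1); first by poly_tac.
move=> x [|i] _ /=; first exact: leq_addl.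
by apply: leq_trans (leq_csize_filter _ _) _; apply: leq_trans (sq x) (leq_addr _ _).
Qed.

Lemma leq_csize_nth (s : seq nat) j : csize (nth 0 s j) <= csize s.
Proof.
elim: s j => [|y s IHs] [|j]; rewrite ?csize_cons //=; first by lia.
by have := IHs j; lia.
Qed.

(** After one step the value is an entry of the table, or 0, so the iterates do not grow. *)
Lemma pt_iter_table (t : G -> seq nat) (n v : G -> nat) :
  pt t -> pt n -> pt v -> pt (fun x => iter (n x) (nth 0 (t x)) (v x)).
Proof.
move=> tP nP vP; apply: pt_iter; [by pt_alg..|].
have [q qP tq] := pt_csize tP; have [r rP vr] := pt_csize vP.
exists (fun n => q n + r n); first by poly_tac.
move=> x i _; elim: i => [|i _] /=; first exact: leq_trans (vr x) (leq_addl _ _).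
apply: leq_trans (leq_addr _ _); apply: leq_trans (tq x).
exact: leq_csize_nth.
Qed.

Definition table_pred (t : seq nat) (v : nat) : seq nat :=
  [seq u <- iota 0 (size t) | nth 0 t u == v].

Definition table_per (t : seq nat) : seq nat :=
  [seq v <- iota 0 (size t) | has (fun u => iter (size (iota 0 (size t))) (nth 0 t) u == v)
    (iota 0 (size t))].

Lemma pt_table_pred (t : G -> seq nat) (v : G -> nat) :
  pt t -> pt v -> pt (fun x => table_pred (t x) (v x)).
Proof. by move=> tP vP; rewrite /table_pred; pt_alg. Qed.

End Algorithm.

Lemma pt_table_per (G : Type) `{coded G} (t : G -> seq nat) :
  pt t -> pt (fun x => table_per (t x)).
Proof.
move=> tP; rewrite /table_per; pt_alg.
by apply: pt_iter_table; pt_alg.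
Qed.

Ltac pt_table_step :=
  cbv beta;
  try change (Equality.sort Datatypes_nat__canonical__eqtype_Equality) with nat;
  lazymatch goal with
  | |- pt (fun x => refine _) => apply pt_refine
  | |- pt (fun x => iter _ (nth O _) _) => apply pt_iter_table
  | |- pt (fun x => table_pred _ _) => apply pt_table_pred
  | |- pt (fun x => table_per _) => apply pt_table_per
  | |- _ => pt_alg_step
  end.
Ltac pt_table := repeat pt_table_step.

Lemma pt_deepest G `{coded G} (lt : G -> rel (nat * nat)) (deeper : G -> rel nat)
    (d p : G -> nat) (R : G -> seq nat) :
  pt (fun z : G * ((nat * nat) * (nat * nat)) => lt z.1 z.2.1 z.2.2) ->
  pt (fun z : G * (nat * nat) => deeper z.1 z.2.1 z.2.2) -> pt d -> pt p -> pt R ->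
  pt (fun x => deepest (lt x) (deeper x) (d x) (p x) (R x)).
Proof. by move=> *; rewrite /deepest; pt_table. Qed.

Lemma pt_quotients G `{coded G} (lt : G -> rel (nat * nat)) (deeper : G -> rel nat)
    (d : G -> nat) (DA : G -> seq nat) (p : G -> nat) (R : G -> seq nat) :
  pt (fun z : G * ((nat * nat) * (nat * nat)) => lt z.1 z.2.1 z.2.2) ->
  pt (fun z : G * (nat * nat) => deeper z.1 z.2.1 z.2.2) ->
  pt d -> pt DA -> pt p -> pt R ->
  pt (fun x => quotients (lt x) (deeper x) (d x) (DA x) (p x) (R x)).
Proof. by move=> *; rewrite /quotients; pt_table; apply pt_deepest; pt_table. Qed.

Lemma pt_quotient G `{coded G} (lt : G -> rel (nat * nat)) (deeper : G -> rel nat)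
    (d : G -> nat) (DA : G -> seq nat) (p : G -> nat) (R : G -> seq nat) :
  pt (fun z : G * ((nat * nat) * (nat * nat)) => lt z.1 z.2.1 z.2.2) ->
  pt (fun z : G * (nat * nat) => deeper z.1 z.2.1 z.2.2) ->
  pt d -> pt DA -> pt p -> pt R ->
  pt (fun x => quotient (lt x) (deeper x) (d x) (DA x) (p x) (R x)).
Proof. by move=> *; rewrite /quotient; pt_table; apply pt_quotients; pt_table. Qed.

Lemma leq_csize_remove_mul (lt : rel (nat * nat)) d p r l R :
  csize (foldl (remove_mul lt d p r) R l) <= csize R.
Proof.
by elim: l R => //= a l IHl R; apply: leq_trans (IHl _) _; exact: leq_csize_filter.
Qed.

Lemma pt_removals G `{coded G} (lt : G -> rel (nat * nat)) (d p r : G -> nat) (R l : G -> seq nat) :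
  pt (fun z : G * ((nat * nat) * (nat * nat)) => lt z.1 z.2.1 z.2.2) ->
  pt d -> pt p -> pt r -> pt R -> pt l ->
  pt (fun x => foldl (remove_mul (lt x) (d x) (p x) (r x)) (R x) (l x)).
Proof.
move=> ltP dP pP rP RP lP; apply: pt_foldl; [|by pt_table..|].
  by rewrite /remove_mul; pt_table.
have [q qP sq] := pt_csize RP; exists q => // x i _.
exact: leq_trans (leq_csize_remove_mul _ _ _ _ _ _) (sq x).
Qed.

(** The remainder only shrinks and the quotient remains a sublist of [DB], which bounds all the
    accumulators. *)
Lemma pt_division G `{coded G} (lt : G -> rel (nat * nat)) (deeper : G -> rel nat)
    (d : G -> nat) (DA : G -> seq nat) (p : G -> nat) (DB : G -> seq nat) :
  pt (fun z : G * ((nat * nat) * (nat * nat)) => lt z.1 z.2.1 z.2.2) ->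
  pt (fun z : G * (nat * nat) => deeper z.1 z.2.1 z.2.2) ->
  pt d -> pt DA -> pt p -> pt DB ->
  pt (fun x => division (lt x) (deeper x) (d x) (DA x) (p x) (DB x)).
Proof.
move=> ltP deeperP dP DAP pP DBP; have [q qP sq] := pt_csize DBP.
rewrite /division; apply: pt_snd; apply: pt_iter; [|by pt_table..|].
  rewrite /division_iter; apply: pt_pair; last by pt_table; apply pt_quotient; pt_table.
  by apply pt_removals; pt_table; apply pt_quotient; pt_table.
exists (fun n => (q n + q n).+1); first by poly_tac.
move=> x i _.
have [] : csize (iter i (division_iter (lt x) (deeper x) (d x) (DA x) (p x) (DB x)) (DB x, [::])).1
      <= q (csize x) /\
    csize (iter i (division_iter (lt x) (deeper x) (d x) (DA x) (p x) (DB x)) (DB x, [::])).2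
      <= q (csize x).
  elim: i => [|i [IH1 IH2]] /=; split; first exact: sq.
  - exact: leq_trans (csize_gt0 (DB x)) (sq x).
  - apply: leq_trans (leq_csize_remove_mul _ _ _ _ _ _) _.
    exact: leq_trans (leq_csize_filter _ _) IH1.
  exact: leq_trans (leq_csize_filter _ _) (sq x).
by case: (iter _ _ _) => [z1 z2] /= le1 le2; rewrite csize_pair ltnS leq_add.
Qed.

Ltac pt_div_step :=
  cbv beta;
  lazymatch goal with
  | |- pt (fun x => division _ _ _ _ _ _) => apply pt_division
  | |- _ => pt_table_step
  end.
Ltac pt_div := repeat pt_div_step.

(* The functions defining [quotient_graph], on [nat] instead of the vertex types
   of graphs, which depend on the tables. *)
Section QuotientTable.
Variables tA tB : seq nat.

Definition table_lt := in_rel (refine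
  [seq (p, (nth 0 tA p.1, nth 0 tB p.2))
     | p <- [seq (u, v) | u <- iota 0 (size tA), v <- iota 0 (size tB)]]).

Definition table_reaches (j b : nat) : bool :=
  has (fun x => iter j (nth 0 tB) x == b) (iota 0 (size tB)).

Definition table_deeper (b b' : nat) : bool :=
  all (fun j => table_reaches j b' ==> table_reaches j b) (iota 0 (size (iota 0 (size tB))).+1).

Definition table_base : nat := head 0 (table_per tA).

Definition table_back (m : nat) : nat :=
  head 0 [seq a <- table_per tA | iter m (nth 0 tA) a == table_base].

Definition table_qper : seq nat :=
  division table_lt table_deeper (size tB) (table_per tA) table_base (table_per tB).

Definition table_kept (m t : nat) : seq nat :=
  division table_lt table_deeper (size tB) (table_pred tA (table_back m)) (table_back m.+1)
    (table_pred tB t).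

Definition table_layer (j t : nat) : bool :=
  (iter j (nth 0 tB) t \in table_qper) &&
  all (fun i => (iter i (nth 0 tB) t \notin table_per tB) &&
                (iter i (nth 0 tB) t \in table_kept (j.-1 - i) (iter i.+1 (nth 0 tB) t)))
    (iota 0 j).

Definition table_qvs : seq nat :=
  [seq t <- iota 0 (size tB) | has (fun j => table_layer j t) (iota 0 (size (iota 0 (size tB))).+1)].

Definition table_qnext (t : nat) : nat :=
  if t \in table_qper then
    nth t [seq u <- table_qper | tie table_lt (nth 0 tA table_base, u) (table_base, nth 0 tB t)]
      (index t [seq u <- table_qper | tie table_lt (table_base, t) (table_base, u)])
  else nth 0 tB t.

(** Holds by conversion, the projections of [gtab] reducing to [nat], [iota] and [nth]; so the
    algorithm that is timed is the one proved correct. *)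
Lemma quotient_tableE :
  quotient_table tA tB = [seq index (table_qnext t) table_qvs | t <- table_qvs].
Proof. reflexivity. Qed.

End QuotientTable.

Section QuotientTablePt.
Context {G : Type} `{coded G}.
Variables (tA tB : G -> seq nat).
Hypotheses (AP : pt tA) (BP : pt tB).

Lemma pt_table_lt (u v : G -> nat * nat) :
  pt u -> pt v -> pt (fun x => table_lt (tA x) (tB x) (u x) (v x)).
Proof. by move=> uP vP; rewrite /table_lt; pt_div. Qed.

Lemma pt_table_deeper (u v : G -> nat) :
  pt u -> pt v -> pt (fun x => table_deeper (tB x) (u x) (v x)).
Proof. by move=> uP vP; rewrite /table_deeper /table_reaches; pt_div. Qed.

Lemma pt_table_base : pt (fun x => table_base (tA x)).
Proof. by rewrite /table_base; pt_div. Qed.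

End QuotientTablePt.

Ltac pt_tab_step :=
  cbv beta;
  lazymatch goal with
  | |- pt (fun x => table_lt _ _ _ _) => apply pt_table_lt
  | |- pt (fun x => table_deeper _ _ _) => apply pt_table_deeper
  | |- pt (fun x => table_base _) => apply pt_table_base
  | |- _ => pt_div_step
  end.
Ltac pt_tab := repeat pt_tab_step.

Lemma pt_table_back G `{coded G} (tA : G -> seq nat) (m : G -> nat) :
  pt tA -> pt m -> pt (fun x => table_back (tA x) (m x)).
Proof. by move=> AP mP; rewrite /table_back; pt_tab. Qed.

Lemma pt_table_qper G `{coded G} (tA tB : G -> seq nat) :
  pt tA -> pt tB -> pt (fun x => table_qper (tA x) (tB x)).
Proof. by move=> AP BP; rewrite /table_qper; pt_tab. Qed.

Lemma pt_table_kept G `{coded G} (tA tB : G -> seq nat) (m t : G -> nat) :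
  pt tA -> pt tB -> pt m -> pt t -> pt (fun x => table_kept (tA x) (tB x) (m x) (t x)).
Proof. by move=> AP BP mP tP; rewrite /table_kept; pt_tab; apply: pt_table_back; pt_tab. Qed.

Lemma pt_table_layer G `{coded G} (tA tB : G -> seq nat) (j t : G -> nat) :
  pt tA -> pt tB -> pt j -> pt t -> pt (fun x => table_layer (tA x) (tB x) (j x) (t x)).
Proof.
move=> AP BP jP tP; rewrite /table_layer; pt_tab; first by apply: pt_table_qper; pt_tab.
by apply: pt_table_kept; pt_tab.
Qed.

Lemma pt_table_qvs G `{coded G} (tA tB : G -> seq nat) :
  pt tA -> pt tB -> pt (fun x => table_qvs (tA x) (tB x)).
Proof. by move=> AP BP; rewrite /table_qvs; pt_tab; apply: pt_table_layer; pt_tab. Qed.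

Lemma pt_table_qnext G `{coded G} (tA tB : G -> seq nat) (t : G -> nat) :
  pt tA -> pt tB -> pt t -> pt (fun x => table_qnext (tA x) (tB x) (t x)).
Proof.
by move=> AP BP tP; rewrite /table_qnext; pt_tab; apply: pt_table_qper; pt_tab.
Qed.

Lemma pt_quotient_table G `{coded G} (tA tB : G -> seq nat) :
  pt tA -> pt tB -> pt (fun x => quotient_table (tA x) (tB x)).
Proof.
move=> AP BP; apply: (pt_ext (fun x => esym (quotient_tableE (tA x) (tB x)))).
by pt_tab; [apply: pt_table_qnext|apply: pt_table_qvs|apply: pt_table_qvs]; pt_tab.
Qed.

Definition table_check (tA tX tB : seq nat) : bool :=
  let vs := [seq (a, x) | a <- iota 0 (size tA), x <- iota 0 (size tX)] ++
            [seq (size tA, b) | b <- iota 0 (size tB)] in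
  let E := [seq (p, if p.1 < size tA then (nth 0 tA p.1, nth 0 tX p.2) else (p.1, nth 0 tB p.2))
             | p <- vs] in
  let X := [seq (a, x) | a <- table_per tA, x <- table_per tX] in
  let Y := [seq (size tA, b) | b <- table_per tB] in
  all (fun t => count (tie (in_rel (refine E)) t) X == count (tie (in_rel (refine E)) t) Y)
    (X ++ Y).

Lemma pt_check G `{coded G} (tA tX tB : G -> seq nat) :
  pt tA -> pt tX -> pt tB -> pt (fun x => check (tA x) (tX x) (tB x)).
Proof.
move=> AP XP BP; apply: (pt_ext (f := fun x => table_check (tA x) (tX x) (tB x))) => //.
by rewrite /table_check; pt_tab.
Qed.

Theorem pt_answer : pt (fun z : seq nat * seq nat => answer z.1 z.2).
Proof.
have quotP : pt (fun z : seq nat * seq nat =>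
    if nilp z.1 then [::] else quotient_table z.1 z.2).
  by pt_tab; apply: pt_quotient_table; pt_tab.
rewrite /answer /valid_table; apply: pt_if; [apply: pt_andb|apply: pt_some|exact: pt_const].
- by apply: pt_all; pt_tab; apply: pt_quotient_table; pt_tab.
- by apply: pt_check; pt_tab; apply: pt_quotient_table; pt_tab.
exact: quotP.
Qed.

(** * Unroll trees and graphs *)

Section Matching.
Variables (O : Type) (l : rel O).
Hypothesis l_swo : swo l.

(* The [i]-th element of a class of [X] is matched with the [i]-th element of
   the same class in [Y]. *)
Definition matching (S T : eqType) (y0 : S -> T) (g : S -> O) (h : T -> O)
    (X : seq S) (Y : seq T) (x : S) : T :=
  nth (y0 x) [seq y <- Y | tie l (g x) (h y)]
    (index x [seq x' <- X | tie l (g x) (g x')]).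

Lemma matching_spec (S T : eqType) (y0 : S -> T) (g : S -> O) (h : T -> O) X Y x :
  meq l (map g X) (map h Y) -> x \in X ->
  matching y0 g h X Y x \in Y /\ tie l (g x) (h (matching y0 g h X Y x)).
Proof.
move=> XY xX; suff : matching y0 g h X Y x \in [seq y <- Y | tie l (g x) (h y)].
  by rewrite mem_filter => /andP[].
rewrite mem_nth // size_filter; have := XY (g x); rewrite !count_map => <-.
by rewrite -size_filter index_mem mem_filter xX tie_refl.
Qed.

(** Both matchings relate equal positions in corresponding classes, so they are inverse to each
    other. *)
Lemma matchingK (S T : eqType) (y0 : S -> T) (x0 : T -> S) (g : S -> O) (h : T -> O) X Y :
  uniq Y -> meq l (map g X) (map h Y) ->
  {in X, cancel (matching y0 g h X Y) (matching x0 h g Y X)}.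
Proof.
move=> uY XY x xX; have [yY xy] := matching_spec y0 XY xX.
set y := matching y0 g h X Y x in yY xy *; rewrite /matching.
have -> : [seq x' <- X | tie l (h y) (g x')] = [seq x' <- X | tie l (g x) (g x')].
  by apply: eq_filter => x'; rewrite (tie_eql l_swo xy).
have -> : [seq y' <- Y | tie l (h y) (h y')] = [seq y' <- Y | tie l (g x) (h y')].
  by apply: eq_filter => y'; rewrite (tie_eql l_swo xy).
have xin : x \in [seq x' <- X | tie l (g x) (g x')].
  by rewrite mem_filter xX tie_refl.
rewrite /y /matching index_uniq ?filter_uniq ?nth_index //.
rewrite size_filter; have := XY (g x); rewrite !count_map => <-.
by rewrite -size_filter index_mem.
Qed.

End Matching.

(** A bridge from [rtree] to the abstract trees: [cs] lists the children of a vertex, and [lab]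
    sends a vertex to the abstract tree of its subtree, up to ties at every depth. *)
Definition labelled O (ch : O -> seq O) (t : rtree) (cs : vertex t -> seq (vertex t))
    (lab : vertex t -> O) : Prop :=
  [/\ forall v, uniq (cs v), forall u v, (u \in cs v) = tree_arc u v
    & forall v k, meq (tlt ch k) (ch (lab v)) (map lab (cs v))].

Section TreeIso.
Variables (O : Type) (ch : O -> seq O).

Lemma tree_iso_eqv (t1 t2 : rtree) cs1 cs2 lab1 lab2 :
  @labelled O ch t1 cs1 lab1 -> @labelled O ch t2 cs2 lab2 -> tree_iso t1 t2 ->
  forall k, eqv ch k (lab1 (tree_root t1)) (lab2 (tree_root t2)).
Proof.
move=> [u1 m1 l1] [u2 m2 l2] [phi [[psi phiK psiK] <- arc]] k.
elim: k (tree_root t1) => // k IHk v; apply/eqvS.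
apply: meq_trans (l1 v k) _; apply: meq_trans (meq_sym (l2 (phi v) k)).
have cs_phi : perm_eq (map phi (cs1 v)) (cs2 (phi v)).
  apply: uniq_perm => //; first by rewrite (map_inj_uniq (can_inj phiK)).
  move=> w; rewrite m2 -{1}(psiK w) (mem_map (can_inj phiK)) m1.
  by rewrite -arc psiK.
apply: meq_trans (meq_perm (tlt ch k) lab2 cs_phi) => t.
by rewrite -map_comp !count_map; apply: eq_count => w /=; apply: eqv_eqr.
Qed.

Definition parent (t : rtree) (v : vertex t) : vertex t :=
  head v (xchoose (root_reachable v)).

Lemma parentP (t : rtree) (v : vertex t) n :
  depth v = n.+1 -> tree_arc v (parent v) /\ depth (parent v) = n.
Proof.
move=> dv; suff vp : tree_arc v (parent v).
  by split=> //; move: dv; rewrite (depth_arc vp) => -[].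
move: dv; rewrite /depth /parent; have /andP[] := xchooseP (root_reachable v).
by case: (xchoose _) => //= w p /andP[].
Qed.

Lemma parent_arc (t : rtree) (v w : vertex t) : tree_arc v w -> parent v = w.
Proof.
move=> vw; have [vp _] := parentP (depth_arc vw); exact: arc_functional vp vw.
Qed.

Variable k : nat.

Section TreeMap.
Variables (t1 t2 : rtree) (cs1 : vertex t1 -> seq (vertex t1)) (cs2 : vertex t2 -> seq (vertex t2)).
Variables (lab1 : vertex t1 -> O) (lab2 : vertex t2 -> O).

(** The isomorphism is built downwards from the root: a vertex is matched with a child of the image
    of its parent. The recursion is on the depth of the vertex. *)
Fixpoint tree_map n (v : vertex t1) : vertex t2 :=
  if n is n'.+1 then
    matching (tlt ch k) (fun _ => tree_root t2) lab1 lab2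
      (cs1 (parent v)) (cs2 (tree_map n' (parent v))) v
  else tree_root t2.

Hypotheses (L1 : labelled ch cs1 lab1) (L2 : labelled ch cs2 lab2).
Hypothesis stable : forall v w, eqv ch k (lab1 v) (lab2 w) -> eqv ch k.+1 (lab1 v) (lab2 w).
Hypothesis roots : eqv ch k (lab1 (tree_root t1)) (lab2 (tree_root t2)).

Lemma meq_children v w : eqv ch k (lab1 v) (lab2 w) ->
  meq (tlt ch k) (map lab1 (cs1 v)) (map lab2 (cs2 w)).
Proof.
have [_ _ l1] := L1; have [_ _ l2] := L2; move=> /stable/eqvS vw.
exact: meq_trans (meq_sym (l1 v k)) (meq_trans vw (l2 w k)).
Qed.

Lemma tree_mapP n v : depth v = n ->
  eqv ch k (lab1 v) (lab2 (tree_map n v)) /\ depth (tree_map n v) = n.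
Proof.
have [_ m1 _] := L1; have [_ m2 _] := L2.
elim: n v => [|n IHn] v dv /=; first by rewrite (depth_eq0 dv) depth_root.
have [vp dp] := parentP dv; have [e d] := IHn _ dp.
have vcs : v \in cs1 (parent v) by rewrite m1.
have [] := matching_spec (tlt_swo ch k) (fun _ => tree_root t2) (meq_children e) vcs.
by rewrite m2 => /depth_arc -> ?; rewrite d.
Qed.

Lemma tree_map_arc n v : depth v = n.+1 ->
  tree_arc (tree_map n.+1 v) (tree_map n (parent v)).
Proof.
have [_ m1 _] := L1; have [_ m2 _] := L2; move=> dv.
have [vp dp] := parentP dv; have [e d] := tree_mapP dp.
have vcs : v \in cs1 (parent v) by rewrite m1.
have [] := matching_spec (tlt_swo ch k) (fun _ => tree_root t2) (meq_children e) vcs.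
by rewrite m2.
Qed.

End TreeMap.

Lemma tree_mapK t1 t2 cs1 cs2 lab1 lab2 :
  @labelled O ch t1 cs1 lab1 -> @labelled O ch t2 cs2 lab2 ->
  (forall v w, eqv ch k (lab1 v) (lab2 w) -> eqv ch k.+1 (lab1 v) (lab2 w)) ->
  eqv ch k (lab1 (tree_root t1)) (lab2 (tree_root t2)) ->
  forall n v, depth v = n ->
  tree_map cs2 cs1 lab2 lab1 n (tree_map cs1 cs2 lab1 lab2 n v) = v.
Proof.
move=> L1 L2 st rt; have [u1 m1 _] := L1; have [u2 m2 _] := L2.
elim=> [|n IHn] v dv; first by rewrite (depth_eq0 dv).
have [vp dp] := parentP dv; have vcs : v \in cs1 (parent v) by rewrite m1.
have [e d] := tree_mapP L1 L2 st rt dp.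
have := tree_map_arc L1 L2 st rt dv => /parent_arc pE.
rewrite [LHS]/= pE (IHn _ dp).
exact: (matchingK (tlt_swo ch k)) (meq_children L1 L2 st e) _ vcs.
Qed.

(** By stability a tie at depth [k] between two vertices matches their children at the same depth
    [k], so the matching can be continued forever and no limit of finite isomorphisms is taken. *)
Lemma eqv_tree_iso t1 t2 cs1 cs2 lab1 lab2 :
  @labelled O ch t1 cs1 lab1 -> @labelled O ch t2 cs2 lab2 ->
  (forall v w, eqv ch k (lab1 v) (lab2 w) -> eqv ch k.+1 (lab1 v) (lab2 w)) ->
  eqv ch k (lab1 (tree_root t1)) (lab2 (tree_root t2)) -> tree_iso t1 t2.
Proof.
move=> L1 L2 st rt.
have st' v w : eqv ch k (lab2 v) (lab1 w) -> eqv ch k.+1 (lab2 v) (lab1 w).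
  by rewrite eqv_sym => /st; rewrite eqv_sym.
have rt' : eqv ch k (lab2 (tree_root t2)) (lab1 (tree_root t1)) by rewrite eqv_sym.
pose phi v := tree_map cs1 cs2 lab1 lab2 (depth v) v.
pose psi v := tree_map cs2 cs1 lab2 lab1 (depth v) v.
have phi_depth v : depth (phi v) = depth v by have [] := tree_mapP L1 L2 st rt (erefl (depth v)).
have psi_depth v : depth (psi v) = depth v by have [] := tree_mapP L2 L1 st' rt' (erefl (depth v)).
have phiK : cancel phi psi.
  by move=> v; rewrite /psi phi_depth; apply: (tree_mapK L1 L2 st rt).
have psiK : cancel psi phi.
  by move=> v; rewrite /phi psi_depth; apply: (tree_mapK L2 L1 st' rt').
have phi_arc v n : depth v = n.+1 -> tree_arc (phi v) (phi (parent v)).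
  move=> dv; have [_ dp] := parentP dv; rewrite /phi dv dp.
  exact: tree_map_arc L1 L2 st rt _ _ dv.
exists phi; split; first by exists psi.
  by rewrite /phi depth_root.
move=> v w; apply/idP/idP => [vw|vw]; last first.
  by rewrite -(parent_arc vw); apply: phi_arc (depth_arc vw).
have dv := depth_arc vw; rewrite phi_depth in dv.
have := arc_functional (phi_arc _ _ dv) vw => /(can_inj phiK) <-.
by have [] := parentP dv.
Qed.

End TreeIso.

Lemma map_val_insub (T : Type) (P : pred T) (sT : subType P) (s : seq T) :
  all P s -> map val (pmap (insub : T -> option sT) s) = s.
Proof.
move=> /all_filterP Ps; rewrite (pmap_filter (@insubK _ _ _)) -[RHS]Ps.
by apply: eq_filter => x; rewrite /= isSome_insub.
Qed.

Section LabelledProduct.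
Variables (O : Type) (ch : O -> seq O) (mul : O -> O -> O).
Hypothesis ch_mul : forall a b, ch (mul a b) = [seq mul x y | x <- ch a, y <- ch b].
Variables (t1 t2 : rtree) (cs1 : vertex t1 -> seq (vertex t1)) (cs2 : vertex t2 -> seq (vertex t2)).
Variables (lab1 : vertex t1 -> O) (lab2 : vertex t2 -> O).

(** The vertices form a subtype, hence [insub]; no pair is lost, as children of vertices of equal
    depth have equal depth. *)
Definition mul_children (p : vertex (tree_mul t1 t2)) : seq (vertex (tree_mul t1 t2)) :=
  pmap insub [seq (x, y) | x <- cs1 (val p).1, y <- cs2 (val p).2].

Definition mul_label (p : vertex (tree_mul t1 t2)) : O :=
  mul (lab1 (val p).1) (lab2 (val p).2).

Lemma labelled_mul : labelled ch cs1 lab1 -> labelled ch cs2 lab2 ->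
  labelled ch mul_children mul_label.
Proof.
move=> [u1 m1 l1] [u2 m2 l2]; split=> [p|p q|p k].
- by apply: pmap_sub_uniq; apply: allpairs_uniq => // -[? ?] [? ?] _ _ [-> ->].
- rewrite mem_pmap_sub /= /prod_arc -m1 -m2; case: p q => [[x y] xy] [[z w] zw] /=.
  by apply/allpairsP/andP => [[[a b] [ain bin [-> ->]]] //|[xin yin]]; exists (x, y).
have -> : map mul_label (mul_children p) =
    [seq mul x y | x <- map lab1 (cs1 (val p).1), y <- map lab2 (cs2 (val p).2)].
  rewrite (map_comp (fun z => mul (lab1 z.1) (lab2 z.2)) val) map_val_insub.
    by rewrite map_allpairs allpairs_mapl allpairs_mapr.
  apply/allP => _ /allpairsP[[a b] [/= ain bin ->]].
  rewrite m1 in ain; rewrite m2 in bin; rewrite /same_depth /=.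
  by rewrite (depth_arc ain) (depth_arc bin); have := valP p.
have swok := tlt_swo ch k.
move=> t; rewrite /mul_label ch_mul !count_allpairs.
transitivity (\sum_(x <- ch (lab1 (val p).1)) \sum_(y <- map lab2 (cs2 (val p).2)) tie (tlt ch k) t (mul x y)).
  apply: eq_bigr => x _; rewrite -!count_sum; apply: (meq_count swok (l2 _ k)) => y z yz.
  by apply: eqv_eqr; apply: eqv_mul2l.
rewrite exchange_big [RHS]exchange_big /=; apply: eq_bigr => y _; rewrite -!count_sum.
apply: (meq_count swok (l1 _ k)) => x z xz.
by apply: eqv_eqr; apply: eqv_mul2r.
Qed.

End LabelledProduct.

Section LabelledUnroll.
Variable A : fdds.

Definition fdds_graph : graph := @Graph (state A) (enum (state A)) (@step A).

Lemma fdds_graph_wf : gwf fdds_graph.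
Proof. by split=> [|v _] /=; rewrite ?enum_uniq ?mem_enum. Qed.

Lemma mem_fdds_graph v : v \in gvs fdds_graph.
Proof. by rewrite mem_enum. Qed.

Lemma gper_fdds v : (v \in gper fdds_graph) = periodic v.
Proof.
apply/(gperP fdds_graph_wf)/idP => [[_ [[//|d] _ dv]]|].
  by rewrite /periodic -{2}dv iterSr; apply: fconnect_iter.
move=> /iter_findex dv; split; first exact: mem_fdds_graph.
by exists (findex (@step A) (step v) v).+1; rewrite // iterSr.
Qed.

Variables (O : Type) (ch : O -> seq O) (o : state A -> O).
Hypothesis oA : @model _ ch fdds_graph o.
Variable u : state A.

Definition unroll_children (x : vertex (unroll_tree u)) : seq (vertex (unroll_tree u)) :=
  pmap insub [seq (s, (val x).2.+1) | s <- @gpred fdds_graph (val x).1].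

Lemma labelled_unroll : labelled ch unroll_children (fun x => o (val x).1).
Proof.
split=> [x|y x|x k].
- apply: pmap_sub_uniq; rewrite map_inj_uniq; last by move=> ? ? [].
  exact: gpred_uniq fdds_graph_wf.
- rewrite mem_pmap_sub /= /unroll_arc; case: x y => [[s i] si] [[s' j] s'j] /=.
  apply/mapP/andP => [[s1]|[j0 /eqP[-> ->]]].
    by rewrite mem_filter => /andP[/eqP /= <- _] [-> ->].
  by exists s'; rewrite ?prednK // mem_filter /= eqxx mem_enum.
rewrite (map_comp (fun z => o z.1) val) map_val_insub; last first.
  apply/allP => _ /mapP[s + ->]; rewrite mem_filter => /andP[/eqP /= e _].
  by rewrite /leads_to_root /= -iterS iterSr e; exact: (valP x).
by rewrite -map_comp oA ?mem_fdds_graph // => t.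
Qed.

End LabelledUnroll.

(** * Tables of dynamical systems, and the equation on unrolls in terms of tables *)

Definition table (A : fdds) : seq nat := [seq val (enum_rank (step s)) | s <- enum (state A)].

Lemma enum_rank_index (T : finType) (x : T) : val (enum_rank x) = index x (enum T).
Proof.
by rewrite -{2}(nth_enum_rank x x) index_uniq ?enum_uniq // -cardE ltn_ord.
Qed.

Lemma tableE A : table A = relabel (fdds_graph A).
Proof. by apply: eq_map => s; rewrite enum_rank_index. Qed.

Definition fdds_label (A : fdds) (s : state A) : wtree :=
  leaf (table A) (index s (gvs (fdds_graph A))).

Lemma model_fdds A : @model _ wch (fdds_graph A) (@fdds_label A).
Proof.
by rewrite /fdds_label tableE; apply: model_relabel; apply: fdds_graph_wf.
Qed.

Lemma forest_of_table A : forest_of (table A) = map (@fdds_label A) (gper (fdds_graph A)).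
Proof.
rewrite /fdds_label tableE /forest_of map_gper_relabel //; exact: fdds_graph_wf.
Qed.

Lemma valid_table_fdds A : valid_table (table A).
Proof. by rewrite tableE; apply: valid_relabel; apply: fdds_graph_wf. Qed.

Section ForestEq.
Variables A X B : fdds.

Let labelled_AX a x := labelled_mul wch_cat
  (labelled_unroll (@model_fdds A) a) (labelled_unroll (@model_fdds X) x).

Let n := size (gvs (fdds_graph B)) + size (gvs (gprod (fdds_graph A) (fdds_graph X))).

(** Every vertex of an unroll tree is labelled by a state of a finite system, so one depth is stable
    for all the infinitely many vertices. *)
Let stable k a x b : n * n <= k ->
  eqv wch k (fdds_label a ++ fdds_label x) (@fdds_label B b) ->
  forall j, eqv wch j (@fdds_label A a ++ @fdds_label X x) (fdds_label b).
Proof.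
move=> nk; rewrite eqv_sym => e j; rewrite eqv_sym.
have M := model_prod wch_cat (@model_fdds A) (@model_fdds X).
have axG : (a, x) \in gvs (gprod (fdds_graph A) (fdds_graph X)).
  by have := @mem_gprod (fdds_graph A) (fdds_graph X) a x; rewrite !mem_fdds_graph.
exact: (@eqv_stable2 _ wch (fdds_graph B) (gprod (fdds_graph A) (fdds_graph X)) _ _
  k j b (a, x) (@model_fdds B) M (mem_fdds_graph b) axG nk e).
Qed.

Lemma tree_iso_unrollP a x b :
  tree_iso (tree_mul (unroll_tree a) (unroll_tree x)) (unroll_tree b) <->
  forall k, eqv wch k (@fdds_label A a ++ @fdds_label X x) (@fdds_label B b).
Proof.
split=> [iso k|e].
  exact: tree_iso_eqv (labelled_AX a x) (labelled_unroll (@model_fdds B) b) iso k.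
apply: (eqv_tree_iso (k := n * n) (labelled_AX a x) (labelled_unroll (@model_fdds B) b)).
  move=> v w vw.
  exact: (@stable (n * n) (val (val v).1).1 (val (val v).2).1 (val w).1 (leqnn _) vw).
exact: e.
Qed.

Theorem forest_eqP :
  forest_eq (forest_mul (unroll A) (unroll X)) (unroll B) <->
  divides (table A) (table X) (table B).
Proof.
pose SA := {u : state A | periodic u}; pose SX := {u : state X | periodic u}.
pose SB := {u : state B | periodic u}.
pose g (i : SA * SX) : wtree := fdds_label (val i.1) ++ fdds_label (val i.2).
pose h (i : SB) : wtree := fdds_label (val i).
have per_enum (C : fdds) : perm_eq (gper (fdds_graph C)) (map val (enum {: {u : state C | periodic u}})).
  apply: uniq_perm; first exact: gper_uniq (fdds_graph_wf C).
    by rewrite map_inj_uniq ?enum_uniq //; apply: val_inj.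
  move=> v; rewrite gper_fdds; apply/idP/mapP => [vP|[w _ ->]]; last exact: (valP w).
  by exists (Sub v vP); rewrite ?mem_enum.
have hE k : meq (tlt wch k) (forest_of (table B)) (map h (enum {: SB})).
  by rewrite forest_of_table (map_comp (@fdds_label B) val); apply: meq_perm; apply: per_enum.
have gE k : meq (tlt wch k) [seq x ++ y | x <- forest_of (table A), y <- forest_of (table X)]
    (map g (enum {: SA * SX})).
  rewrite !forest_of_table allpairs_mapl allpairs_mapr.
  rewrite -(map_allpairs (fun p => fdds_label p.1 ++ fdds_label p.2) pair).
  rewrite (map_comp (fun p => fdds_label p.1 ++ fdds_label p.2) (fun i : SA * SX => (val i.1, val i.2))).
  apply: meq_perm; apply: uniq_perm.
  - apply: allpairs_uniq; [exact: gper_uniq (fdds_graph_wf A)|exact: gper_uniq (fdds_graph_wf X)|].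
    by move=> [? ?] [? ?] _ _ [-> ->].
  - rewrite map_inj_uniq ?enum_uniq // => -[i1 i2] [j1 j2] [] /= /val_inj -> /val_inj ->.
    by [].
  move=> p; apply/allpairsP/mapP => [[[a x] [/= aP xP ->]]|[[i j] _ ->]].
    rewrite gper_fdds in aP; rewrite gper_fdds in xP.
    by exists (Sub a aP, Sub x xP); rewrite ?mem_enum.
  by exists (val i, val j); rewrite /= !gper_fdds (valP i) (valP j).
have sameE : (exists k, meq (tlt wch k) (map g (enum {: SA * SX})) (map h (enum {: SB}))) ->
    size (enum {: SA * SX}) = size (enum {: SB}).
  by move=> [k /(meq_size (tlt_swo wch k))]; rewrite !size_map.
split=> [[sigma sigma_bij iso] k|div].
  apply: meq_trans (hE k) _; apply: meq_trans (meq_sym (gE k)).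
  have P : perm_eq (map sigma (enum {: SA * SX})) (enum {: SB}).
    apply: uniq_perm; rewrite ?enum_uniq //.
      by rewrite map_inj_uniq ?enum_uniq //; apply: bij_inj.
    move=> y; rewrite mem_enum; have [rho _ rhoK] := sigma_bij.
    by rewrite -(rhoK y) map_f ?mem_enum.
  apply: meq_sym; apply: meq_trans (meq_perm (tlt wch k) h P) => t.
  rewrite -map_comp !count_map; apply: eq_count => i /=.
  by apply: eqv_eqr; apply: (iffLR (tree_iso_unrollP _ _ _) (iso i)).
have M : meq (tlt wch (n * n)) (map g (enum {: SA * SX})) (map h (enum {: SB})).
  exact: meq_trans (meq_sym (gE _)) (meq_trans (meq_sym (div _)) (hE _)).
have es : #|{: SA * SX}| = #|{: SB}| by rewrite !cardE; apply: sameE; exists (n * n).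
(* [matching] needs default values; as the types may be empty they are taken from the equality of
   cardinals, and the matching never returns them. *)
have y0 (i : SA * SX) : SB.
  by apply: (enum_val (cast_ord es (enum_rank i))).
have x0 (i : SB) : SA * SX.
  by apply: (enum_val (cast_ord (esym es) (enum_rank i))).
have swon := tlt_swo wch (n * n).
exists (matching (tlt wch (n * n)) y0 g h (enum {: SA * SX}) (enum {: SB})).
  exists (matching (tlt wch (n * n)) x0 h g (enum {: SB}) (enum {: SA * SX})) => i.
    by apply: (matchingK swon); rewrite ?enum_uniq ?mem_enum.
  by apply: (matchingK swon); rewrite ?enum_uniq ?mem_enum //; apply: meq_sym.
move=> i; apply/tree_iso_unrollP => k; apply: (@stable (n * n)) => //.
by have [] := matching_spec swon y0 M (mem_enum _ i).
Qed.

End ForestEq.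

(** The default of [insubd] is never reached for a valid table. *)
Definition fdds_of (t : seq nat) : fdds :=
  @FDDS 'I_(size t) (fun i => insubd i (nth 0 t i)).

Lemma table_fdds_of t : valid_table t -> table (fdds_of t) = t.
Proof.
move=> /allP tv; rewrite -[RHS](mkseq_nth 0) /mkseq -val_enum_ord -map_comp.
apply: eq_map => i /=; rewrite enum_rank_ord /=.
by apply: etrans (val_insubd _ _) _; rewrite tv ?mem_nth.
Qed.

Lemma code_fddsE A : code_fdds A = code (table A).
Proof. by []. Qed.

Lemma csize_table A : csize (table A) <= (fdds_size A * (fdds_size A + fdds_size A + 2)).+1.
Proof.
rewrite csize_seqE ltnS big_map.
apply: (@leq_trans (\sum_(s <- enum (state A)) (fdds_size A + fdds_size A + 2))).
  apply: leq_sum => s _; rewrite csize_nat.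
  have : val (enum_rank (step s)) < fdds_size A := ltn_ord _.
  lia.
by rewrite big_const_seq count_predT iter_addn_0 -cardE mulnC.
Qed.

Theorem theorem6 :
  exists (p : program) (c d : nat),
  forall A B : fdds,
  exists (r : option fdds) (time : nat),
    [/\ runs p (Node (code_fdds A) (code_fdds B)) (code_answer r) time,
        time <= c * (fdds_size A + fdds_size B) ^ d + c
      & match r with
        | Some X => forest_eq (forest_mul (unroll A) (unroll X)) (unroll B)
        | None => forall X : fdds,
            ~ forest_eq (forest_mul (unroll A) (unroll X)) (unroll B)
        end].
Proof.
have [p [q [_ qP run]]] := pt_answer.
(* [s n] bounds the code of a table with [n] states, as in [csize_table]; pairing the two codes adds
   one node. *)
pose s n := (n * (n + n + 2)).+1.
have sP : poly s by rewrite /s; poly_tac.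
have [c [d cd]] : exists c d, forall n, q (s n + s n).+1 <= c * n ^ d + c.
  by apply: (@poly_bound (fun n => q (s n + s n).+1)); poly_tac.
exists p, c, d => A B; have [time [runAB timeq _]] := run (table A, table B).
exists (omap fdds_of (answer (table A) (table B))), time.
have le : time <= c * (fdds_size A + fdds_size B) ^ d + c.
  apply: leq_trans timeq (leq_trans (poly_leq qP _) (cd _)).
  rewrite csize_pair ltnS leq_add // (leq_trans (csize_table _)) // poly_leq //.
    exact: leq_addr.
  exact: leq_addl.
have := answerP (valid_table_fdds A) (valid_table_fdds B).
case E : (answer _ _) => [tX|] /=; rewrite E in runAB.
  move=> [Xv div]; split.
  - by rewrite (code_fddsE (fdds_of tX)) table_fdds_of.
  - exact: le.
  by apply/forest_eqP; rewrite table_fdds_of.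
move=> nodiv; split=> // X /forest_eqP.
exact: nodiv (valid_table_fdds X).
Qed.
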